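(* Let $c=1$, $r^*=r-1$. Define $$\Phi_-(z)=\;:\exp\Big(-\sum_{m\neq0}\frac{1}{[2m]_q-[m]_q}\,\beta_m z^{-m}\Big):\;e^{\hat\alpha}\,z^{h/2+1/2}\,z^{-P/r-h/2r-1/r},$$ $$\Psi^*_-(z)=\;:\exp\Big(\sum_{m\neq0}\frac{1}{[2m]_q-[m]_q}\,\alpha_m z^{-m}\Big):\;e^{-\hat\alpha}\,z^{-h/2+1/2}\,e^{Q}\,z^{P/r^*+1/r^*}.$$ Write $\Phi_-(u)=\Phi_-(z)$, $\Psi^*_-(u)=\Psi^*_-(z)$, $E(u)=E(z)$, $F(u)=F(z)$, $K_-^+(u)=K(q^{r+1}z)^{-1}$ for $z=q^{2u}$. Then $\Phi_-$ and $\Psi_-^*$ realize the highest components of the type-I and type-II vertex operators of the level-one elliptic algebra $U_{q,p}(A_2^{(2)})$, i.e. they satisfy the conditions determining these components: (type I) $$\Phi_-(u_2+\tfrac12)\,K_-^+(u_1)=\rho^+(u_1-u_2)\,K_-^+(u_1)\,\Phi_-(u_2+\tfrac12),$$ $$\Phi_-(u_1)E(u_2)=E(u_2)\Phi_-(u_1),\qquad [\Phi_-(u),P]=0,$$ $$\Phi_-(u_1)F(u_2)=-\frac{[u_1-u_2+\frac12]}{[u_1-u_2-\frac12]}\,F(u_2)\Phi_-(u_1);$$ (type II) $$\Psi^*_-(u_2+1)\,K_-^+(u_1)\,\rho^{+*}(u_1-u_2)=K_-^+(u_1)\,\Psi^*_-(u_2+1),$$ $$\Psi^*_-(u_1)F(u_2)=F(u_2)\Psi^*_-(u_1),\qquad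 [\Psi^*_-(u),P+\tfrac h2]=0,$$ $$\Psi^*_-(u_1)E(u_2)=-\frac{[u_1-u_2-\frac12]^*}{[u_1-u_2+\frac12]^*}\,E(u_2)\Psi^*_-(u_1).$$
   Context: Fix $0<q<1$ and reals $r,r^*>0$ with $r^*=r-c$, here $c=1$. Put $p=q^{2r}$, $p^*=q^{2r^*}$, $[n]_q=\frac{q^n-q^{-n}}{q-q^{-1}}$, $(z;t_1,\dots,t_k)_\infty=\prod_{n_1,\dots,n_k\ge0}(1-zt_1^{n_1}\cdots t_k^{n_k})$, $\Theta_p(z)=(z;p)_\infty(pz^{-1};p)_\infty(p;p)_\infty$, $[u]=q^{u^2/r-u}\Theta_p(q^{2u})$, $[u]^*=[u]|_{r\to r^*}$ (so $p\to p^*$). With $\{z\}=(z;p,q^6)_\infty$ and $z=q^{2u}$, $$\rho^+(u)=-qz^{1/r}\frac{\{pq^2z\}\{pq^3z\}^2\{pq^4z\}\{1/z\}\{q/z\}\{q^5/z\}\{q^6/z\}}{\{pz\}\{pqz\}\{pq^5z\}\{pq^6z\}\{q^2/z\}\{q^3/z\}^2\{q^4/z\}},\qquad \rho^{+*}=\rho^+|_{r\to r^*}.$$ Bosons: $\alpha_m$ ($m\in\mathbb Z_{\ne0}$) with $[\alpha_m,\alpha_n]=\delta_{m+n,0}\frac{[2m]_q-[m]_q}{m}\frac{[m]_q[rm]_q}{[r^*m]_q}$ (the case $c=1$), and $\beta_m=\frac{[r^*m]_q}{[rm]_q}\alpha_m$. Zero modes: $h,\hat\alpha,P,Q$ with $[h,\hat\alpha]=2$,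 $[P,Q]=1$, $[Q,\hat\alpha]=\pi i$, $[P,\hat\alpha]=0$, $[h,P]=[h,Q]=0$, all commuting with the $\alpha_m$; thus e.g. $e^{Q}e^{\hat\alpha}=-e^{\hat\alpha}e^{Q}$. The symbol $:\ :$ is normal ordering (modes with $m<0$ to the left of modes with $m>0$). Level-one currents of $U_{q,p}(A_2^{(2)})$ (with $\epsilon(q)=(q^{1/2}+q^{-1/2})^{-1/2}$): $$E(z)=\epsilon(q):\exp\Big(-\sum_{m\ne0}\frac{\alpha_m}{[m]_q}z^{-m}\Big):e^{\hat\alpha}z^{h/2+1/2}e^{-Q}z^{-P/r^*},$$ $$F(z)=\epsilon(q):\exp\Big(\sum_{m\ne0}\frac{\beta_m}{[m]_q}z^{-m}\Big):e^{-\hat\alpha}z^{-h/2+1/2}z^{P/r+h/2r},$$ $$K(z)=:\exp\Big(-\sum_{m\ne0}\frac{[m]_q}{[rm]_q([2m]_q-[m]_q)}\alpha_mz^{-m}\Big):e^{-Q}z^{(1/r-1/r^* )P+h/2r}.$$ The displayed relations are exchange relations: each product is brought to normal-ordered form and the resulting scalar factors are compared as meromorphic functions (after analytic continuation). *)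

(* Defs.v *)
From Stdlib Require Import Reals ZArith List Lra Lia FunctionalExtensionality.
From Coquelicot Require Import Coquelicot.
Import ListNotations.
Open Scope R_scope.

Definition Cexp (w : C) : C :=
  (exp (Re w) * cos (Im w), exp (Re w) * sin (Im w)).

(** [q^w] for real [q > 0] and complex [w].  The spectral parameter is always
    the additive one: [z = q^(2u)], so that [z^a := q^(2ua)] carries no choice
    of branch. *)
Definition qpow (q : R) (w : C) : C := Cexp (w * RtoC (ln q))%C.
Definition zpow (q : R) (u a : C) : C := qpow q (RtoC 2 * u * a)%C.

Definition Clim (s : nat -> C) : C :=
  (real (Lim_seq (fun n => Re (s n))), real (Lim_seq (fun n => Im (s n)))).

Fixpoint Cprod (a : nat -> C) (N : nat) : C :=
  match N with O => RtoC 1 | S N' => (Cprod a N' * a N')%C end.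

Definition Cprod_inf (a : nat -> C) : C := Clim (Cprod a).

(** [(z; t_1, ..., t_k)_infinity], as an iterated infinite product. *)
Fixpoint qpoch (z : C) (ts : list R) : C :=
  match ts with
  | [] => (RtoC 1 - z)%C
  | t :: ts' => Cprod_inf (fun n => qpoch (z * RtoC (t ^ n)) ts')
  end.

Definition entire (f : C -> C) : Prop :=
  forall u : C, @ex_derive C_AbsRing C_NormedModule f u.

Definition nonzero_entire (d : C -> C) : Prop :=
  entire d /\ exists u, d u <> RtoC 0.

(** The meromorphic functions on [C] are the quotients of entire functions;
    the values of [g] on the zeros of the chosen denominator are irrelevant. *)
Definition meromorphic (g : C -> C) : Prop :=
  exists a d, entire a /\ nonzero_entire d /\
    forall u, d u <> RtoC 0 -> g u = (a u / d u)%C.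

Definition mero_eq (f g : C -> C) : Prop :=
  exists d, nonzero_entire d /\ forall u, d u <> RtoC 0 -> f u = g u.

Definition qnum (q x : R) : R :=
  (Rpower q x - Rpower q (- x)) / (q - / q).

Definition nome (q r : R) : R := Rpower q (2 * r).

Definition Theta (p : R) (z : C) : C :=
  (qpoch z [p] * qpoch (RtoC p / z) [p] * qpoch (RtoC p) [p])%C.

(** [theta q r u] is [[u]], and [theta q (r - 1) u] is [[u]^*]. *)
Definition theta (q r : R) (u : C) : C :=
  (qpow q (u * u / RtoC r - u) * Theta (nome q r) (qpow q (RtoC 2 * u)))%C.

Definition rho (q r : R) (u : C) : C :=
  let p := RtoC (nome q r) in
  let z := qpow q (RtoC 2 * u)%C in
  let qq := RtoC q in
  let br := fun x : C => qpoch x [nome q r; q ^ 6] in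
  (- qq * zpow q u (RtoC (/ r))
   * ((br (p * qq ^ 2 * z) * (br (p * qq ^ 3 * z)) ^ 2 * br (p * qq ^ 4 * z)
       * br (/ z) * br (qq / z) * br (qq ^ 5 / z) * br (qq ^ 6 / z))
      / (br (p * z) * br (p * qq * z) * br (p * qq ^ 5 * z) * br (p * qq ^ 6 * z)
         * br (qq ^ 2 / z) * (br (qq ^ 3 / z)) ^ 2 * br (qq ^ 4 / z))))%C.

Definition occ : Type := positive -> nat.

Definition incr (m : positive) (n : occ) : occ :=
  fun k => if Pos.eqb k m then S (n k) else n k.
Definition decr (m : positive) (n : occ) : occ :=
  fun k => if Pos.eqb k m then Nat.pred (n k) else n k.

Definition finite_occ (n : occ) : Prop :=
  exists N : positive, forall m, (N < m)%positive -> n m = O.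

(** [v : state] is the possibly infinite formal combination with coefficients
    [v n i j] on [prod_m alpha_{-m}^(n m) e^(i alphahat) e^(j Q) |h0, P0>],
    where [alpha_m |h0, P0> = 0] for [m > 0], [h |h0, P0> = h0 |h0, P0>] and
    [P |h0, P0> = P0 |h0, P0>].  Only the values at [n] with finite support are
    meaningful. *)
Definition state : Type := occ -> Z -> Z -> C.

Definition finite_vector (v : state) : Prop :=
  exists N : positive, forall n i j, v n i j <> RtoC 0 ->
    (forall m, (n m <= Pos.to_nat N)%nat) /\
    (forall m, (N < m)%positive -> n m = O) /\
    (Z.abs i <= Zpos N)%Z /\ (Z.abs j <= Zpos N)%Z.

(** [[alpha_m, alpha_n] = delta_{m+n,0} kappa m], at [c = 1], [r^* = r - 1]. *)
Definition kappa (q r : R) (m : Z) : R :=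
  (qnum q (2 * IZR m) - qnum q (IZR m)) / IZR m
  * (qnum q (IZR m) * qnum q (r * IZR m) / qnum q ((r - 1) * IZR m)).

Definition alpha (q r : R) (m : Z) (v : state) : state :=
  fun n i j =>
    match m with
    | Z0 => RtoC 0
    | Zneg k => match n k with O => RtoC 0 | S _ => v (decr k n) i j end
    | Zpos k => (RtoC (kappa q r m * INR (S (n k))) * v (incr k n) i j)%C
    end.

Definition beta (q r : R) (m : Z) (v : state) : state :=
  fun n i j =>
    (RtoC (qnum q ((r - 1) * IZR m) / qnum q (r * IZR m)) * alpha q r m v n i j)%C.

Definition hP_fun (h0 P0 : C) (f : C -> C -> C) (v : state) : state :=
  fun n i j =>
    (f (h0 + RtoC (2 * IZR i)) (P0 + RtoC (IZR j)) * v n i j)%C.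

Definition exp_alphahat (k : Z) (v : state) : state :=
  fun n i j => v n (i - k)%Z j.

(** [e^(kQ)]; the sign comes from [e^(kQ) e^(i alphahat) =
    (-1)^(ki) e^(i alphahat) e^(kQ)]. *)
Definition exp_Q (k : Z) (v : state) : state :=
  fun n i j =>
    (RtoC (if Z.even (k * i) then 1 else -1) * v n i (j - k)%Z)%C.

(** [T v w] reads: every series occurring in the evaluation of [T] on [v]
    converges coefficientwise, and the result is [w]. *)
Definition op : Type := state -> state -> Prop.

Definition lift (T : state -> state) : op := fun v w => w = T v.

Definition comp (A B : op) : op := fun v w => exists x, B v x /\ A x w.
Infix "∘" := comp (at level 40, left associativity).

Definition scale (c : C) (A : op) : op :=
  fun v w => exists x, A v x /\ w = (fun n i j => (c * x n i j)%C).

(** [sum_{m > 0} a_{sg m} T_{sg m} z^(- sg m)], with [sg] one of [Zpos], [Zneg]. *)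
Definition mode_sum (q : R) (sg : positive -> Z)
    (T : Z -> state -> state) (a : Z -> R) (u : C) : op :=
  fun v w => forall n i j, finite_occ n ->
    @is_series C_AbsRing C_NormedModule
      (fun k => let m := sg (Pos.of_succ_nat k) in
         RtoC (a m) * zpow q u (RtoC (- IZR m)) * T m v n i j)%C
      (w n i j).

(** [exp A = sum_k A^k / k!] *)
Definition op_exp (A : op) : op :=
  fun v w => exists x : nat -> state,
    x O = v /\ (forall k, A (x k) (x (S k))) /\
    forall n i j, finite_occ n ->
      @is_series C_AbsRing C_NormedModule
        (fun k => RtoC (/ INR (fact k)) * x k n i j)%C (w n i j).

(** [: exp (sum_{m <> 0} a_m T_m z^(-m)) :] *)
Definition normal_exp (q : R) (T : Z -> state -> state) (a : Z -> R) (u : C) : op :=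
  op_exp (mode_sum q Zneg T a u) ∘ op_exp (mode_sum q Zpos T a u).

(** [z^(f(h, P))] *)
Definition zpow_hP (q : R) (h0 P0 u : C) (f : C -> C -> C) : op :=
  lift (hP_fun h0 P0 (fun h P => zpow q u (f h P))).

Definition eps (q : R) : R :=
  Rpower (Rpower q (1 / 2) + Rpower q (- (1 / 2))) (- (1 / 2)).

Definition currE (q r : R) (h0 P0 u : C) : op :=
  scale (RtoC (eps q))
    (normal_exp q (alpha q r) (fun m => - / qnum q (IZR m)) u
     ∘ lift (exp_alphahat 1)
     ∘ zpow_hP q h0 P0 u (fun h _ => h / RtoC 2 + RtoC (1 / 2))%C
     ∘ lift (exp_Q (-1))
     ∘ zpow_hP q h0 P0 u (fun _ P => - (P / RtoC (r - 1)))%C).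

Definition currF (q r : R) (h0 P0 u : C) : op :=
  scale (RtoC (eps q))
    (normal_exp q (beta q r) (fun m => / qnum q (IZR m)) u
     ∘ lift (exp_alphahat (-1))
     ∘ zpow_hP q h0 P0 u (fun h _ => - (h / RtoC 2) + RtoC (1 / 2))%C
     ∘ zpow_hP q h0 P0 u (fun h P => P / RtoC r + h / RtoC (2 * r))%C).

Definition coefK (q r : R) (m : Z) : R :=
  - (qnum q (IZR m)
     / (qnum q (r * IZR m) * (qnum q (2 * IZR m) - qnum q (IZR m)))).

Definition expoK (r : R) (h P : C) : C :=
  (RtoC (/ r - / (r - 1)) * P + h / RtoC (2 * r))%C.

Definition currK (q r : R) (h0 P0 u : C) : op :=
  normal_exp q (alpha q r) (coefK q r) u
  ∘ lift (exp_Q (-1))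
  ∘ zpow_hP q h0 P0 u (expoK r).

(** [K(z)^(-1)]: the inverses of the factors of [currK], in reverse order.
    Note that it is not normally ordered. *)
Definition currK_inv (q r : R) (h0 P0 u : C) : op :=
  zpow_hP q h0 P0 u (fun h P => - expoK r h P)%C
  ∘ lift (exp_Q 1)
  ∘ op_exp (mode_sum q Zpos (alpha q r) (fun m => - coefK q r m) u)
  ∘ op_exp (mode_sum q Zneg (alpha q r) (fun m => - coefK q r m) u).

(** [K_-^+(u) = K(q^(r+1) z)^(-1)]; [q^(r+1) z = q^(2(u + (r+1)/2))]. *)
Definition Kmp (q r : R) (h0 P0 u : C) : op :=
  currK_inv q r h0 P0 (u + RtoC ((r + 1) / 2))%C.

Definition Phi_minus (q r : R) (h0 P0 u : C) : op :=
  normal_exp q (beta q r)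
    (fun m => - / (qnum q (2 * IZR m) - qnum q (IZR m))) u
  ∘ lift (exp_alphahat 1)
  ∘ zpow_hP q h0 P0 u (fun h _ => h / RtoC 2 + RtoC (1 / 2))%C
  ∘ zpow_hP q h0 P0 u
      (fun h P => - (P / RtoC r) - h / RtoC (2 * r) - RtoC (1 / r))%C.

Definition Psi_minus_star (q r : R) (h0 P0 u : C) : op :=
  normal_exp q (alpha q r)
    (fun m => / (qnum q (2 * IZR m) - qnum q (IZR m))) u
  ∘ lift (exp_alphahat (-1))
  ∘ zpow_hP q h0 P0 u (fun h _ => - (h / RtoC 2) + RtoC (1 / 2))%C
  ∘ lift (exp_Q 1)
  ∘ zpow_hP q h0 P0 u (fun _ P => P / RtoC (r - 1) + RtoC (1 / (r - 1)))%C.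

Definition coefficient (A : op) (v : state) (n : occ) (i j : Z) (c : C) : Prop :=
  exists w, A v w /\ w n i j = c.

(** [f(u1 - u2) X(u1) Y(u2) = g(u1 - u2) Y(u2) X(u1)] after analytic
    continuation.  Since [0 < q < 1], [|z1| > |z2|] means [Re u1 < Re u2].  The
    matrix coefficients of [X(u1) Y(u2)] are given by convergent series for
    [|z1| >> |z2|], those of [Y(u2) X(u1)] for [|z1| << |z2|]; what is compared
    are their (unique) meromorphic continuations [G12], [G21] in [u1]. *)
Definition exchange (f : C -> C) (X Y : C -> op) (g : C -> C) : Prop :=
  exists M : R, forall (u2 : C) (v : state) (n : occ) (i j : Z),
    finite_vector v -> finite_occ n ->
    exists G12 G21 : C -> C,
      meromorphic G12 /\ meromorphic G21 /\
      (forall u1, Re u1 < Re u2 - M ->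
         coefficient (X u1 ∘ Y u2) v n i j (G12 u1)) /\
      (forall u1, Re u1 > Re u2 + M ->
         coefficient (Y u2 ∘ X u1) v n i j (G21 u1)) /\
      mero_eq (fun u1 => f (u1 - u2)%C * G12 u1)%C
              (fun u1 => g (u1 - u2)%C * G21 u1)%C.

(** [[A, D] = 0] on the Fock space. *)
Definition commutes (A : op) (D : state -> state) : Prop :=
  forall v, finite_vector v -> exists w, A v w /\ A (D v) (D w).

Lemma incr_decr (m : positive) (n : occ) :
  n m <> O -> incr m (decr m n) = n.
Proof.
  intros H; apply functional_extensionality; intros k; unfold incr, decr.
  destruct (Pos.eqb_spec k m) as [->|]; [lia | reflexivity].
Qed.

Lemma decr_incr (m : positive) (n : occ) : decr m (incr m n) = n.
Proof.
  apply functional_extensionality; intros k; unfold incr, decr.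
  destruct (Pos.eqb k m); reflexivity.
Qed.

Lemma incr_comm (k m : positive) (n : occ) :
  incr k (incr m n) = incr m (incr k n).
Proof.
  apply functional_extensionality; intros l; unfold incr.
  destruct (Pos.eqb l k), (Pos.eqb l m); reflexivity.
Qed.

Lemma decr_comm (k m : positive) (n : occ) :
  decr k (decr m n) = decr m (decr k n).
Proof.
  apply functional_extensionality; intros l; unfold decr.
  destruct (Pos.eqb l k), (Pos.eqb l m); reflexivity.
Qed.

Lemma incr_decr_comm (k m : positive) (n : occ) :
  k <> m -> incr k (decr m n) = decr m (incr k n).
Proof.
  intros H; apply functional_extensionality; intros l; unfold decr, incr.
  destruct (Pos.eqb_spec l k), (Pos.eqb_spec l m); congruence.
Qed.

Lemma incr_same (m : positive) (n : occ) : incr m n m = S (n m).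
Proof. unfold incr; now rewrite Pos.eqb_refl. Qed.

Lemma decr_same (m : positive) (n : occ) : decr m n m = Nat.pred (n m).
Proof. unfold decr; now rewrite Pos.eqb_refl. Qed.

Lemma incr_other (k m : positive) (n : occ) : k <> m -> incr m n k = n k.
Proof. intros H; unfold incr; destruct (Pos.eqb_spec k m); congruence. Qed.

Lemma decr_other (k m : positive) (n : occ) : k <> m -> decr m n k = n k.
Proof. intros H; unfold decr; destruct (Pos.eqb_spec k m); congruence. Qed.

Lemma qnum_opp (q x : R) : qnum q (- x) = - qnum q x.
Proof. unfold qnum; rewrite Ropp_involutive; unfold Rdiv; ring. Qed.

Lemma kappa_opp (q r : R) (m : Z) : kappa q r (- m) = - kappa q r m.
Proof.
  unfold kappa; rewrite opp_IZR, <- !Ropp_mult_distr_r, !qnum_opp.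
  unfold Rdiv; rewrite !Rinv_opp; ring.
Qed.

Lemma alpha_alpha (q r : R) (l m : Z) (v : state) (n : occ) (i j : Z) :
  l <> 0%Z -> m <> 0%Z ->
  (alpha q r l (alpha q r m v) n i j - alpha q r m (alpha q r l v) n i j
   = RtoC (if Z.eqb (l + m) 0 then kappa q r l else 0) * v n i j)%C.
Proof.
  assert (pn : forall a b : positive,
    (alpha q r (Zpos a) (alpha q r (Zneg b) v) n i j
     - alpha q r (Zneg b) (alpha q r (Zpos a) v) n i j
     = RtoC (if Z.eqb (Zpos a + Zneg b) 0 then kappa q r (Zpos a) else 0)
       * v n i j)%C).
  { intros a b; cbv beta iota delta [alpha].
    destruct (Pos.eq_dec a b) as [<-|H].
    - replace (Zpos a + Zneg a)%Z with 0%Z by lia; simpl Z.eqb; cbv iota.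
      rewrite incr_same, decr_incr.
      destruct (n a) as [|x] eqn:E.
      + rewrite Rmult_1_r; ring.
      + rewrite decr_same, E, incr_decr by congruence.
        rewrite !RtoC_mult, (S_INR (S x)), RtoC_plus; simpl Nat.pred; ring.
    - rewrite (proj2 (Z.eqb_neq _ _)) by lia.
      rewrite (incr_other b a) by congruence.
      destruct (n b) as [|x] eqn:E; [ring|].
      rewrite (decr_other a b), incr_decr_comm by congruence; ring. }
  intros Hl Hm; destruct l as [|a|a], m as [|b|b]; try congruence.
  - rewrite (proj2 (Z.eqb_neq _ _)) by lia; cbv beta iota delta [alpha].
    destruct (Pos.eq_dec a b) as [<-|H]; [ring|].
    rewrite !incr_other, (incr_comm a b), !RtoC_mult by congruence; ring.
  - apply pn.
  - specialize (pn b a); rewrite Z.add_comm in pn.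
    replace (kappa q r (Zneg a)) with (- kappa q r (Zpos a))
      by (rewrite <- kappa_opp; reflexivity).
    transitivity (- (alpha q r (Zpos b) (alpha q r (Zneg a) v) n i j
      - alpha q r (Zneg a) (alpha q r (Zpos b) v) n i j))%C; [ring|].
    rewrite pn; destruct (Z.eqb_spec (Zneg a + Zpos b) 0) as [e|]; [|ring].
    replace b with a by lia; rewrite RtoC_opp; ring.
  - rewrite (proj2 (Z.eqb_neq _ _)) by lia; cbv beta iota delta [alpha].
    destruct (Pos.eq_dec a b) as [<-|H]; [ring|].
    destruct (n a) eqn:E, (n b) eqn:E'; rewrite ?decr_other, ?E, ?E' by congruence;
      try ring.
    rewrite (decr_comm a b); ring.
Qed.

Lemma exp_Q_exp_alphahat (v : state) (n : occ) (i j : Z) :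
  exp_Q 1 (exp_alphahat 1 v) n i j = (- exp_alphahat 1 (exp_Q 1 v) n i j)%C.
Proof.
  unfold exp_Q, exp_alphahat; rewrite !Z.mul_1_l, Z.even_sub; simpl.
  destruct (Z.even i); simpl; ring.
Qed.

(** [e^alphahat f(h) = f(h - 2) e^alphahat] and
    [e^Q f(P) = f(P - 1) e^Q], for arbitrary [f]. *)
Lemma exp_alphahat_hP (h0 P0 : C) (f : C -> C -> C) (v : state) (n : occ) (i j : Z) :
  exp_alphahat 1 (hP_fun h0 P0 f v) n i j
  = hP_fun h0 P0 (fun h P => f (h - RtoC 2)%C P) (exp_alphahat 1 v) n i j.
Proof.
  unfold exp_alphahat, hP_fun; rewrite minus_IZR.
  do 2 f_equal; apply injective_projections; simpl; ring.
Qed.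

Lemma exp_Q_hP (h0 P0 : C) (f : C -> C -> C) (v : state) (n : occ) (i j : Z) :
  exp_Q 1 (hP_fun h0 P0 f v) n i j
  = hP_fun h0 P0 (fun h P => f h (P - RtoC 1)%C) (exp_Q 1 v) n i j.
Proof.
  unfold exp_Q, hP_fun; rewrite minus_IZR.
  replace (P0 + RtoC (IZR j - 1))%C with (P0 + RtoC (IZR j) - RtoC 1)%C
    by (apply injective_projections; simpl; ring).
  ring.
Qed.

Lemma exp_Q_inv (v : state) (n : occ) (i j : Z) :
  exp_Q (-1) (exp_Q 1 v) n i j = v n i j.
Proof.
  unfold exp_Q; rewrite Z.even_mul, Z.mul_1_l; simpl.
  replace (j - -1 - 1)%Z with j by lia.
  destruct (Z.even i); ring.
Qed.

(* Main.v *)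
Require Import Defs.
From Stdlib Require Import Reals ZArith List Lra Lia FunctionalExtensionality ClassicalEpsilon.
From Coquelicot Require Import Coquelicot.
Import ListNotations.
Open Scope R_scope.

(** Every operator in the theorem is a product of exponentials of the modes and
    of zero mode factors. Moving the annihilation part of one past the creation
    part of the other multiplies by [exp (sum_m a_m kappa_m b_(-m) x^m)], with
    [x = z2 / z1] or [z1 / z2], so both orderings of a product are scalar multiples
    of the same normally ordered product, whose matrix coefficients are entire in
    the spectral parameter because only finitely many terms contribute. Reordering
    the zero modes gives a sign times a power of [z1 / z2].

    The contraction exponents are of the form [sum_m c_m x^m / m] with [c_m] a
    combination of [s^m / prod_i (1 - t_i^m)]. If [G(x) = exp (sum_m c_m x^m / ((1 - t^m) m))]
    then [G(x) = g(x) G(t x)] with [g(x) = exp (sum_m c_m x^m / m)], and iterating this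
    identity shows that [G] is the product of the [g(x t^n)]; hence contractions are
    quotients of the products [(x; t_1, ..., t_k)_infinity]. The same functional
    equation, solved by a power series whose coefficients are estimated by a discrete
    Gronwall inequality, shows that these products are entire, so the quotients
    provide the meromorphic continuation. The scalars then match by
    [[m]^2 / ([rm] ([2m] - [m])) = q^(rm) (1 + s - s^2 - 2 s^3 - s^4 + s^5 + s^6)
    / ((1 - p^m) (1 - s^6))] with [s = q^m] for [rho], and by
    [[(r - 1) m] / [r m] = (q^m - (p / q)^m) / (1 - p^m)] for the theta functions. *)

(** * Complex series *)

(** The obstacle is that [op] demands convergence of every series met on the way. After a creation
    exponential a state has infinitely many nonzero coefficients, so the annihilation half of the
    next operator is an infinite sum at each coefficient. States are therefore kept in the form
    [W f], with [f] of finitely many modes and [W] a product of creation exponentials: there the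
    annihilation sum acts as [W (P + c) f], where [P] is nilpotent and the scalar [c] is the
    contraction, so its exponential is [exp c] times a finite sum. [K^(-1)] is not normally ordered.
    Its reordering gives a constant independent of [z], which cancels from the relations but whose
    series must be shown to converge. Analytic continuation is made explicit: a power series is used
    only near 0, where its exponential equals an expression defined everywhere. Meromorphic
    functions are compared off the zeros of an explicit entire function, which is not identically
    zero because its factors are nonzero at the single point [q^(2u) = -1]. *)

Notation is_Cseries := (@is_series C_AbsRing C_NormedModule).

(* Restates an equation between elements of a Coquelicot structure over [R] as
   one in [R], where [ring] applies. *)
Ltac eqR := match goal with |- @eq _ ?x ?y => change (@eq R x y) end.

Fixpoint Csum (a : nat -> C) (N : nat) : C :=
  match N with O => RtoC 0 | S N' => (Csum a N' + a N')%C end.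

Lemma Csum_ext (a b : nat -> C) (N : nat) :
  (forall k, (k < N)%nat -> a k = b k) -> Csum a N = Csum b N.
Proof.
  induction N as [|N IH]; simpl; intros H; [reflexivity|].
  rewrite IH, H by (intros; try apply H; lia); reflexivity.
Qed.

Lemma Csum_zero (a : nat -> C) (N : nat) :
  (forall k, (k < N)%nat -> a k = RtoC 0) -> Csum a N = RtoC 0.
Proof.
  induction N as [|N IH]; simpl; intros H; [reflexivity|].
  rewrite IH, H by (intros; try apply H; lia); ring.
Qed.

Lemma Csum_plus (a b : nat -> C) (N : nat) :
  Csum (fun k => a k + b k)%C N = (Csum a N + Csum b N)%C.
Proof. induction N as [|N IH]; simpl; [|rewrite IH]; ring. Qed.

Lemma Csum_scal (c : C) (a : nat -> C) (N : nat) :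
  Csum (fun k => c * a k)%C N = (c * Csum a N)%C.
Proof. induction N as [|N IH]; simpl; [|rewrite IH]; ring. Qed.

Lemma Csum_shift (a : nat -> C) (N : nat) :
  Csum a (S N) = (a 0%nat + Csum (fun k => a (S k)) N)%C.
Proof.
  induction N as [|N IH]; [simpl; ring|].
  change (Csum a (S (S N))) with (Csum a (S N) + a (S N))%C.
  rewrite IH; simpl; ring.
Qed.

Lemma Csum_swap (f : nat -> nat -> C) (M N : nat) :
  Csum (fun k => Csum (fun l => f k l) N) M = Csum (fun l => Csum (fun k => f k l) M) N.
Proof.
  induction M as [|M IH]; simpl.
  - symmetry; apply Csum_zero; reflexivity.
  - rewrite IH, <- Csum_plus; reflexivity.
Qed.

Lemma Csum_le (a : nat -> C) (M N : nat) :
  (M <= N)%nat -> (forall k, (M <= k < N)%nat -> a k = RtoC 0) -> Csum a N = Csum a M.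
Proof.
  intros H; induction H as [|N H IH]; intros Z; [reflexivity|].
  simpl; rewrite IH, Z by (intros; try apply Z; lia); ring.
Qed.

Lemma Csum_single (a : nat -> C) (N m : nat) :
  (m < N)%nat -> (forall k, k <> m -> a k = RtoC 0) -> Csum a N = a m.
Proof.
  intros H Z; rewrite (Csum_le a (S m)) by (intros; try apply Z; lia).
  simpl; rewrite Csum_zero by (intros; apply Z; lia); ring.
Qed.

Lemma sum_n_Csum (a : nat -> C) (N : nat) :
  @sum_n C_AbelianMonoid a N = Csum a (S N).
Proof.
  induction N as [|N IH].
  - rewrite sum_O; simpl; ring.
  - rewrite sum_Sn, IH; reflexivity.
Qed.

Lemma Re_Csum (a : nat -> C) (N : nat) :
  Re (Csum a (S N)) = sum_n (fun k => Re (a k)) N.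
Proof.
  induction N as [|N IH].
  - rewrite sum_O; simpl; unfold Re; ring.
  - rewrite sum_Sn, <- IH; reflexivity.
Qed.

Lemma Im_Csum (a : nat -> C) (N : nat) :
  Im (Csum a (S N)) = sum_n (fun k => Im (a k)) N.
Proof.
  induction N as [|N IH].
  - rewrite sum_O; simpl; unfold Im; ring.
  - rewrite sum_Sn, <- IH; reflexivity.
Qed.

(** The uniform structure of [C] is that of a product of two copies of [R], so a ball splits into
    two real balls and the real theory applies to each component. *)
Lemma is_Cseries_components (a : nat -> C) (l : C) :
  is_Cseries a l <->
  is_series (fun n => Re (a n)) (Re l) /\ is_series (fun n => Im (a n)) (Im l).
Proof.
  unfold is_series; split.
  - intros H; split; apply filterlim_locally; intros eps;
      pose proof (proj1 (filterlim_locally (F := eventually) _ _) H eps) as [N HN];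
      exists N; intros n Hn; specialize (HN n Hn); destruct HN as [H1 H2];
      rewrite sum_n_Csum in H1, H2.
    + rewrite <- Re_Csum; exact H1.
    + rewrite <- Im_Csum; exact H2.
  - intros [H1 H2]; apply filterlim_locally; intros eps.
    pose proof (proj1 (filterlim_locally (F := eventually) _ _) H1 eps) as [N1 HN1].
    pose proof (proj1 (filterlim_locally (F := eventually) _ _) H2 eps) as [N2 HN2].
    exists (N1 + N2)%nat; intros n Hn; split; rewrite sum_n_Csum.
    + change (ball (Re l) eps (Re (Csum a (S n)))); rewrite Re_Csum; apply HN1; lia.
    + change (ball (Im l) eps (Im (Csum a (S n)))); rewrite Im_Csum; apply HN2; lia.
Qed.

Lemma is_Cseries_ext (a b : nat -> C) (l : C) :
  (forall n, a n = b n) -> is_Cseries a l -> is_Cseries b l.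
Proof. apply is_series_ext. Qed.

Lemma is_Cseries_plus (a b : nat -> C) (la lb : C) :
  is_Cseries a la -> is_Cseries b lb ->
  is_Cseries (fun n => a n + b n)%C (la + lb)%C.
Proof. intros Ha Hb; exact (is_series_plus a b la lb Ha Hb). Qed.

Lemma is_Cseries_scal (c : C) (a : nat -> C) (l : C) :
  is_Cseries a l -> is_Cseries (fun n => c * a n)%C (c * l)%C.
Proof. intros Ha; exact (is_series_scal c a l Ha). Qed.

Lemma is_Cseries_unique (a : nat -> C) (l l' : C) :
  is_Cseries a l -> is_Cseries a l' -> l = l'.
Proof.
  intros H H'; apply is_Cseries_components in H; apply is_Cseries_components in H'.
  destruct H as [H1 H2], H' as [H1' H2'].
  apply is_series_unique in H1, H2, H1', H2'.
  apply injective_projections.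
  - change (Re l = Re l'); rewrite <- H1, <- H1'; reflexivity.
  - change (Im l = Im l'); rewrite <- H2, <- H2'; reflexivity.
Qed.

Lemma is_Cseries_finite (a : nat -> C) (N : nat) (l : C) :
  (forall k, (N <= k)%nat -> a k = RtoC 0) -> Csum a N = l -> is_Cseries a l.
Proof.
  intros H <-; apply filterlim_locally; intros eps; exists N; intros n Hn.
  rewrite sum_n_Csum, (Csum_le a N (S n)) by (intros; try apply H; lia).
  apply ball_center.
Qed.

Lemma is_Cseries_Csum (s : nat -> nat -> C) (w : nat -> C) (N : nat) :
  (forall l, (l < N)%nat -> is_Cseries (fun k => s k l) (w l)) ->
  is_Cseries (fun k => Csum (fun l => s k l) N) (Csum w N).
Proof.
  induction N as [|N IH]; intros H; simpl.
  - apply (is_Cseries_finite (fun _ => RtoC 0) 0); reflexivity.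
  - apply is_Cseries_plus; [apply IH; intros|]; apply H; lia.
Qed.

Lemma is_Cseries_shift (a : nat -> C) (l : C) :
  a 0%nat = RtoC 0 -> is_Cseries (fun n => a (S n)) l -> is_Cseries a l.
Proof.
  intros H0 H; apply is_Cseries_components in H; destruct H as [H1 H2].
  apply is_Cseries_components.
  split; apply is_series_decr_1; rewrite H0; simpl.
  - match goal with |- is_series _ ?x => replace x with (Re l) end; [exact H1|].
    change (@eq R (Re l) (Re l + - 0)); rewrite Ropp_0, Rplus_0_r; reflexivity.
  - match goal with |- is_series _ ?x => replace x with (Im l) end; [exact H2|].
    change (@eq R (Im l) (Im l + - 0)); rewrite Ropp_0, Rplus_0_r; reflexivity.
Qed.

Lemma is_Cseries_unshift (a : nat -> C) (l : C) :
  a 0%nat = RtoC 0 -> is_Cseries a l -> is_Cseries (fun n => a (S n)) l.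
Proof.
  intros H0 H; apply is_Cseries_components in H; destruct H as [H1 H2].
  apply is_Cseries_components; split.
  - apply (is_series_incr_1 (fun k => Re (a k))); rewrite H0.
    match goal with |- is_series _ ?x => replace x with (Re l) end; [exact H1|].
    change (@eq R (Re l) (Re l + 0)); rewrite Rplus_0_r; reflexivity.
  - apply (is_series_incr_1 (fun k => Im (a k))); rewrite H0.
    match goal with |- is_series _ ?x => replace x with (Im l) end; [exact H2|].
    change (@eq R (Im l) (Im l + 0)); rewrite Rplus_0_r; reflexivity.
Qed.

Lemma ex_series_dominated (a b : nat -> R) :
  (forall n, 0 <= a n <= b n) -> ex_series b -> ex_series a.
Proof.
  intros H; apply (ex_series_le (K := R_AbsRing) (V := R_CompleteNormedModule)).
  intros n; change (Rabs (a n) <= b n); rewrite Rabs_pos_eq; apply H.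
Qed.

Lemma Cmod_le_Re_Im (z : C) : Cmod z <= Rabs (Re z) + Rabs (Im z).
Proof.
  replace z with (RtoC (Re z) + Ci * RtoC (Im z))%C at 1
    by (apply injective_projections; unfold Re, Im; simpl; ring).
  eapply Rle_trans; [apply Cmod_triangle|].
  rewrite Cmod_mult, Cmod_Ci, !Cmod_R; lra.
Qed.

Lemma im_le_Cmod (z : C) : Rabs (Im z) <= Cmod z.
Proof. eapply Rle_trans; [apply Rmax_r | apply (Rmax_Cmod z)]. Qed.

Lemma Cmod_Csum (a : nat -> C) (N : nat) :
  Cmod (Csum a (S N)) <= sum_n (fun k => Cmod (a k)) N.
Proof.
  induction N as [|N IH].
  - rewrite sum_O; simpl; rewrite Cplus_0_l; apply Rle_refl.
  - rewrite sum_Sn; eapply Rle_trans; [apply Cmod_triangle|].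
    apply Rplus_le_compat_r; exact IH.
Qed.

Lemma is_Cseries_Cmod_le (a : nat -> C) (b : nat -> R) (l : C) (L : R) :
  is_Cseries a l -> (forall n, Cmod (a n) <= b n) -> is_series b L -> Cmod l <= L.
Proof.
  intros Ha Hb HL.
  apply (is_lim_seq_le (fun n => Cmod (Csum a (S n))) (sum_n b) (Cmod l) L).
  - intros n; eapply Rle_trans; [apply Cmod_Csum|].
    apply sum_n_m_le; intros k; apply Hb.
  - apply (is_lim_seq_ext (fun n => @norm C_AbsRing C_NormedModule (sum_n a n))).
    + intros n; rewrite sum_n_Csum; reflexivity.
    + unfold is_lim_seq.
      eapply filterlim_comp; [exact Ha|].
      apply (filterlim_norm (K := C_AbsRing) (V := C_NormedModule) l).
  - exact HL.
Qed.

Lemma ex_Cseries_dominated (a : nat -> C) (b : nat -> R) :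
  (forall n, Cmod (a n) <= b n) -> ex_series b -> exists l, is_Cseries a l.
Proof.
  intros H Hb.
  assert (H1 : ex_series (fun n => Re (a n))).
  { apply (ex_series_le (K := R_AbsRing) (V := R_CompleteNormedModule) _ b); [|exact Hb].
    intros n; eapply Rle_trans; [apply re_le_Cmod | apply H]. }
  assert (H2 : ex_series (fun n => Im (a n))).
  { apply (ex_series_le (K := R_AbsRing) (V := R_CompleteNormedModule) _ b); [|exact Hb].
    intros n; eapply Rle_trans; [apply im_le_Cmod | apply H]. }
  destruct H1 as [l1 H1], H2 as [l2 H2]; exists (l1, l2).
  apply is_Cseries_components; split; assumption.
Qed.

Lemma sum_n_linear (s : R) (f g h : nat -> R) (n : nat) :
  (forall k, h k = f k + s * g k) -> sum_n h n = sum_n f n + s * sum_n g n.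
Proof.
  intros H; induction n as [|n IH].
  - rewrite !sum_O; apply H.
  - rewrite !sum_Sn, IH, H; unfold plus; simpl; eqR; ring.
Qed.

(** Real and imaginary parts reduce the Cauchy product to four real ones, absolutely convergent
    because [Cmod] dominates both parts. *)
Lemma is_Cseries_mult (a b : nat -> C) (la lb : C) :
  is_Cseries a la -> is_Cseries b lb ->
  ex_series (fun n => Cmod (a n)) -> ex_series (fun n => Cmod (b n)) ->
  is_Cseries (fun n => Csum (fun k => a k * b (n - k)%nat)%C (S n)) (la * lb)%C.
Proof.
  intros Ha Hb Aa Ab.
  apply is_Cseries_components in Ha; destruct Ha as [Ha1 Ha2].
  apply is_Cseries_components in Hb; destruct Hb as [Hb1 Hb2].
  assert (absR : forall c : nat -> C, ex_series (fun n => Cmod (c n)) ->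
    ex_series (fun n => Rabs (Re (c n))) /\ ex_series (fun n => Rabs (Im (c n)))).
  { intros c Hc; split;
    apply (ex_series_le (K := R_AbsRing) (V := R_CompleteNormedModule) _ _) with (2 := Hc);
    intros n; unfold norm; simpl; unfold abs; simpl; rewrite Rabs_Rabsolu.
    - apply re_le_Cmod.
    - apply im_le_Cmod. }
  destruct (absR a Aa) as [A1 A2], (absR b Ab) as [B1 B2].
  pose proof (is_series_mult _ _ _ _ Ha1 Hb1 A1 B1) as P11.
  pose proof (is_series_mult _ _ _ _ Ha2 Hb2 A2 B2) as P22.
  pose proof (is_series_mult _ _ _ _ Ha1 Hb2 A1 B2) as P12.
  pose proof (is_series_mult _ _ _ _ Ha2 Hb1 A2 B1) as P21.
  apply is_Cseries_components; split.
  - apply (is_series_minus _ _ _ _ P11) in P22.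
    replace (Re (la * lb)%C) with (plus (Re la * Re lb) (opp (Im la * Im lb)))
      by (unfold plus, opp, Re, Im; simpl; ring).
    eapply is_series_ext; [|exact P22].
    intros n; rewrite Re_Csum, <- !sum_n_Reals.
    rewrite (sum_n_linear (-1) (fun k => Re (a k) * Re (b (n - k)%nat))
      (fun k => Im (a k) * Im (b (n - k)%nat))
      (fun k => Re (a k * b (n - k)%nat)%C))
      by (intros k; unfold Re, Im; simpl; ring).
    unfold plus, opp; simpl; eqR; ring.
  - apply (is_series_plus _ _ _ _ P12) in P21.
    replace (Im (la * lb)%C) with (plus (Re la * Im lb) (Im la * Re lb))
      by (unfold plus, Re, Im; simpl; ring).
    eapply is_series_ext; [|exact P21].
    intros n; rewrite Im_Csum, <- !sum_n_Reals.
    rewrite (sum_n_linear 1 (fun k => Re (a k) * Im (b (n - k)%nat))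
      (fun k => Im (a k) * Re (b (n - k)%nat))
      (fun k => Im (a k * b (n - k)%nat)%C))
      by (intros k; unfold Re, Im; simpl; ring).
    unfold plus; simpl; eqR; ring.
Qed.

(** * Complex differentiation and power series *)

Notation Cder := (@is_derive C_AbsRing C_NormedModule).

Lemma Cder_iff (f : C -> C) (z l : C) :
  Cder f z l <->
  (forall eps, 0 < eps -> exists delta, 0 < delta /\ forall h, Cmod h < delta ->
    Cmod (f (z + h) - f z - l * h)%C <= eps * Cmod h).
Proof.
  split.
  - intros [_ H] eps Heps.
    destruct (H z (fun P HP => HP) (mkposreal eps Heps)) as [d Hd].
    exists d; split; [apply cond_pos|]; intros h Hh.
    specialize (Hd (z + h)%C).
    assert (B : ball (z : AbsRing_UniformSpace C_AbsRing) d (z + h)%C).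
    { change (Cmod ((z + h) - z)%C < d); replace (z + h - z)%C with h by ring; exact Hh. }
    specialize (Hd B).
    change (Cmod (f (z + h) - f z - (z + h - z) * l)%C <= eps * Cmod (z + h - z)%C) in Hd.
    replace (z + h - z)%C with h in Hd by ring.
    rewrite (Cmult_comm l h); exact Hd.
  - intros H; split; [apply is_linear_scal_l|].
    intros x Hx eps.
    apply (is_filter_lim_locally_unique (K := C_AbsRing) (V := AbsRing_NormedModule C_AbsRing)) in Hx.
    subst x.
    destruct (H eps (cond_pos eps)) as [d [Hd Hb]].
    assert (Hy : forall y : C, Cmod (y - z)%C < d ->
      Cmod (f y - f z - (y - z) * l)%C <= eps * Cmod (y - z)%C).
    { intros y Hy; specialize (Hb (y - z)%C Hy).
      replace (z + (y - z))%C with y in Hb by ring.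
      rewrite (Cmult_comm (y - z) l); exact Hb. }
    exists (mkposreal d Hd); exact Hy.
Qed.

Lemma Cder_const (c z : C) : Cder (fun _ => c) z (RtoC 0).
Proof. exact (is_derive_const (K := C_AbsRing) (V := C_NormedModule) c z). Qed.

(* [C_NormedModule] and the normed module underlying [C_AbsRing] have the same
   norm, but are not convertible. *)
Lemma Cder_AbsRing (f : C -> C) (z l : C) :
  Cder f z l <-> @is_derive C_AbsRing (AbsRing_NormedModule C_AbsRing) f z l.
Proof. split; intros [_ H]; (split; [apply is_linear_scal_l | exact H]). Qed.

Lemma Cder_id (z : C) : Cder (fun w => w) z (RtoC 1).
Proof. apply Cder_AbsRing; exact (is_derive_id (K := C_AbsRing) z). Qed.

Lemma Cder_plus (f g : C -> C) (z l m : C) :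
  Cder f z l -> Cder g z m -> Cder (fun w => f w + g w)%C z (l + m)%C.
Proof.
  intros Hf Hg; exact (is_derive_plus (K := C_AbsRing) (V := C_NormedModule) f g z l m Hf Hg).
Qed.

Lemma Cder_mult (f g : C -> C) (z l m : C) :
  Cder f z l -> Cder g z m -> Cder (fun w => f w * g w)%C z (l * g z + f z * m)%C.
Proof.
  rewrite !Cder_AbsRing; intros Hf Hg.
  exact (is_derive_mult (K := C_AbsRing) f g z l m Hf Hg Cmult_comm).
Qed.

Lemma Cder_comp (f g : C -> C) (z l m : C) :
  Cder f (g z) l -> Cder g z m -> Cder (fun w => f (g w)) z (m * l)%C.
Proof.
  rewrite (Cder_AbsRing g); intros Hf Hg.
  exact (is_derive_comp (K := C_AbsRing) (V := C_NormedModule) f g z l m Hf Hg).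
Qed.

Lemma Cder_eq (f : C -> C) (z l m : C) : l = m -> Cder f z l -> Cder f z m.
Proof. intros ->; auto. Qed.

(** Along the segment from 0 to [z] the real and imaginary parts of [f] are real functions with zero
    derivative. This is the uniqueness principle behind the series of [Cexp] and of
    [log (1 - x)]. *)
Lemma Cder_zero_const (f : C -> C) (rho : R) (z : C) :
  (forall w, Cmod w < rho -> Cder f w (RtoC 0)) -> Cmod z < rho -> f z = f (RtoC 0).
Proof.
  intros H Hz.
  assert (key : forall p : C -> R,
    (forall a b, p (a - b)%C = p a - p b) -> (forall a, Rabs (p a) <= Cmod a) ->
    p (f (RtoC 0)) = p (f z)).
  { intros p plin pabs.
    assert (D : forall t, 0 <= t <= 1 -> is_derive (fun s => p (f (RtoC s * z)%C)) t 0).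
    { intros t Ht; apply is_derive_Reals; intros eps Heps.
      assert (Hw : Cmod (RtoC t * z)%C < rho).
      { rewrite Cmod_mult, Cmod_R, Rabs_pos_eq by lra.
        pose proof (Cmod_ge_0 z); nra. }
      destruct (proj1 (Cder_iff _ _ _) (H _ Hw) (eps / (2 * (Cmod z + 1)))) as [d [Hd Hb]].
      { pose proof (Cmod_ge_0 z); apply Rdiv_lt_0_compat; lra. }
      assert (Hpos : 0 < d / (Cmod z + 1)).
      { pose proof (Cmod_ge_0 z); apply Rdiv_lt_0_compat; lra. }
      exists (mkposreal _ Hpos); intros k Hk0 Hk; simpl in Hk.
      rewrite Rminus_0_r.
      specialize (Hb (RtoC k * z)%C).
      assert (Hm : Cmod (RtoC k * z)%C = Rabs k * Cmod z) by (rewrite Cmod_mult, Cmod_R; ring).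
      assert (Hk' : Rabs k * (Cmod z + 1) < d).
      { pose proof (Cmod_ge_0 z); apply Rmult_lt_reg_r with (/ (Cmod z + 1)).
        - apply Rinv_0_lt_compat; lra.
        - rewrite Rmult_assoc, Rinv_r by lra; unfold Rdiv in Hk; lra. }
      rewrite Hm in Hb.
      assert (Hlt : Rabs k * Cmod z < d) by (pose proof (Rabs_pos k); nra).
      specialize (Hb Hlt).
      rewrite <- plin.
      replace (RtoC (t + k) * z)%C with (RtoC t * z + RtoC k * z)%C
        by (rewrite RtoC_plus; ring).
      unfold Rdiv; rewrite Rabs_mult, Rabs_inv.
      assert (Hkp : 0 < Rabs k) by (apply Rabs_pos_lt; assumption).
      apply Rmult_lt_reg_r with (Rabs k); [exact Hkp|].
      rewrite Rmult_assoc, Rinv_l, Rmult_1_r by lra.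
      eapply Rle_lt_trans; [apply pabs|].
      replace (f (RtoC t * z + RtoC k * z) - f (RtoC t * z))%C
        with (f (RtoC t * z + RtoC k * z) - f (RtoC t * z) - RtoC 0 * (RtoC k * z))%C by ring.
      eapply Rle_lt_trans; [apply Hb|].
      pose proof (Cmod_ge_0 z).
      replace (eps / (2 * (Cmod z + 1)) * (Rabs k * Cmod z))
        with (eps * Rabs k * (Cmod z / (2 * (Cmod z + 1)))) by (field; lra).
      assert (Cmod z / (2 * (Cmod z + 1)) < 1).
      { apply Rmult_lt_reg_r with (2 * (Cmod z + 1)); [lra|].
        unfold Rdiv; rewrite Rmult_assoc, Rinv_l by lra; lra. }
      assert (0 < eps * Rabs k) by (apply Rmult_lt_0_compat; lra).
      nra. }
    pose proof (eq_is_derive (V := R_NormedModule) _ 0 1 D Rlt_0_1) as E; simpl in E.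
    rewrite Cmult_0_l, Cmult_1_l in E; exact E. }
  apply injective_projections; symmetry.
  - apply (key Re); [intros a b; unfold Re; simpl; ring | apply re_le_Cmod].
  - apply (key Im); [intros a b; unfold Im; simpl; ring | apply im_le_Cmod].
Qed.

(** * Complex power series *)

Definition conv_on (a : nat -> C) (rho : R) : Prop :=
  forall s, 0 <= s < rho -> ex_series (fun k => Cmod (a k) * s ^ k).

(** A total function: without convergence the value of [Series] means nothing, so it is related to a
    sum only through [Cps_eq] and [is_Cseries_Cps]. *)
Definition Cps (a : nat -> C) (z : C) : C :=
  (Series (fun k => Re (a k * z ^ k)%C), Series (fun k => Im (a k * z ^ k)%C)).

Definition Cps_derive (a : nat -> C) (k : nat) : C := (RtoC (INR (S k)) * a (S k))%C.

Lemma Cps_eq (a : nat -> C) (z l : C) : is_Cseries (fun k => a k * z ^ k)%C l -> Cps a z = l.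
Proof.
  intros H; apply is_Cseries_components in H; destruct H as [H1 H2].
  unfold Cps; rewrite (is_series_unique _ _ H1), (is_series_unique _ _ H2).
  destruct l; reflexivity.
Qed.

Lemma is_Cseries_Cps (a : nat -> C) (rho : R) (z : C) :
  conv_on a rho -> Cmod z < rho -> is_Cseries (fun k => a k * z ^ k)%C (Cps a z).
Proof.
  intros H Hz.
  destruct (ex_Cseries_dominated (fun k => a k * z ^ k)%C (fun k => Cmod (a k) * Cmod z ^ k))
    as [l Hl].
  - intros n; rewrite Cmod_mult, Cmod_pow; lra.
  - apply H; split; [apply Cmod_ge_0 | exact Hz].
  - rewrite (Cps_eq _ _ _ Hl); exact Hl.
Qed.

(** The two lowest terms of the binomial expansion. Divided by [d], it bounds the terms of the
    derived series by those of the original series at the larger radius [s + d]. *)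
Lemma pow_plus_ge (s d : R) (k : nat) :
  0 <= s -> 0 <= d -> INR (S k) * s ^ k * d + s ^ S k <= (s + d) ^ S k.
Proof.
  intros Hs Hd; induction k as [|k IH]; [simpl; lra|].
  rewrite (S_INR (S k)).
  change ((s + d) ^ S (S k)) with ((s + d) * (s + d) ^ S k).
  change (s ^ S (S k)) with (s * (s * s ^ k)).
  change (s ^ S k) with (s * s ^ k) in *.
  assert (0 <= INR (S k) * s ^ k).
  { apply Rmult_le_pos; [apply pos_INR | apply pow_le; lra]. }
  assert (0 <= s ^ k) by (apply pow_le; lra).
  nra.
Qed.

Lemma conv_on_derive (a : nat -> C) (rho : R) : conv_on a rho -> conv_on (Cps_derive a) rho.
Proof.
  intros H s Hs.
  set (d := (rho - s) / 2).
  assert (Hd : 0 < d) by (unfold d; lra).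
  assert (E : ex_series (fun k => / d * (Cmod (a (S k)) * (s + d) ^ S k))).
  { apply (ex_series_scal (K := R_AbsRing) (V := R_NormedModule)).
    apply (ex_series_incr_1 (fun k => Cmod (a k) * (s + d) ^ k)); apply H; unfold d; lra. }
  refine (ex_series_dominated _ _ _ E).
  intros k; unfold Cps_derive; rewrite Cmod_mult, Cmod_R, (Rabs_pos_eq (INR (S k))) by apply pos_INR.
  assert (P0 : 0 <= s ^ k) by (apply pow_le; lra).
  pose proof (pow_plus_ge s d k (proj1 Hs) (Rlt_le _ _ Hd)) as P.
  assert (P1 : 0 <= s ^ S k) by (apply pow_le; lra).
  split.
  - repeat apply Rmult_le_pos; try apply pos_INR; try apply Cmod_ge_0; exact P0.
  - apply Rmult_le_reg_l with d; [exact Hd|].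
    match goal with |- _ <= d * (/ d * ?X) => replace (d * (/ d * X)) with X by (field; lra) end.
    apply Rle_trans with (Cmod (a (S k)) * (INR (S k) * s ^ k * d)); [right; ring|].
    apply Rmult_le_compat_l; [apply Cmod_ge_0 | lra].
Qed.

(** The order-two remainder of [(z + h)^k] is compared with its real majorant at [|z|] and [d].
    Every term contains [h^j] with [j >= 2], whence the factor [(|h| / d)^2]. Both remainders obey
    the same recursion in [k], which gives the induction. *)
Lemma Cpow_second_order (z h : C) (d : R) (k : nat) :
  Cmod h <= d ->
  Cmod ((z + h) ^ k - z ^ k - RtoC (INR k) * z ^ pred k * h)%C * d ^ 2
  <= Cmod h ^ 2 * ((Cmod z + d) ^ k - Cmod z ^ k - INR k * Cmod z ^ pred k * d).
Proof.
  intros Hh; pose proof (Cmod_ge_0 h) as Hh0; pose proof (Cmod_ge_0 z) as Hz0.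
  assert (shiftR : forall m, Cmod z * (INR m * Cmod z ^ pred m) = INR m * Cmod z ^ m)
    by (intros [|m]; simpl; ring).
  assert (shiftC : forall m, (z * (RtoC (INR m) * z ^ pred m) = RtoC (INR m) * z ^ m)%C)
    by (intros [|m]; simpl; ring).
  induction k as [|k IH].
  - replace ((z + h) ^ 0 - z ^ 0 - RtoC (INR 0) * z ^ pred 0 * h)%C with (RtoC 0)
      by (simpl; ring).
    rewrite Cmod_0; simpl; lra.
  - set (Rk := ((z + h) ^ k - z ^ k - RtoC (INR k) * z ^ pred k * h)%C) in *.
    set (Bk := (Cmod z + d) ^ k - Cmod z ^ k - INR k * Cmod z ^ pred k * d) in *.
    replace ((z + h) ^ S k - z ^ S k - RtoC (INR (S k)) * z ^ pred (S k) * h)%C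
      with ((z + h) * Rk + (RtoC (INR k) * z ^ pred k) * h ^ 2)%C.
    2:{ unfold Rk; rewrite S_INR, RtoC_plus; simpl pred.
        change ((z + h) ^ S k)%C with ((z + h) * (z + h) ^ k)%C.
        change (z ^ S k)%C with (z * z ^ k)%C.
        transitivity ((z + h) * (z + h) ^ k - z * z ^ k
          - (z * (RtoC (INR k) * z ^ pred k)) * h - z ^ k * h)%C; [simpl; ring|].
        rewrite shiftC; ring. }
    replace ((Cmod z + d) ^ S k - Cmod z ^ S k - INR (S k) * Cmod z ^ pred (S k) * d)
      with ((Cmod z + d) * Bk + INR k * Cmod z ^ pred k * d ^ 2).
    2:{ unfold Bk; rewrite S_INR; simpl pred.
        change ((Cmod z + d) ^ S k) with ((Cmod z + d) * (Cmod z + d) ^ k).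
        change (Cmod z ^ S k) with (Cmod z * Cmod z ^ k).
        transitivity ((Cmod z + d) * (Cmod z + d) ^ k - Cmod z * Cmod z ^ k
          - (Cmod z * (INR k * Cmod z ^ pred k)) * d - Cmod z ^ k * d); [simpl; ring|].
        rewrite shiftR; ring. }
    assert (T : Cmod ((z + h) * Rk + RtoC (INR k) * z ^ pred k * h ^ 2)%C
      <= (Cmod z + d) * Cmod Rk + INR k * Cmod z ^ pred k * Cmod h ^ 2).
    { eapply Rle_trans; [apply Cmod_triangle|].
      rewrite !Cmod_mult, !Cmod_pow, Cmod_R, (Rabs_pos_eq (INR k)) by apply pos_INR.
      apply Rplus_le_compat_r, Rmult_le_compat_r; [apply Cmod_ge_0|].
      eapply Rle_trans; [apply Cmod_triangle | lra]. }
    apply Rle_trans with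
      (((Cmod z + d) * Cmod Rk + INR k * Cmod z ^ pred k * Cmod h ^ 2) * d ^ 2).
    + apply Rmult_le_compat_r; [apply pow2_ge_0 | exact T].
    + assert ((Cmod z + d) * (Cmod Rk * d ^ 2) <= (Cmod z + d) * (Cmod h ^ 2 * Bk))
        by (apply Rmult_le_compat_l; lra).
      lra.
Qed.

Lemma Cder_Cps (a : nat -> C) (rho : R) (z : C) :
  conv_on a rho -> Cmod z < rho -> Cder (Cps a) z (Cps (Cps_derive a) z).
Proof.
  intros H Hz; apply Cder_iff; intros eps Heps.
  pose proof (Cmod_ge_0 z) as Hz0.
  set (d := (rho - Cmod z) / 2).
  assert (Hd : 0 < d) by (unfold d; lra).
  destruct (H (Cmod z + d)) as [M HM]; [unfold d; lra|].
  assert (HM0 : 0 <= M).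
  { rewrite <- Cmod_0.
    apply (is_Cseries_Cmod_le (fun _ => RtoC 0) (fun k => Cmod (a k) * (Cmod z + d) ^ k)).
    - apply (is_Cseries_finite (fun _ => RtoC 0) 0); reflexivity.
    - intros n; rewrite Cmod_0; apply Rmult_le_pos; [apply Cmod_ge_0 | apply pow_le; lra].
    - exact HM. }
  assert (Hd2 : 0 < d ^ 2) by (apply pow_lt; exact Hd).
  (* The second bound makes [|h| M / d^2 <= eps], where [M] is the sum of the majorant at radius
     [|z| + d]; the 1 allows [M = 0]. *)
  exists (Rmin d (eps * d ^ 2 / (M + 1))); split.
  { apply Rmin_pos; [exact Hd|]; apply Rdiv_lt_0_compat; [nra | lra]. }
  intros h Hh.
  assert (Hh1 : Cmod h < d) by (eapply Rlt_le_trans; [apply Hh | apply Rmin_l]).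
  assert (Hh2 : Cmod h < eps * d ^ 2 / (M + 1))
    by (eapply Rlt_le_trans; [apply Hh | apply Rmin_r]).
  pose proof (Cmod_ge_0 h) as Hh0.
  assert (Hzh : Cmod (z + h)%C < rho)
    by (eapply Rle_lt_trans; [apply Cmod_triangle | unfold d in *; lra]).
  pose proof (is_Cseries_Cps a rho (z + h)%C H Hzh) as S1.
  pose proof (is_Cseries_Cps a rho z H Hz) as S2.
  pose proof (is_Cseries_Cps _ rho z (conv_on_derive a rho H) Hz) as S3.
  assert (S4 : is_Cseries (fun k => h * (RtoC (INR k) * a k * z ^ pred k))%C
                          (h * Cps (Cps_derive a) z)%C).
  { apply is_Cseries_scal, is_Cseries_shift; [simpl; ring|].
    eapply is_Cseries_ext; [|exact S3]; intros n; reflexivity. }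
  assert (S5 : is_Cseries
    (fun k => a k * ((z + h) ^ k - z ^ k - RtoC (INR k) * z ^ pred k * h))%C
    (Cps a (z + h) - Cps a z - Cps (Cps_derive a) z * h)%C).
  { replace (Cps a (z + h) - Cps a z - Cps (Cps_derive a) z * h)%C
      with (Cps a (z + h) + (RtoC (-1) * Cps a z) + RtoC (-1) * (h * Cps (Cps_derive a) z))%C
      by ring.
    eapply is_Cseries_ext;
      [|exact (is_Cseries_plus _ _ _ _ (is_Cseries_plus _ _ _ _ S1
          (is_Cseries_scal (RtoC (-1)) _ _ S2)) (is_Cseries_scal (RtoC (-1)) _ _ S4))].
    intros n; simpl; ring. }
  assert (B : Cmod (Cps a (z + h) - Cps a z - Cps (Cps_derive a) z * h)%C
              <= Cmod h ^ 2 / d ^ 2 * M).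
  { apply (is_Cseries_Cmod_le _
      (fun k => Cmod h ^ 2 / d ^ 2 * (Cmod (a k) * (Cmod z + d) ^ k)) _ _ S5).
    - intros k; rewrite Cmod_mult.
      pose proof (Cpow_second_order z h d k (Rlt_le _ _ Hh1)) as P.
      assert (0 <= INR k * Cmod z ^ pred k * d).
      { apply Rmult_le_pos; [apply Rmult_le_pos; [apply pos_INR | apply pow_le; lra] | lra]. }
      assert (0 <= Cmod z ^ k) by (apply pow_le; lra).
      assert (0 <= Cmod h ^ 2) by apply pow2_ge_0.
      apply Rle_trans with (Cmod (a k) * (Cmod h ^ 2 / d ^ 2 * (Cmod z + d) ^ k)); [|right; ring].
      apply Rmult_le_compat_l; [apply Cmod_ge_0|].
      apply Rmult_le_reg_r with (d ^ 2); [exact Hd2|].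
      eapply Rle_trans; [exact P|].
      replace (Cmod h ^ 2 / d ^ 2 * (Cmod z + d) ^ k * d ^ 2)
        with (Cmod h ^ 2 * (Cmod z + d) ^ k) by (field; lra).
      apply Rmult_le_compat_l; lra.
    - exact (is_series_scal (K := R_AbsRing) (V := R_NormedModule) (Cmod h ^ 2 / d ^ 2) _ _ HM). }
  eapply Rle_trans; [exact B|].
  assert (Cmod h * (M + 1) <= eps * d ^ 2).
  { apply Rmult_le_reg_r with (/ (M + 1)); [apply Rinv_0_lt_compat; lra|].
    rewrite Rmult_assoc, Rinv_r by lra; unfold Rdiv in Hh2; lra. }
  apply Rmult_le_reg_r with (d ^ 2); [exact Hd2|].
  replace (Cmod h ^ 2 / d ^ 2 * M * d ^ 2) with (Cmod h * (Cmod h * M)) by (field; lra).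
  replace (eps * Cmod h * d ^ 2) with (Cmod h * (eps * d ^ 2)) by ring.
  apply Rmult_le_compat_l; nra.
Qed.

(** * The complex exponential *)

Lemma Cmult_cancel_l (c a b : C) : c <> RtoC 0 -> (c * a = c * b)%C -> a = b.
Proof.
  intros Hc E; replace a with (/ c * (c * a))%C by (field; exact Hc).
  rewrite E; field; exact Hc.
Qed.

Lemma Cexp_add (a b : C) : Cexp (a + b)%C = (Cexp a * Cexp b)%C.
Proof.
  unfold Cexp, Re, Im; apply injective_projections; simpl;
    rewrite exp_plus, ?cos_plus, ?sin_plus; ring.
Qed.

Lemma Cexp_0 : Cexp (RtoC 0) = RtoC 1.
Proof.
  unfold Cexp, Re, Im; apply injective_projections; simpl;
    rewrite exp_0, ?cos_0, ?sin_0; ring.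
Qed.

Lemma Cexp_neq_0 (a : C) : Cexp a <> RtoC 0.
Proof.
  intros H; apply C1_nz; change C1 with (RtoC 1).
  rewrite <- Cexp_0; replace (RtoC 0) with (a + - a)%C by ring.
  rewrite Cexp_add, H; ring.
Qed.

Lemma Cexp_opp (a : C) : Cexp (- a)%C = (/ Cexp a)%C.
Proof.
  apply (Cmult_cancel_l (Cexp a)); [apply Cexp_neq_0|].
  rewrite <- Cexp_add, Cinv_r by apply Cexp_neq_0.
  rewrite <- Cexp_0; f_equal; ring.
Qed.

Lemma Cmod_Cexp (a : C) : Cmod (Cexp a) = exp (Re a).
Proof.
  unfold Cexp, Cmod; simpl.
  replace (exp (Re a) * cos (Im a) * (exp (Re a) * cos (Im a) * 1)
    + exp (Re a) * sin (Im a) * (exp (Re a) * sin (Im a) * 1))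
    with (exp (Re a) * exp (Re a)).
  - apply sqrt_square, Rlt_le, exp_pos.
  - pose proof (sin2_cos2 (Im a)) as E; unfold Rsqr in E.
    transitivity (exp (Re a) * exp (Re a) * (sin (Im a) * sin (Im a) + cos (Im a) * cos (Im a)));
      [rewrite E|]; ring.
Qed.

(** By the addition formula only the increment at 0 matters, and there it is a combination of the
    real first-order expansions of [exp], [cos] and [sin]. *)
Lemma Cder_Cexp (z : C) : Cder Cexp z (Cexp z).
Proof.
  assert (small : forall (f : R -> R) (l : R), f 0 = l -> is_derive f 0 0 ->
    forall eps, 0 < eps -> exists d, 0 < d /\ forall x, Rabs x < d ->
      Rabs (f x - l) <= eps * Rabs x).
  { intros f l f0 D eps Heps; apply is_derive_Reals in D.
    destruct (D eps Heps) as [d Hd]; exists d; split; [apply cond_pos|].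
    intros x Hx; destruct (Req_dec x 0) as [->|X].
    - rewrite f0, Rminus_diag, Rabs_R0; lra.
    - specialize (Hd x X Hx); rewrite Rplus_0_l, f0, Rminus_0_r in Hd.
      unfold Rdiv in Hd; rewrite Rabs_mult, Rabs_inv in Hd.
      apply Rabs_pos_lt in X.
      apply Rmult_le_reg_r with (/ Rabs x); [apply Rinv_0_lt_compat; exact X|].
      rewrite Rmult_assoc, Rinv_r by lra; lra. }
  apply Cder_iff; intros eps Heps.
  set (K := Cmod (Cexp z)).
  assert (HK : 0 < K) by (unfold K; rewrite Cmod_Cexp; apply exp_pos).
  (* The expansions together leave an error of at most [6 e |h|], three times [e |h|] in each of the
     real and imaginary parts; the factor [Cexp z] multiplies it by [K]. *)
  set (e := Rmin 1 (eps / (6 * K))).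
  assert (He : 0 < e) by (apply Rmin_pos; [lra | apply Rdiv_lt_0_compat; lra]).
  destruct (small (fun x => exp x - x) 1) with (eps := e) as [d1 [Hd1 B1]];
    [rewrite exp_0; ring | auto_derive; [exact I | rewrite exp_0; ring] | exact He|].
  destruct (small cos 1) with (eps := e) as [d2 [Hd2 B2]];
    [apply cos_0 | auto_derive; [exact I | rewrite sin_0; ring] | exact He|].
  destruct (small (fun x => sin x - x) 0) with (eps := e) as [d3 [Hd3 B3]];
    [rewrite sin_0; ring | auto_derive; [exact I | rewrite cos_0; ring] | exact He|].
  exists (Rmin (e / 3) (Rmin d1 (Rmin d2 d3))).
  split; [repeat apply Rmin_pos; lra|].
  intros [x y] Hh.
  assert (Hx : Rabs x <= Cmod (x, y)) by apply (re_le_Cmod (x, y)).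
  assert (Hy : Rabs y <= Cmod (x, y)) by apply (im_le_Cmod (x, y)).
  pose proof (Rmin_l (e / 3) (Rmin d1 (Rmin d2 d3))).
  pose proof (Rmin_r (e / 3) (Rmin d1 (Rmin d2 d3))).
  pose proof (Rmin_l d1 (Rmin d2 d3)); pose proof (Rmin_r d1 (Rmin d2 d3)).
  pose proof (Rmin_l d2 d3); pose proof (Rmin_r d2 d3).
  assert (He1 : e <= 1) by apply Rmin_l.
  specialize (B1 x ltac:(lra)); specialize (B2 y ltac:(lra)); specialize (B3 y ltac:(lra)).
  rewrite Cexp_add.
  replace (Cexp z * Cexp (x, y) - Cexp z - Cexp z * (x, y))%C
    with (Cexp z * (Cexp (x, y) - RtoC 1 - (x, y)))%C by ring.
  rewrite Cmod_mult; fold K.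
  set (m := Cmod (x, y)) in *.
  assert (Hm : 0 <= m) by apply Cmod_ge_0.
  assert (P : Cmod (Cexp (x, y) - RtoC 1 - (x, y))%C <= 6 * e * m).
  { eapply Rle_trans; [apply Cmod_le_Re_Im|].
    unfold Cexp, Re, Im; simpl.
    set (u := exp x - x - 1) in *; set (v := cos y - 1) in *; set (w := sin y - y - 0) in *.
    replace (exp x * cos y + - (1) + - x) with (u + (1 + x + u) * v) by (unfold u, v; ring).
    replace (exp x * sin y + - 0 + - y) with (w + (x + u) * (y + w)) by (unfold u, w; ring).
    assert (Hu : Rabs u <= e * m) by (eapply Rle_trans; [exact B1 | nra]).
    assert (Hv : Rabs v <= e * m) by (eapply Rle_trans; [exact B2 | nra]).
    assert (Hw : Rabs w <= e * m) by (eapply Rle_trans; [exact B3 | nra]).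
    assert (Rabs ((1 + x + u) * v) <= 2 * (e * m)).
    { rewrite Rabs_mult; apply Rmult_le_compat; try apply Rabs_pos; [|exact Hv].
      eapply Rle_trans; [apply Rabs_triang|].
      eapply Rle_trans; [apply Rplus_le_compat_r, Rabs_triang|].
      rewrite Rabs_R1; nra. }
    assert (Rabs ((x + u) * (y + w)) <= 2 * (e * m)).
    { rewrite Rabs_mult.
      apply Rle_trans with ((2 * m) * (2 * m)); [|nra].
      apply Rmult_le_compat; try apply Rabs_pos;
        (eapply Rle_trans; [apply Rabs_triang|]; nra). }
    pose proof (Rabs_triang u ((1 + x + u) * v)).
    pose proof (Rabs_triang w ((x + u) * (y + w))).
    lra. }
  assert (6 * K * e <= eps).
  { pose proof (Rmin_r 1 (eps / (6 * K))) as Q; fold e in Q.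
    apply Rmult_le_compat_l with (r := 6 * K) in Q; [|lra].
    replace (6 * K * (eps / (6 * K))) with eps in Q by (field; lra); exact Q. }
  apply Rle_trans with (K * (6 * e * m)); [apply Rmult_le_compat_l; lra | nra].
Qed.

Lemma RtoC_inv_fact (k : nat) :
  RtoC (/ INR (fact k)) = (RtoC (INR (S k)) * RtoC (/ INR (fact (S k))))%C.
Proof.
  rewrite <- RtoC_mult; f_equal; change (fact (S k)) with (S k * fact k)%nat; rewrite mult_INR.
  field; split; [apply INR_fact_neq_0 | apply not_0_INR; discriminate].
Qed.

Lemma conv_on_exp (rho : R) : conv_on (fun k => RtoC (/ INR (fact k))) rho.
Proof.
  intros s Hs; exists (exp s).
  eapply is_series_ext; [|exact (proj1 (is_pseries_R _ _ _) (is_exp_Reals s))].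
  intros n; simpl; rewrite Cmod_R, Rabs_pos_eq; [ring|].
  apply Rlt_le, Rinv_0_lt_compat, INR_fact_lt_0.
Qed.

(** The series is its own derivative, so its product with [Cexp (- w)] has derivative zero and
    equals its value 1 at the origin. *)
Lemma is_Cseries_Cexp (c : C) : is_Cseries (fun k => RtoC (/ INR (fact k)) * c ^ k)%C (Cexp c).
Proof.
  set (a := fun k => RtoC (/ INR (fact k))).
  assert (Da : forall k, Cps_derive a k = a k).
  { intros k; symmetry; apply RtoC_inv_fact. }
  assert (D : forall z, Cder (fun w => Cps a w * Cexp (- w))%C z (RtoC 0)).
  { intros z.
    assert (Hz : Cmod z < Cmod z + 1) by lra.
    pose proof (Cder_Cps a _ z (conv_on_exp _) Hz) as D1.
    replace (Cps (Cps_derive a) z) with (Cps a z) in D1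
      by (f_equal; apply functional_extensionality; intros; rewrite Da; reflexivity).
    assert (D2 : Cder (fun w => RtoC (-1) * w)%C z (RtoC (-1))).
    { eapply Cder_eq; [|exact (Cder_mult _ _ z _ _ (Cder_const (RtoC (-1)) z) (Cder_id z))];
      simpl; ring. }
    pose proof (Cder_comp Cexp _ z _ _ (Cder_Cexp _) D2) as D3.
    eapply Cder_eq; [|eapply (is_derive_ext (K := C_AbsRing) (V := C_NormedModule));
      [|exact (Cder_mult _ _ z _ _ D1 D3)]].
    - simpl; ring.
    - intros t; simpl; do 2 f_equal; ring. }
  assert (H0 : Cps a (RtoC 0) = RtoC 1).
  { apply Cps_eq, is_Cseries_finite with 1%nat; [intros [|k] Hk; [lia | simpl; ring]|].
    unfold a; simpl; rewrite Rinv_1; ring. }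
  assert (Hc : Cmod c < Cmod c + 1) by lra.
  pose proof (Cder_zero_const _ (Cmod c + 1) c (fun w _ => D w) Hc) as E; simpl in E.
  replace (- RtoC 0)%C with (RtoC 0) in E by ring.
  rewrite H0, Cexp_0, Cexp_opp in E.
  replace (Cexp c) with (Cps a c).
  - exact (is_Cseries_Cps a _ c (conv_on_exp _) Hc).
  - apply (Cmult_cancel_l (/ Cexp c)).
    + rewrite <- Cexp_opp; apply Cexp_neq_0.
    + rewrite Cmult_comm, E, Cinv_l by apply Cexp_neq_0; ring.
Qed.

Lemma Cgeom (x : C) : Cmod x < 1 -> is_Cseries (fun k => x ^ k)%C (/ (RtoC 1 - x))%C.
Proof.
  intros Hx.
  destruct (ex_Cseries_dominated (fun k => x ^ k)%C (fun k => Cmod x ^ k)) as [l Hl].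
  - intros n; rewrite Cmod_pow; lra.
  - apply ex_series_geom; rewrite Rabs_pos_eq by apply Cmod_ge_0; exact Hx.
  - assert (H1 : is_Cseries (fun k => (if Nat.eqb k 0 then RtoC 1 else RtoC 0)
        + (match k with O => RtoC 0 | S j => x * x ^ j end))%C (RtoC 1 + x * l)%C).
    { apply is_Cseries_plus.
      - apply is_Cseries_finite with 1%nat; [intros [|k] Hk; [lia | reflexivity] | simpl; ring].
      - apply is_Cseries_shift; [reflexivity|]; apply is_Cseries_scal; exact Hl. }
    assert (E : l = (RtoC 1 + x * l)%C).
    { eapply is_Cseries_unique; [exact Hl|].
      eapply is_Cseries_ext; [|exact H1]; intros [|k]; simpl; ring. }
    assert (N : (RtoC 1 - x)%C <> RtoC 0).
    { intros N; assert (X : x = RtoC 1) by (replace x with (RtoC 1 - (RtoC 1 - x))%C by ring;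
        rewrite N; ring).
      rewrite X, Cmod_1 in Hx; lra. }
    replace (/ (RtoC 1 - x))%C with l; [exact Hl|].
    apply (Cmult_cancel_l (RtoC 1 - x)%C); [exact N|].
    rewrite Cinv_r by exact N.
    transitivity (l - x * l)%C; [ring|]; rewrite E at 1; ring.
Qed.

(** * Infinite products *)

Definition Ccvg (s : nat -> C) (l : C) : Prop :=
  forall eps, 0 < eps -> exists N, forall n, (N <= n)%nat -> Cmod (s n - l)%C < eps.

Lemma Clim_eq (s : nat -> C) (l : C) : Ccvg s l -> Clim s = l.
Proof.
  intros H.
  assert (L : forall p : C -> R, (forall a b, p (a - b)%C = p a - p b) ->
    (forall a, Rabs (p a) <= Cmod a) -> real (Lim_seq (fun n => p (s n))) = p l).
  { intros p plin pabs.
    rewrite (is_lim_seq_unique (fun n => p (s n)) (p l)); [reflexivity|].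
    apply is_lim_seq_spec; intros eps; destruct (H eps (cond_pos eps)) as [N HN].
    exists N; intros n Hn; rewrite <- plin.
    eapply Rle_lt_trans; [apply pabs | apply HN, Hn]. }
  unfold Clim; apply injective_projections.
  - apply (L Re); [intros a b; unfold Re; simpl; ring | apply re_le_Cmod].
  - apply (L Im); [intros a b; unfold Im; simpl; ring | apply im_le_Cmod].
Qed.

(** The case [h = 0] forces [F 0 = 1]. This normalisation with a local Lipschitz bound is what the
    products need: [F (z t^n)] tends to 1. *)
Definition lipschitz_at_0 (F : C -> C) : Prop :=
  exists K d, 0 < d /\ forall h, Cmod h < d -> Cmod (F h - RtoC 1)%C <= K * Cmod h.

Lemma lipschitz_of_Cder (F : C -> C) (l : C) :
  F (RtoC 0) = RtoC 1 -> Cder F (RtoC 0) l -> lipschitz_at_0 F.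
Proof.
  intros F0 D.
  destruct (proj1 (Cder_iff _ _ _) D 1 Rlt_0_1) as [d [Hd H]].
  exists (1 + Cmod l), d; split; [exact Hd|]; intros h Hh.
  specialize (H h Hh); rewrite Cplus_0_l, F0 in H.
  replace (F h - RtoC 1)%C with ((F h - RtoC 1 - l * h) + l * h)%C by ring.
  eapply Rle_trans; [apply Cmod_triangle|]; rewrite (Cmod_mult l); lra.
Qed.

Lemma lipschitz_cvg (F : C -> C) (t : R) (z : C) :
  0 < t < 1 -> lipschitz_at_0 F -> Ccvg (fun n => F (z * RtoC (t ^ n))%C) (RtoC 1).
Proof.
  intros Ht [K [d [Hd H]]] eps Heps.
  pose proof (Cmod_ge_0 z) as Hz.
  set (e := Rmin d (eps / (Rabs K + 1))).
  assert (He : 0 < e).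
  { pose proof (Rabs_pos K); apply Rmin_pos; [|apply Rdiv_lt_0_compat]; lra. }
  destruct (pow_lt_1_zero t) with (y := e / (Cmod z + 1)) as [N HN].
  { rewrite Rabs_pos_eq; lra. }
  { apply Rdiv_lt_0_compat; lra. }
  exists N; intros n Hn; specialize (HN n Hn).
  assert (P : 0 <= t ^ n) by (apply pow_le; lra).
  assert (B : Cmod (z * RtoC (t ^ n))%C < e).
  { rewrite Cmod_mult, Cmod_R.
    apply Rmult_lt_compat_r with (r := Cmod z + 1) in HN; [|lra].
    unfold Rdiv in HN; rewrite Rmult_assoc, Rinv_l in HN by lra.
    pose proof (Rabs_pos (t ^ n)); nra. }
  assert (B1 : Cmod (z * RtoC (t ^ n))%C < d) by (eapply Rlt_le_trans; [exact B | apply Rmin_l]).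
  assert (B2 : Cmod (z * RtoC (t ^ n))%C < eps / (Rabs K + 1))
    by (eapply Rlt_le_trans; [exact B | apply Rmin_r]).
  eapply Rle_lt_trans; [apply H, B1|].
  pose proof (Cmod_ge_0 (z * RtoC (t ^ n))%C); pose proof (Rabs_pos K); pose proof (Rle_abs K).
  apply Rmult_lt_compat_r with (r := Rabs K + 1) in B2; [|lra].
  unfold Rdiv in B2; rewrite Rmult_assoc, Rinv_l in B2 by lra.
  nra.
Qed.

Lemma Cprod_telescope (f G : C -> C) (t : R) (z : C) (N : nat) :
  (forall n, G (z * RtoC (t ^ n)) = f (z * RtoC (t ^ n)) * G (z * RtoC (t ^ S n)))%C ->
  G z = (Cprod (fun n => f (z * RtoC (t ^ n))%C) N * G (z * RtoC (t ^ N)))%C.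
Proof.
  intros H; induction N as [|N IH].
  - simpl; rewrite Cmult_1_r; ring.
  - rewrite IH, H; simpl; ring.
Qed.

(* A solution [G] of [G(z) = f(z) G(tz)] with [G(0) = 1] is the product of the
   [f(z t^n)]. *)
Lemma Cprod_inf_functional (f G : C -> C) (t : R) (z : C) :
  0 < t < 1 -> lipschitz_at_0 G ->
  (forall n, G (z * RtoC (t ^ n)) = f (z * RtoC (t ^ n)) * G (z * RtoC (t ^ S n)))%C ->
  Cprod_inf (fun n => f (z * RtoC (t ^ n))%C) = G z.
Proof.
  intros Ht HG H; apply Clim_eq; intros eps Heps.
  pose proof (Cmod_ge_0 (G z)) as Hz.
  set (e := Rmin (1 / 2) (eps / (2 * (Cmod (G z) + 1)))).
  assert (He : 0 < e) by (apply Rmin_pos; [|apply Rdiv_lt_0_compat]; lra).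
  destruct (lipschitz_cvg G t z Ht HG e He) as [N HN].
  exists N; intros n Hn; specialize (HN n Hn).
  rewrite (Cprod_telescope f G t z n H) at 1.
  pose proof (Cprod_telescope f G t z n H) as E.
  set (P := Cprod _ n) in *; set (g := G (z * RtoC (t ^ n))%C) in *.
  replace (P - P * g)%C with (- (P * (g - RtoC 1)))%C by ring.
  rewrite Cmod_opp, Cmod_mult.
  assert (HN1 : Cmod (g - RtoC 1)%C < 1 / 2) by (eapply Rlt_le_trans; [exact HN | apply Rmin_l]).
  assert (HN2 : Cmod (g - RtoC 1)%C < eps / (2 * (Cmod (G z) + 1)))
    by (eapply Rlt_le_trans; [exact HN | apply Rmin_r]).
  (* Since [G z = P g] with [|g - 1| < 1/2], the partial product is at most twice [|G z|]; nothing
     is divided by [G z], so zeros of [G] are allowed. *)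
  assert (HP : Cmod P <= 2 * Cmod (G z)).
  { assert (T : Cmod P <= Cmod (G z) + Cmod P * Cmod (g - RtoC 1)%C).
    { rewrite <- Cmod_mult.
      replace P with (G z - P * (g - RtoC 1))%C at 1 by (rewrite E; ring).
      unfold Cminus at 1; eapply Rle_trans; [apply Cmod_triangle|].
      rewrite Cmod_opp; lra. }
    pose proof (Cmod_ge_0 P); nra. }
  apply Rmult_lt_compat_r with (r := 2 * (Cmod (G z) + 1)) in HN2; [|lra].
  unfold Rdiv in HN2; rewrite Rmult_assoc, Rinv_l in HN2 by lra.
  pose proof (Cmod_ge_0 (g - RtoC 1)%C); pose proof (Cmod_ge_0 P); nra.
Qed.

(** * The products [(z; t_1, ..., t_k)_infinity] as entire functions *)

Definition unit_entire (f : C -> C) : Prop :=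
  exists a : nat -> C, a O = RtoC 1 /\ (forall rho, conv_on a rho) /\ forall z, f z = Cps a z.

Lemma unit_entire_Cder (f : C -> C) (z : C) : unit_entire f -> exists l, Cder f z l.
Proof.
  intros [a [_ [Ha Hf]]]; exists (Cps (Cps_derive a) z).
  apply (is_derive_ext (K := C_AbsRing) (V := C_NormedModule) (Cps a));
    [intros t; symmetry; apply Hf|].
  apply Cder_Cps with (Cmod z + 1); [apply Ha | lra].
Qed.

Lemma Cps_0 (a : nat -> C) : Cps a (RtoC 0) = a O.
Proof.
  apply Cps_eq, is_Cseries_finite with 1%nat; [intros [|k] Hk; [lia | simpl; ring]|].
  simpl; ring.
Qed.

Lemma unit_entire_lipschitz (f : C -> C) : unit_entire f -> lipschitz_at_0 f.
Proof.
  intros H; destruct (unit_entire_Cder f (RtoC 0) H) as [l Hl].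
  apply lipschitz_of_Cder with l; [|exact Hl].
  destruct H as [a [H0 [_ H]]]; rewrite H, Cps_0; exact H0.
Qed.

(** Let [a] and [b] be the coefficients of [f] and [G], with [a 0 = 1]. Comparing coefficients of
    [z^k] in [G(z) = f(z) G(t z)] gives [(1 - t^k) b_k = sum_(i < k) b_i t^i a_(k-i)]. The recursion
    needs all earlier values, so [qcoef_upto] builds a table up to [n]. *)
Definition qcoef_step (a : nat -> C) (t : R) (b : nat -> C) (k : nat) : C :=
  (RtoC (/ (1 - t ^ k)) * Csum (fun i => b i * RtoC (t ^ i) * a (k - i)%nat) k)%C.

Fixpoint qcoef_upto (a : nat -> C) (t : R) (n : nat) : nat -> C :=
  match n with
  | O => fun _ => RtoC 1
  | S n' => fun k => if Nat.leb k n' then qcoef_upto a t n' k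
                     else qcoef_step a t (qcoef_upto a t n') k
  end.

Definition qcoef (a : nat -> C) (t : R) (k : nat) : C := qcoef_upto a t k k.

Lemma qcoef_upto_eq (a : nat -> C) (t : R) (n k : nat) :
  (k <= n)%nat -> qcoef_upto a t n k = qcoef a t k.
Proof.
  induction n as [|n IH]; intros H.
  - replace k with 0%nat by lia; reflexivity.
  - destruct (Nat.eq_dec k (S n)) as [->|N]; [reflexivity|].
    simpl; rewrite (proj2 (Nat.leb_le k n)) by lia; apply IH; lia.
Qed.

Lemma qcoef_S (a : nat -> C) (t : R) (k : nat) :
  qcoef a t (S k) = qcoef_step a t (qcoef a t) (S k).
Proof.
  unfold qcoef at 1; cbn [qcoef_upto].
  rewrite (proj2 (Nat.leb_gt (S k) k)) by lia.
  unfold qcoef_step; f_equal; apply Csum_ext; intros i Hi.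
  rewrite qcoef_upto_eq by lia; reflexivity.
Qed.

Lemma pow_S_le (t : R) (k : nat) : 0 < t < 1 -> t ^ S k <= t.
Proof.
  intros Ht; assert (0 <= t ^ k) by (apply pow_le; lra).
  assert (t ^ k <= 1) by (rewrite <- (pow1 k); apply pow_incr; lra).
  simpl; nra.
Qed.

Lemma qcoef_rec (a : nat -> C) (t : R) (k : nat) :
  0 < t < 1 -> a O = RtoC 1 ->
  qcoef a t k = Csum (fun i => qcoef a t i * RtoC (t ^ i) * a (k - i)%nat)%C (S k).
Proof.
  intros Ht Ha; simpl Csum; rewrite Nat.sub_diag, Ha.
  destruct k as [|k]; [simpl; ring|].
  assert (E : (RtoC (1 - t ^ S k) * qcoef a t (S k)
    = Csum (fun i => qcoef a t i * RtoC (t ^ i) * a (S k - i)%nat) (S k))%C).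
  { rewrite qcoef_S; unfold qcoef_step; rewrite Cmult_assoc, <- RtoC_mult, Rinv_r; [ring|].
    pose proof (pow_S_le t k Ht); lra. }
  rewrite <- E, RtoC_minus; ring.
Qed.

Lemma series_terms_bounded (b : nat -> R) :
  ex_series b -> exists M, forall k, Rabs (b k) <= M.
Proof.
  intros H; destruct (filterlim_bounded (K := R_AbsRing) (V := R_NormedModule) b) as [M HM].
  - exists 0; exact (ex_series_lim_0 b H).
  - exists M; exact HM.
Qed.

Lemma exp_le_compat (x y : R) : x <= y -> exp x <= exp y.
Proof. intros [H| ->]; [left; apply exp_increasing, H | right; reflexivity]. Qed.

Fixpoint Rsum (b : nat -> R) (N : nat) : R :=
  match N with O => 0 | S N' => Rsum b N' + b N' end.

(* Discrete Gronwall inequality. *)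
Lemma qcoef_conv (a : nat -> C) (t : R) :
  0 < t < 1 -> (forall rho, conv_on a rho) -> forall rho, conv_on (qcoef a t) rho.
Proof.
  intros Ht Ha rho s Hs.
  (* A radius beyond [rho]: once the weighted coefficients [beta] at [sg] are bounded, the series at
     [s < rho] is dominated by a geometric one of ratio [s / sg]. *)
  set (sg := rho + 1).
  destruct (series_terms_bounded _ (Ha (sg + 1) sg ltac:(unfold sg; lra))) as [M HM].
  assert (HM' : forall k, Cmod (a k) * sg ^ k <= M).
  { intros k; eapply Rle_trans; [apply Rle_abs | apply HM]. }
  assert (M0 : 0 <= M) by (eapply Rle_trans; [apply Rabs_pos | apply (HM O)]).
  set (beta := fun k => Cmod (qcoef a t k) * sg ^ k).
  set (A := M / (1 - t)).
  assert (A0 : 0 <= A) by (apply Rmult_le_pos; [lra | apply Rlt_le, Rinv_0_lt_compat; lra]).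
  assert (sgp : forall k, 0 < sg ^ k) by (intros; apply pow_lt; unfold sg; lra).
  assert (tp : forall k, 0 < t ^ k) by (intros; apply pow_lt; lra).
  assert (bp : forall k, 0 <= beta k).
  { intros k; apply Rmult_le_pos; [apply Cmod_ge_0 | apply Rlt_le, sgp]. }
  set (T := Rsum (fun i => t ^ i * beta i)).
  assert (Tp : forall n, 0 <= T n).
  { induction n as [|n IH]; unfold T; simpl; [lra|].
    fold T; pose proof (bp n); pose proof (tp n); nra. }
  assert (step : forall k n, (n <= k)%nat ->
    Cmod (Csum (fun i => qcoef a t i * RtoC (t ^ i) * a (k - i)%nat)%C n) * sg ^ k <= M * T n).
  { intros k; induction n as [|n IH]; intros Hn; unfold T; simpl.
    - rewrite Cmod_0; lra.
    - fold T; specialize (IH ltac:(lia)).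
      eapply Rle_trans;
        [apply Rmult_le_compat_r; [apply Rlt_le, sgp | apply Cmod_triangle]|].
      rewrite Rmult_plus_distr_r, Rmult_plus_distr_l; apply Rplus_le_compat; [exact IH|].
      rewrite !Cmod_mult, Cmod_R, Rabs_pos_eq by (apply Rlt_le, tp).
      replace (sg ^ k) with (sg ^ n * sg ^ (k - n)) by (rewrite <- pow_add; f_equal; lia).
      replace (Cmod (qcoef a t n) * t ^ n * Cmod (a (k - n)%nat) * (sg ^ n * sg ^ (k - n)))
        with ((t ^ n * beta n) * (Cmod (a (k - n)%nat) * sg ^ (k - n))) by (unfold beta; ring).
      rewrite (Rmult_comm M); apply Rmult_le_compat_l; [|apply HM'].
      apply Rmult_le_pos; [apply Rlt_le, tp | apply bp]. }
  (* [T k] sums [t^i beta i] over [i < k]. The recursion and [1 - t^k >= 1 - t] for [k >= 1] bound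
     [beta k] by [A * T k]; the summand 1 covers [k = 0]. *)
  assert (bT : forall k, beta k <= 1 + A * T k).
  { intros [|k].
    - unfold beta, T, qcoef; simpl; rewrite Cmod_1; lra.
    - unfold beta at 1; rewrite qcoef_S; unfold qcoef_step.
      pose proof (pow_S_le t k Ht) as Htk; pose proof (tp (S k)).
      rewrite Cmod_mult, Cmod_R, Rabs_pos_eq by (apply Rlt_le, Rinv_0_lt_compat; lra).
      pose proof (step (S k) (S k) (le_n _)) as P.
      rewrite Rmult_assoc.
      apply Rle_trans with (/ (1 - t) * (M * T (S k))).
      + apply Rmult_le_compat; [apply Rlt_le, Rinv_0_lt_compat; lra | | | exact P].
        * apply Rmult_le_pos; [apply Cmod_ge_0 | apply Rlt_le, sgp].
        * apply Rinv_le_contravar; lra.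
      + apply Rle_trans with (A * T (S k)); [right; unfold A; field; lra | lra]. }
  (* Passing to [k + 1] multiplies [1 + A * T k] by at most [1 + A t^k <= exp (A t^k)], and these
     exponents form a geometric sum. *)
  assert (U : forall k, 1 + A * T k <= exp (A / (1 - t) * (1 - t ^ k))).
  { induction k as [|k IH].
    - unfold T; simpl; rewrite Rminus_diag, !Rmult_0_r, exp_0; lra.
    - unfold T; simpl; fold T.
      apply Rle_trans with ((1 + A * T k) * (1 + A * t ^ k)).
      + pose proof (bT k); pose proof (tp k).
        assert (A * t ^ k * beta k <= A * t ^ k * (1 + A * T k)).
        { apply Rmult_le_compat_l; [apply Rmult_le_pos; lra | assumption]. }
        lra.
      + replace (A / (1 - t) * (1 - t * t ^ k)) with (A / (1 - t) * (1 - t ^ k) + A * t ^ k)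
          by (field; lra).
        rewrite exp_plus; apply Rmult_le_compat; [| |exact IH|apply exp_ineq1_le].
        * pose proof (Tp k); nra.
        * pose proof (tp k); nra. }
  assert (D : forall k, beta k <= exp (A / (1 - t))).
  { intros k; eapply Rle_trans; [apply bT|]; eapply Rle_trans; [apply U|].
    apply exp_le_compat; assert (0 <= A / (1 - t))
      by (apply Rmult_le_pos; [lra | apply Rlt_le, Rinv_0_lt_compat; lra]).
    pose proof (tp k); nra. }
  apply (ex_series_dominated _ (fun k => exp (A / (1 - t)) * (s / sg) ^ k)).
  - intros k; assert (0 <= s ^ k) by (apply pow_le; lra).
    split; [apply Rmult_le_pos; [apply Cmod_ge_0 | assumption]|].
    replace (Cmod (qcoef a t k) * s ^ k) with (beta k * (s / sg) ^ k).
    + apply Rmult_le_compat_r; [|apply D].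
      apply pow_le, Rmult_le_pos; [lra | apply Rlt_le, Rinv_0_lt_compat; unfold sg; lra].
    + unfold beta, Rdiv; rewrite Rpow_mult_distr, pow_inv.
      field; apply Rgt_not_eq, sgp.
  - apply (ex_series_scal (K := R_AbsRing) (V := R_NormedModule)), ex_series_geom.
    assert (0 <= s / sg)
      by (apply Rmult_le_pos; [lra | apply Rlt_le, Rinv_0_lt_compat; unfold sg; lra]).
    rewrite Rabs_pos_eq by assumption.
    apply Rmult_lt_reg_r with sg; [unfold sg; lra|].
    unfold Rdiv; rewrite Rmult_assoc, Rinv_l by (unfold sg; lra); unfold sg; lra.
Qed.

Lemma qcoef_functional (a : nat -> C) (t : R) (z : C) :
  0 < t < 1 -> a O = RtoC 1 -> (forall rho, conv_on a rho) ->
  Cps (qcoef a t) z = (Cps a z * Cps (qcoef a t) (z * RtoC t))%C.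
Proof.
  intros Ht H0 Ha; apply Cps_eq.
  pose proof (qcoef_conv a t Ht Ha) as Hb.
  pose proof (Cmod_ge_0 z) as Hz.
  assert (Hzt : Cmod (z * RtoC t)%C <= Cmod z).
  { rewrite Cmod_mult, Cmod_R, Rabs_pos_eq; nra. }
  set (rho := Cmod z + 1).
  assert (S1 : is_Cseries (fun k => a k * z ^ k)%C (Cps a z))
    by (apply is_Cseries_Cps with rho; [apply Ha | unfold rho; lra]).
  assert (S2 : is_Cseries (fun k => qcoef a t k * (z * RtoC t) ^ k)%C
      (Cps (qcoef a t) (z * RtoC t)))
    by (apply is_Cseries_Cps with rho; [apply Hb | unfold rho; lra]).
  assert (A1 : ex_series (fun k => Cmod (a k * z ^ k)%C)).
  { eapply ex_series_ext; [|apply (Ha rho (Cmod z)); unfold rho; lra].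
    intros n; rewrite Cmod_mult, Cmod_pow; reflexivity. }
  assert (A2 : ex_series (fun k => Cmod (qcoef a t k * (z * RtoC t) ^ k)%C)).
  { eapply ex_series_ext; [|apply (Hb rho (Cmod (z * RtoC t)%C)); unfold rho; split;
      [apply Cmod_ge_0 | lra]].
    intros n; rewrite (Cmod_mult (qcoef a t n)), Cmod_pow; reflexivity. }
  rewrite Cmult_comm.
  eapply is_Cseries_ext; [|exact (is_Cseries_mult _ _ _ _ S2 S1 A2 A1)].
  intros n; cbv beta.
  rewrite (qcoef_rec a t n Ht H0) at 1.
  rewrite (Cmult_comm _ (z ^ n)%C), <- Csum_scal.
  apply Csum_ext; intros k Hk.
  rewrite Cpow_mult_l, RtoC_pow.
  replace (z ^ n)%C with (z ^ k * z ^ (n - k))%C; [ring|].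
  rewrite <- Cpow_add_r; f_equal; lia.
Qed.

(** The power series [Cps (qcoef a t)] solves the functional equation, and such a solution is the
    product; convergence, entirety and the shift relation all come from this one identification. *)
Lemma unit_entire_Cprod_inf (f : C -> C) (t : R) :
  0 < t < 1 -> unit_entire f ->
  let F := fun z => Cprod_inf (fun n => f (z * RtoC (t ^ n))%C) in
  unit_entire F /\ forall z, F z = (f z * F (z * RtoC t))%C.
Proof.
  intros Ht [a [H0 [Ha Hf]]] F.
  assert (U : unit_entire (Cps (qcoef a t))).
  { exists (qcoef a t); split; [reflexivity | split; [apply qcoef_conv; assumption | reflexivity]]. }
  assert (E : forall z, Cps (qcoef a t) z = (f z * Cps (qcoef a t) (z * RtoC t))%C).
  { intros z; rewrite Hf; apply qcoef_functional; assumption. }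
  assert (HF : forall z, F z = Cps (qcoef a t) z).
  { intros z; apply Cprod_inf_functional; [exact Ht | apply unit_entire_lipschitz, U|].
    intros n; rewrite E; do 2 f_equal; rewrite <- Cmult_assoc, <- RtoC_mult.
    do 2 f_equal; simpl; ring. }
  split.
  - exists (qcoef a t); split; [reflexivity | split; [apply qcoef_conv; assumption | exact HF]].
  - intros z; rewrite !HF; apply E.
Qed.

Definition ratios (ts : list R) : Prop := List.Forall (fun t => 0 < t < 1) ts.

Lemma unit_entire_qpoch (ts : list R) : ratios ts -> unit_entire (fun z => qpoch z ts).
Proof.
  induction 1 as [|t ts Ht Hts IH].
  - exists (fun k => match k with O => RtoC 1 | 1%nat => RtoC (-1) | _ => RtoC 0 end).
    split; [reflexivity|]; split.
    + intros rho s Hs; apply (ex_series_incr_n _ 2).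
      apply ex_series_ext with (fun _ => 0); [intros n; simpl; rewrite Cmod_0; ring|].
      exists 0; exact (proj1 (proj1 (is_Cseries_components (fun _ => RtoC 0) (RtoC 0))
        (is_Cseries_finite _ 0 _ (fun _ _ => eq_refl) eq_refl))).
    + intros z; symmetry; apply Cps_eq, is_Cseries_finite with 2%nat.
      * intros [|[|k]] Hk; try lia; simpl; ring.
      * simpl; ring.
  - exact (proj1 (unit_entire_Cprod_inf (fun z => qpoch z ts) t Ht IH)).
Qed.

Lemma qpoch_cons (z : C) (t : R) (ts : list R) :
  ratios (t :: ts) -> qpoch z (t :: ts) = (qpoch z ts * qpoch (z * RtoC t) (t :: ts))%C.
Proof.
  intros H; inversion H as [|? ? Ht Hts]; subst.
  exact (proj2 (unit_entire_Cprod_inf (fun z => qpoch z ts) t Ht (unit_entire_qpoch ts Hts)) z).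
Qed.

(** Multiplication by [t^n] keeps a point off the ray [[1, infinity)], so by induction on the bases
    no finite product of factors vanishes; the remaining tail is taken at [z t^N] and lies within
    distance 1 of 1 for large [N]. *)
Lemma qpoch_neq_0 (ts : list R) :
  ratios ts -> forall z, ~ (exists x, 1 <= x /\ z = RtoC x) -> qpoch z ts <> RtoC 0.
Proof.
  intros H; pose proof H as H'; induction H as [|t ts Ht Hts IH]; intros z Hz.
  - simpl; intros E; apply Hz; exists 1; split; [lra|].
    replace z with (RtoC 1 - (RtoC 1 - z))%C by ring; rewrite E; ring.
  - assert (Hn : forall n, ~ (exists x, 1 <= x /\ (z * RtoC (t ^ n))%C = RtoC x)).
    { intros n [x [Hx E]]; apply Hz; assert (P : 0 < t ^ n) by (apply pow_lt; lra).
      assert (P1 : t ^ n <= 1) by (rewrite <- (pow1 n); apply pow_incr; lra).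
      exists (x / t ^ n); split.
      { apply Rmult_le_reg_r with (t ^ n); [exact P|].
        unfold Rdiv; rewrite Rmult_assoc, Rinv_l by lra; lra. }
      unfold Rdiv; rewrite RtoC_mult, RtoC_inv, <- E by lra.
      field; intros E'; apply RtoC_inj in E'; lra. }
    destruct (lipschitz_cvg (fun z => qpoch z (t :: ts)) t z Ht
      (unit_entire_lipschitz _ (unit_entire_qpoch _ H')) 1 Rlt_0_1) as [N HN].
    specialize (HN N (le_n _)).
    rewrite (Cprod_telescope (fun z => qpoch z ts) (fun z => qpoch z (t :: ts)) t z N).
    + apply Cmult_neq_0.
      * induction N as [|N IHN]; simpl; [exact C1_nz|].
        apply Cmult_neq_0; [|apply IH; [assumption | apply Hn]].
        clear HN IHN; induction N as [|N IHN]; simpl; [exact C1_nz|].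
        apply Cmult_neq_0; [exact IHN | apply IH; [assumption | apply Hn]].
      * intros E; rewrite E in HN.
        replace (RtoC 0 - RtoC 1)%C with (- RtoC 1)%C in HN by ring.
        rewrite Cmod_opp, Cmod_1 in HN; lra.
    + intros n; rewrite qpoch_cons by assumption; do 2 f_equal.
      rewrite <- Cmult_assoc, <- RtoC_mult; do 2 f_equal; simpl; ring.
Qed.

(* The coefficient at [k = 0] is [alpha 0 / 0 = 0]. *)
Definition lg (alpha : nat -> R) (k : nat) : C := RtoC (alpha k / INR k).

(** Only the germ of [F] at 0 is constrained, so [F] may be any global expression, such as a
    quotient of infinite products; it then serves as the analytic continuation of the exponential of
    the series. *)
Definition exp_series (alpha : nat -> R) (F : C -> C) : Prop :=
  exists rho, 0 < rho /\ conv_on (lg alpha) rho /\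
    forall x, Cmod x < rho -> Cexp (Cps (lg alpha) x) = F x.

Lemma lg_0 (alpha : nat -> R) : lg alpha 0 = RtoC 0.
Proof. unfold lg, Rdiv; simpl; rewrite Rinv_0, Rmult_0_r; reflexivity. Qed.

Lemma exp_series_ext (alpha beta : nat -> R) (F G : C -> C) :
  (forall k, (0 < k)%nat -> alpha k = beta k) -> (forall x, F x = G x) ->
  exp_series alpha F -> exp_series beta G.
Proof.
  intros H HF [rho [Hr [Hc He]]]; exists rho.
  assert (E : lg alpha = lg beta).
  { apply functional_extensionality; intros [|k]; [rewrite !lg_0; reflexivity|].
    unfold lg; rewrite H by lia; reflexivity. }
  rewrite <- E; split; [exact Hr | split; [exact Hc|]].
  intros x Hx; rewrite <- HF; apply He, Hx.
Qed.

(** The geometric series gives [L' = - 1 / (1 - x)] for the power series [L], so [exp (- L) (1 - x)]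
    is constant. All other contractions arise from this one by sums, signs, dilations and infinite
    products. *)
Lemma exp_series_log : exp_series (fun _ => -1) (fun x => RtoC 1 - x)%C.
Proof.
  set (a := lg (fun _ => -1)).
  assert (aS : forall k, a (S k) = RtoC (- 1 / INR (S k))) by reflexivity.
  assert (a0 : a O = RtoC 0) by apply lg_0.
  assert (Ca : conv_on a 1).
  { intros s Hs; apply (ex_series_dominated _ (fun k => s ^ k)).
    - intros k; assert (P : 0 <= s ^ k) by (apply pow_le; lra).
      assert (Q : Cmod (a k) <= 1).
      { destruct k as [|k]; [rewrite a0, Cmod_0; lra|].
        rewrite aS, Cmod_R; unfold Rdiv.
        rewrite Rabs_mult, Rabs_inv, (Rabs_pos_eq (INR (S k))) by apply pos_INR.
        replace (Rabs (-1)) with 1 by (rewrite Rabs_left; lra).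
        rewrite Rmult_1_l; rewrite <- Rinv_1; apply Rinv_le_contravar; [lra|].
        rewrite S_INR; pose proof (pos_INR k); lra. }
      pose proof (Cmod_ge_0 (a k)); split; [apply Rmult_le_pos; lra | nra].
    - apply ex_series_geom; rewrite Rabs_pos_eq; lra. }
  exists 1; split; [lra | split; [exact Ca|]].
  assert (Da : forall z, Cmod z < 1 -> (Cps (Cps_derive a) z = - / (RtoC 1 - z))%C).
  { intros z Hz; apply Cps_eq.
    replace (- / (RtoC 1 - z))%C with (RtoC (-1) * / (RtoC 1 - z))%C by ring.
    eapply is_Cseries_ext; [|exact (is_Cseries_scal (RtoC (-1)) _ _ (Cgeom z Hz))].
    intros n; unfold Cps_derive; rewrite aS, <- RtoC_mult; f_equal; f_equal.
    field; apply not_0_INR; discriminate. }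
  assert (N : forall z, Cmod z < 1 -> (RtoC 1 - z)%C <> RtoC 0).
  { intros z Hz N; assert (X : z = RtoC 1)
      by (replace z with (RtoC 1 - (RtoC 1 - z))%C by ring; rewrite N; ring).
    rewrite X, Cmod_1 in Hz; lra. }
  assert (D : forall z, Cmod z < 1 ->
    Cder (fun w => Cexp (RtoC (-1) * Cps a w) * (RtoC 1 + RtoC (-1) * w))%C z (RtoC 0)).
  { intros z Hz.
    pose proof (Cder_Cps a 1 z Ca Hz) as D1; rewrite Da in D1 by exact Hz.
    pose proof (Cder_mult _ _ z _ _ (Cder_const (RtoC (-1)) z) D1) as D2.
    pose proof (Cder_comp Cexp _ z _ _ (Cder_Cexp _) D2) as D3.
    pose proof (Cder_plus _ _ z _ _ (Cder_const (RtoC 1) z)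
      (Cder_mult _ _ z _ _ (Cder_const (RtoC (-1)) z) (Cder_id z))) as D4.
    eapply Cder_eq; [|exact (Cder_mult _ _ z _ _ D3 D4)].
    specialize (N z Hz); cbv beta; field; exact N. }
  intros x Hx; pose proof (Cder_zero_const _ 1 x D Hx) as E; cbv beta in E.
  rewrite Cps_0, a0 in E.
  replace (RtoC (-1) * RtoC 0)%C with (RtoC 0) in E by ring.
  replace (RtoC (-1) * Cps a x)%C with (- Cps a x)%C in E by ring.
  rewrite Cexp_0, Cexp_opp in E.
  apply (Cmult_cancel_l (/ Cexp (Cps a x))%C); [rewrite <- Cexp_opp; apply Cexp_neq_0|].
  rewrite Cinv_l by apply Cexp_neq_0.
  replace (RtoC 1 - x)%C with (RtoC 1 + RtoC (-1) * x)%C by ring.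
  rewrite E; ring.
Qed.

Lemma exp_series_plus (alpha beta : nat -> R) (F G : C -> C) :
  exp_series alpha F -> exp_series beta G ->
  exp_series (fun k => alpha k + beta k) (fun x => F x * G x)%C.
Proof.
  intros [r1 [Hr1 [C1 E1]]] [r2 [Hr2 [C2 E2]]].
  pose proof (Rmin_l r1 r2); pose proof (Rmin_r r1 r2).
  assert (L : forall k, lg (fun k => alpha k + beta k) k = (lg alpha k + lg beta k)%C).
  { intros k; unfold lg, Rdiv; rewrite Rmult_plus_distr_r, RtoC_plus; reflexivity. }
  exists (Rmin r1 r2); split; [apply Rmin_pos; assumption | split].
  - intros s Hs.
    refine (ex_series_dominated _ _ _
      (ex_series_plus (K := R_AbsRing) (V := R_NormedModule) _ _ (C1 s ltac:(lra)) (C2 s ltac:(lra)))).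
    intros k; unfold plus; simpl; assert (0 <= s ^ k) by (apply pow_le; lra).
    rewrite L; split; [apply Rmult_le_pos; [apply Cmod_ge_0 | assumption]|].
    pose proof (Cmod_triangle (lg alpha k) (lg beta k)); nra.
  - intros x Hx; rewrite <- E1, <- E2, <- Cexp_add by lra; f_equal.
    apply Cps_eq; eapply is_Cseries_ext;
      [|exact (is_Cseries_plus _ _ _ _ (is_Cseries_Cps _ r1 x C1 ltac:(lra))
          (is_Cseries_Cps _ r2 x C2 ltac:(lra)))].
    intros n; cbv beta; rewrite L; ring.
Qed.

Lemma exp_series_opp (alpha : nat -> R) (F : C -> C) :
  exp_series alpha F -> exp_series (fun k => - alpha k) (fun x => / F x)%C.
Proof.
  intros [r [Hr [C1 E1]]].
  assert (L : forall k, lg (fun k => - alpha k) k = (- lg alpha k)%C).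
  { intros k; unfold lg, Rdiv; rewrite <- RtoC_opp; f_equal; ring. }
  exists r; split; [exact Hr | split].
  - intros s Hs; eapply ex_series_ext; [|exact (C1 s Hs)].
    intros n; cbv beta; rewrite L, Cmod_opp; reflexivity.
  - intros x Hx; rewrite <- E1, <- Cexp_opp by assumption; f_equal.
    replace (- Cps (lg alpha) x)%C with (RtoC (-1) * Cps (lg alpha) x)%C by ring.
    apply Cps_eq; eapply is_Cseries_ext;
      [|exact (is_Cseries_scal (RtoC (-1)) _ _ (is_Cseries_Cps _ r x C1 Hx))].
    intros n; cbv beta; rewrite L; ring.
Qed.

Lemma exp_series_dilate (alpha : nat -> R) (F : C -> C) (s : R) :
  0 < s -> exp_series alpha F -> exp_series (fun k => alpha k * s ^ k) (fun x => F (RtoC s * x)%C).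
Proof.
  intros Hs [r [Hr [C1 E1]]].
  assert (L : forall k, lg (fun k => alpha k * s ^ k) k = (lg alpha k * RtoC (s ^ k))%C).
  { intros k; unfold lg, Rdiv; rewrite <- RtoC_mult; f_equal; ring. }
  assert (M : forall x, x < r / s -> s * x < r).
  { intros x Hx; apply Rmult_lt_compat_l with (r := s) in Hx; [|exact Hs].
    replace (s * (r / s)) with r in Hx by (field; lra); exact Hx. }
  exists (r / s); split; [apply Rdiv_lt_0_compat; assumption | split].
  - intros x Hx; eapply ex_series_ext; [|apply (C1 (s * x)); split; [nra | apply M; lra]].
    intros n; cbv beta; rewrite L, Cmod_mult, Cmod_R, Rpow_mult_distr, Rabs_pos_eq; [eqR; ring|].
    apply pow_le; lra.
  - intros x Hx.
    assert (Hx' : Cmod (RtoC s * x)%C < r).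
    { rewrite Cmod_mult, Cmod_R, Rabs_pos_eq by lra; apply M, Hx. }
    rewrite <- E1 by exact Hx'; f_equal; apply Cps_eq.
    eapply is_Cseries_ext; [|exact (is_Cseries_Cps _ r _ C1 Hx')].
    intros n; cbv beta; rewrite L, Cpow_mult_l, RtoC_pow; ring.
Qed.

(** For [k >= 1] one has [1 - t^k >= 1 - t], so the division keeps the disc of convergence; at
    [k = 0] it is harmless, since [lg] vanishes there. *)
Lemma exp_series_Cprod_inf (alpha : nat -> R) (f : C -> C) (t : R) :
  0 < t < 1 -> exp_series alpha f ->
  exp_series (fun k => alpha k / (1 - t ^ k)) (fun x => Cprod_inf (fun n => f (x * RtoC (t ^ n))%C)).
Proof.
  intros Ht [r [Hr [C1 E1]]].
  set (beta := fun k => alpha k / (1 - t ^ k)).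
  assert (L : forall k, lg alpha k = (lg beta k * RtoC (1 - t ^ k))%C).
  { intros [|k]; [rewrite !lg_0; ring|].
    unfold lg, beta; rewrite <- RtoC_mult; f_equal.
    pose proof (pow_S_le t k Ht); field; split; [lra | apply not_0_INR; discriminate]. }
  assert (B : forall k, Cmod (lg beta k) <= / (1 - t) * Cmod (lg alpha k)).
  { intros k; rewrite L, Cmod_mult, Cmod_R.
    destruct k as [|k]; [rewrite lg_0, Cmod_0; lra|].
    pose proof (pow_S_le t k Ht); rewrite Rabs_pos_eq by lra.
    pose proof (Cmod_ge_0 (lg beta (S k))).
    apply Rmult_le_reg_l with (1 - t); [lra|].
    replace ((1 - t) * (/ (1 - t) * (Cmod (lg beta (S k)) * (1 - t ^ S k))))
      with (Cmod (lg beta (S k)) * (1 - t ^ S k)) by (field; lra).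
    nra. }
  assert (Cb : conv_on (lg beta) r).
  { intros s Hs.
    refine (ex_series_dominated _ _ _
      (ex_series_scal (K := R_AbsRing) (V := R_NormedModule) (/ (1 - t)) _ (C1 s Hs))).
    intros k; unfold scal; simpl; unfold mult; simpl.
    assert (0 <= s ^ k) by (apply pow_le; lra).
    split; [apply Rmult_le_pos; [apply Cmod_ge_0 | assumption]|].
    rewrite <- Rmult_assoc; apply Rmult_le_compat_r; [assumption | apply B]. }
  exists r; split; [exact Hr | split; [exact Cb|]].
  intros x Hx; symmetry.
  apply (Cprod_inf_functional f (fun x => Cexp (Cps (lg beta) x))); [exact Ht| |].
  - apply lipschitz_of_Cder with (Cps (Cps_derive (lg beta)) (RtoC 0) * Cexp (Cps (lg beta) (RtoC 0)))%C.
    + rewrite Cps_0, lg_0; apply Cexp_0.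
    + apply Cder_comp; [apply Cder_Cexp | apply Cder_Cps with r; [exact Cb | rewrite Cmod_0; exact Hr]].
  - intros n; set (y := (x * RtoC (t ^ n))%C).
    assert (Hy : Cmod y < r).
    { unfold y; assert (0 <= t ^ n) by (apply pow_le; lra).
      assert (t ^ n <= 1) by (rewrite <- (pow1 n); apply pow_incr; lra).
      pose proof (Cmod_ge_0 x).
      rewrite Cmod_mult, Cmod_R, Rabs_pos_eq by assumption; nra. }
    replace (x * RtoC (t ^ S n))%C with (y * RtoC t)%C
      by (unfold y; rewrite <- Cmult_assoc, <- RtoC_mult; do 2 f_equal; simpl; ring).
    assert (Hyt : Cmod (y * RtoC t)%C < r).
    { pose proof (Cmod_ge_0 y); rewrite Cmod_mult, Cmod_R, Rabs_pos_eq by lra; nra. }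
    rewrite <- E1, <- Cexp_add by exact Hy; f_equal.
    apply Cps_eq; eapply is_Cseries_ext;
      [|exact (is_Cseries_plus _ _ _ _ (is_Cseries_Cps _ r _ C1 Hy)
          (is_Cseries_Cps _ r _ Cb Hyt))].
    intros k; cbv beta; rewrite L, Cpow_mult_l, RtoC_minus, RtoC_pow; ring.
Qed.

Lemma exp_series_qpoch (ts : list R) :
  ratios ts ->
  exp_series (fun k => fold_right (fun t x => x / (1 - t ^ k)) (-1) ts) (fun x => qpoch x ts).
Proof.
  induction 1 as [|t ts Ht Hts IH]; [exact exp_series_log|].
  exact (exp_series_Cprod_inf _ _ t Ht IH).
Qed.

(** * Fock space *)

(* The index [k] stands for the modes [alpha_(k+1)] and [alpha_(-k-1)]. *)
Definition mode (k : nat) : positive := Pos.of_succ_nat k.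

Lemma mode_inj (k l : nat) : mode k = mode l -> k = l.
Proof. apply SuccNat2Pos.inj. Qed.

Lemma mode_surj (p : positive) : mode (pred (Pos.to_nat p)) = p.
Proof.
  unfold mode; pose proof (Pos2Nat.is_pos p); lia.
Qed.

Definition annihilate (kap : nat -> R) (k : nat) (f : occ -> C) (n : occ) : C :=
  (RtoC (kap k * INR (S (n (mode k)))) * f (incr (mode k) n))%C.

Definition create (k : nat) (f : occ -> C) (n : occ) : C :=
  match n (mode k) with O => RtoC 0 | S _ => f (decr (mode k) n) end.

Lemma annihilate_create (kap : nat -> R) (k l : nat) (f : occ -> C) (n : occ) :
  annihilate kap k (create l f) n
  = (create l (annihilate kap k f) n + RtoC (if Nat.eqb k l then kap k else 0) * f n)%C.
Proof.
  unfold annihilate, create; destruct (Nat.eqb_spec k l) as [<-|H].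
  - rewrite incr_same, decr_incr.
    destruct (n (mode k)) as [|x] eqn:E.
    + simpl INR; rewrite Rmult_1_r; ring.
    + rewrite decr_same, E, incr_decr by congruence.
      rewrite !RtoC_mult, (S_INR (S x)), RtoC_plus; simpl Nat.pred; ring.
  - assert (Hm : mode k <> mode l) by (intros E; apply H, mode_inj, E).
    rewrite (incr_other (mode l) (mode k)) by congruence.
    destruct (n (mode l)) as [|x] eqn:E; [ring|].
    rewrite (decr_other (mode k) (mode l)), incr_decr_comm by congruence; ring.
Qed.

Lemma create_comm (k l : nat) (f : occ -> C) (n : occ) :
  create k (create l f) n = create l (create k f) n.
Proof.
  destruct (Nat.eq_dec k l) as [->|H]; [reflexivity|].
  assert (Hm : mode k <> mode l) by (intros E; apply H, mode_inj, E).
  unfold create; rewrite !decr_other by congruence.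
  destruct (n (mode k)), (n (mode l)); try reflexivity.
  rewrite decr_comm; reflexivity.
Qed.

Lemma annihilate_comm (kap : nat -> R) (k l : nat) (f : occ -> C) (n : occ) :
  annihilate kap k (annihilate kap l f) n = annihilate kap l (annihilate kap k f) n.
Proof.
  destruct (Nat.eq_dec k l) as [->|H]; [reflexivity|].
  assert (Hm : mode k <> mode l) by (intros E; apply H, mode_inj, E).
  unfold annihilate; rewrite !incr_other, (incr_comm (mode k)) by congruence; ring.
Qed.

Fixpoint nsum (L : nat) (n : occ) : nat :=
  match L with O => O | S L' => (nsum L' n + n (mode L'))%nat end.

(* At occupations [n] of level [L], the first [L] modes and the first [L] terms
   of the exponential series are all that contribute to [Em]. *)
Definition Lev (L : nat) (n : occ) : Prop :=
  (forall k, (L <= k)%nat -> n (mode k) = O) /\ (nsum L n < L)%nat.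

Lemma nsum_tail (L L' : nat) (n : occ) :
  (L <= L')%nat -> (forall k, (L <= k)%nat -> n (mode k) = O) -> nsum L' n = nsum L n.
Proof.
  intros H Z; induction H as [|L' H IH]; [reflexivity|].
  simpl; rewrite IH, Z by lia; lia.
Qed.

Lemma Lev_mono (L L' : nat) (n : occ) : Lev L n -> (L <= L')%nat -> Lev L' n.
Proof.
  intros [H1 H2] H; split; [intros k Hk; apply H1; lia|].
  rewrite (nsum_tail L L') by assumption; lia.
Qed.

Lemma nsum_incr (L k : nat) (n : occ) :
  nsum L (incr (mode k) n) = (nsum L n + if Nat.ltb k L then 1 else 0)%nat.
Proof.
  induction L as [|L IH]; [reflexivity|].
  cbn [nsum]; rewrite IH; unfold incr at 1.
  destruct (Pos.eqb_spec (mode L) (mode k)) as [E|E].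
  - apply mode_inj in E; subst k.
    rewrite (proj2 (Nat.ltb_ge L L)), (proj2 (Nat.ltb_lt L (S L))) by lia; lia.
  - assert (L <> k) by congruence.
    destruct (Nat.ltb_spec k L), (Nat.ltb_spec k (S L)); lia.
Qed.

Lemma nsum_decr (L k : nat) (n : occ) :
  n (mode k) <> O -> (k < L)%nat -> nsum L n = S (nsum L (decr (mode k) n)).
Proof.
  intros H Hk; rewrite <- (incr_decr (mode k) n H) at 1.
  rewrite nsum_incr, (proj2 (Nat.ltb_lt k L) Hk); lia.
Qed.

Lemma Lev_decr (L k : nat) (n : occ) :
  Lev L n -> n (mode k) <> O -> Lev L (decr (mode k) n).
Proof.
  intros [H1 H2] Hn.
  assert (Hk : (k < L)%nat) by (destruct (Nat.lt_ge_cases k L) as [|G]; [|apply H1 in G]; lia).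
  split.
  - intros l Hl; unfold decr; rewrite H1 by exact Hl; destruct (Pos.eqb _ _); reflexivity.
  - pose proof (nsum_decr L k n Hn Hk); lia.
Qed.

Lemma Lev_exists (n : occ) : finite_occ n -> exists L, Lev L n.
Proof.
  intros [N HN].
  assert (Z : forall k, (Pos.to_nat N <= k)%nat -> n (mode k) = O).
  { intros k Hk; apply HN; unfold mode; lia. }
  set (L := (Pos.to_nat N + S (nsum (Pos.to_nat N) n))%nat).
  exists L; split; [intros k Hk; apply Z; unfold L in *; lia|].
  rewrite (nsum_tail (Pos.to_nat N)) by (unfold L; try assumption; lia); unfold L; lia.
Qed.

Lemma finite_incr (k : nat) (n : occ) : finite_occ n -> finite_occ (incr (mode k) n).
Proof.
  intros [N HN]; exists (Pos.max N (mode k)); intros m Hm.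
  rewrite incr_other by lia; apply HN; lia.
Qed.

Lemma finite_decr (k : nat) (n : occ) : finite_occ n -> finite_occ (decr (mode k) n).
Proof.
  intros [N HN]; exists N; intros m Hm; unfold decr; rewrite HN by exact Hm.
  destruct (Pos.eqb m (mode k)); reflexivity.
Qed.

(* Unspecified when [n] has infinite support. *)
Definition lev (n : occ) : nat := epsilon (inhabits O) (fun L => Lev L n).

Lemma lev_spec (n : occ) : finite_occ n -> Lev (lev n) n.
Proof. intros H; unfold lev; apply epsilon_spec, Lev_exists, H. Qed.

(** * Exponentials of creation operators *)

Definition raise (L : nat) (b : nat -> C) (f : occ -> C) (n : occ) : C :=
  Csum (fun k => b k * create k f n)%C L.

Definition raise_all (b : nat -> C) (f : occ -> C) (n : occ) : C := raise (lev n) b f n.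

Definition exp_upto (K : nat) (A : (occ -> C) -> occ -> C) (f : occ -> C) (n : occ) : C :=
  Csum (fun k => RtoC (/ INR (fact k)) * Nat.iter k A f n)%C K.

Definition Em (b : nat -> C) (f : occ -> C) (n : occ) : C :=
  exp_upto (lev n) (raise (lev n) b) f n.

Lemma raise_mono (L L' : nat) (b : nat -> C) (f : occ -> C) (n : occ) :
  Lev L n -> (L <= L')%nat -> raise L' b f n = raise L b f n.
Proof.
  intros [H _] HL; apply Csum_le; [exact HL|].
  intros k Hk; unfold create; rewrite H by lia; ring.
Qed.

Lemma raise_local (L : nat) (b : nat -> C) (f g : occ -> C) (n : occ) :
  Lev L n -> (forall m, Lev L m -> f m = g m) -> raise L b f n = raise L b g n.
Proof.
  intros H E; apply Csum_ext; intros k Hk; f_equal; unfold create.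
  destruct (n (mode k)) eqn:Hn; [reflexivity|].
  apply E, Lev_decr; [exact H | lia].
Qed.

Lemma iter_raise_mono (L L' : nat) (b : nat -> C) (f : occ -> C) (k : nat) :
  (L <= L')%nat -> forall n, Lev L n ->
  Nat.iter k (raise L' b) f n = Nat.iter k (raise L b) f n.
Proof.
  intros HL; induction k as [|k IH]; intros n Hn; [reflexivity|].
  simpl; rewrite (raise_mono L L') by assumption.
  apply raise_local; assumption.
Qed.

(** Read on coefficients, each creation operator removes one quantum from [n], and it gives 0 when
    there is none left to remove. *)
Lemma iter_raise_vanish (L : nat) (b : nat -> C) (f : occ -> C) (k : nat) :
  forall n, Lev L n -> (nsum L n < k)%nat -> Nat.iter k (raise L b) f n = RtoC 0.
Proof.
  induction k as [|k IH]; intros n Hn Hk; [lia|].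
  simpl; apply Csum_zero; intros l Hl; unfold create.
  destruct (n (mode l)) eqn:E; [ring|].
  rewrite IH; [ring | apply Lev_decr; [exact Hn | lia] |].
  pose proof (nsum_decr L l n ltac:(lia) Hl); lia.
Qed.

(** Any two admissible truncations agree with a common larger one, so the arbitrary choice made by
    [lev] does not matter. *)
Lemma Em_Lev (L : nat) (b : nat -> C) (f : occ -> C) (n : occ) :
  finite_occ n -> Lev L n -> Em b f n = exp_upto L (raise L b) f n.
Proof.
  intros Hf H.
  assert (G : forall L1 L2, Lev L1 n -> (L1 <= L2)%nat ->
    exp_upto L2 (raise L2 b) f n = exp_upto L1 (raise L1 b) f n).
  { intros L1 L2 H1 H12; unfold exp_upto; rewrite (Csum_le _ L1 L2).
    - apply Csum_ext; intros k Hk; rewrite (iter_raise_mono L1 L2) by assumption; reflexivity.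
    - exact H12.
    - intros k Hk; rewrite (iter_raise_mono L1 L2), iter_raise_vanish;
        try assumption; [ring | destruct H1; lia]. }
  unfold Em; pose proof (lev_spec n Hf) as H0.
  rewrite <- (G (lev n) (lev n + L)%nat), <- (G L (lev n + L)%nat) by (assumption || lia).
  reflexivity.
Qed.

(** [raise_all] truncates at a level that changes with the occupation, while sums are handled at one
    fixed [L]. Both agree because [create] evaluates its argument within level [L]. *)
Lemma iter_raise_all (L : nat) (b : nat -> C) (f : occ -> C) (k : nat) :
  forall n, finite_occ n -> Lev L n ->
  Nat.iter k (raise_all b) f n = Nat.iter k (raise L b) f n.
Proof.
  induction k as [|k IH]; intros n Hf Hn; [reflexivity|].
  simpl; unfold raise_all at 1; pose proof (lev_spec n Hf) as H0.
  rewrite <- (raise_mono (lev n) (lev n + L)), <- (raise_mono L (lev n + L)) by (assumption || lia).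
  apply Csum_ext; intros l Hl; f_equal; unfold create.
  destruct (n (mode l)) eqn:E; [reflexivity|].
  apply IH; [apply finite_decr, Hf | apply Lev_decr; [exact Hn | lia]].
Qed.

Lemma raise_scal (L : nat) (b : nat -> C) (c : C) (f : occ -> C) :
  raise L b (fun n => c * f n)%C = (fun n => c * raise L b f n)%C.
Proof.
  apply functional_extensionality; intros n; unfold raise; rewrite <- Csum_scal.
  apply Csum_ext; intros k _; unfold create; destruct (n (mode k)); ring.
Qed.

Lemma raise_plus (L : nat) (b : nat -> C) (f g : occ -> C) :
  raise L b (fun n => f n + g n)%C = (fun n => raise L b f n + raise L b g n)%C.
Proof.
  apply functional_extensionality; intros n; unfold raise; rewrite <- Csum_plus.
  apply Csum_ext; intros k _; unfold create; destruct (n (mode k)); ring.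
Qed.

Lemma iter_scal (A : (occ -> C) -> occ -> C) (c : C) (f : occ -> C) (k : nat) :
  (forall f, A (fun n => c * f n)%C = (fun n => c * A f n)%C) ->
  Nat.iter k A (fun n => c * f n)%C = (fun n => c * Nat.iter k A f n)%C.
Proof. intros H; induction k as [|k IH]; [reflexivity|]; simpl; rewrite IH; apply H. Qed.

Lemma iter_plus (A : (occ -> C) -> occ -> C) (f g : occ -> C) (k : nat) :
  (forall f g, A (fun n => f n + g n)%C = (fun n => A f n + A g n)%C) ->
  Nat.iter k A (fun n => f n + g n)%C = (fun n => Nat.iter k A f n + Nat.iter k A g n)%C.
Proof. intros H; induction k as [|k IH]; [reflexivity|]; simpl; rewrite IH; apply H. Qed.

Lemma exp_upto_scal (K : nat) (A : (occ -> C) -> occ -> C) (c : C) (f : occ -> C) (n : occ) :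
  (forall f, A (fun n => c * f n)%C = (fun n => c * A f n)%C) ->
  exp_upto K A (fun n => c * f n)%C n = (c * exp_upto K A f n)%C.
Proof.
  intros H; unfold exp_upto; rewrite <- Csum_scal; apply Csum_ext; intros k _.
  rewrite iter_scal by exact H; ring.
Qed.

Lemma exp_upto_plus (K : nat) (A : (occ -> C) -> occ -> C) (f g : occ -> C) (n : occ) :
  (forall f g, A (fun n => f n + g n)%C = (fun n => A f n + A g n)%C) ->
  exp_upto K A (fun n => f n + g n)%C n = (exp_upto K A f n + exp_upto K A g n)%C.
Proof.
  intros H; unfold exp_upto; rewrite <- Csum_plus; apply Csum_ext; intros k _.
  rewrite iter_plus by exact H; ring.
Qed.

Lemma Em_scal (b : nat -> C) (c : C) (f : occ -> C) (n : occ) :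
  Em b (fun n => c * f n)%C n = (c * Em b f n)%C.
Proof. apply exp_upto_scal; intros g; apply raise_scal. Qed.

Lemma Em_plus (b : nat -> C) (f g : occ -> C) (n : occ) :
  Em b (fun n => f n + g n)%C n = (Em b f n + Em b g n)%C.
Proof. apply exp_upto_plus; intros g1 g2; apply raise_plus. Qed.

(** At a fixed occupation only finitely many coefficients of the argument enter, so termwise
    summation needs no estimate. *)
Lemma iter_raise_series (L : nat) (b : nat -> C) (s : nat -> occ -> C) (f : occ -> C) (j : nat) :
  (forall n, finite_occ n -> is_Cseries (fun k => s k n) (f n)) ->
  forall n, finite_occ n ->
  is_Cseries (fun k => Nat.iter j (raise L b) (s k) n) (Nat.iter j (raise L b) f n).
Proof.
  intros H; induction j as [|j IH]; intros n Hn; [apply H, Hn|].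
  simpl; apply (is_Cseries_Csum
    (fun k l => b l * create l (Nat.iter j (raise L b) (s k)) n)%C).
  intros l _; apply is_Cseries_scal; unfold create.
  destruct (n (mode l)) eqn:E.
  - apply is_Cseries_finite with O; reflexivity.
  - apply IH, finite_decr, Hn.
Qed.

Lemma Em_series (b : nat -> C) (s : nat -> occ -> C) (f : occ -> C) :
  (forall n, finite_occ n -> is_Cseries (fun k => s k n) (f n)) ->
  forall n, finite_occ n -> is_Cseries (fun k => Em b (s k) n) (Em b f n).
Proof.
  intros H n Hn; unfold Em, exp_upto.
  apply (is_Cseries_Csum
    (fun k l => RtoC (/ INR (fact l)) * Nat.iter l (raise (lev n) b) (s k) n)%C).
  intros l _; apply is_Cseries_scal, iter_raise_series; assumption.
Qed.

Lemma iter_raise_local (L : nat) (b : nat -> C) (f g : occ -> C) (k : nat) :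
  (forall n, finite_occ n -> f n = g n) ->
  forall n, finite_occ n -> Nat.iter k (raise L b) f n = Nat.iter k (raise L b) g n.
Proof.
  intros E; induction k as [|k IH]; intros n Hn; [apply E, Hn|].
  simpl; apply Csum_ext; intros l _; f_equal; unfold create.
  destruct (n (mode l)); [reflexivity | apply IH, finite_decr, Hn].
Qed.

Lemma Em_local (b : nat -> C) (f g : occ -> C) :
  (forall n, finite_occ n -> f n = g n) -> forall n, finite_occ n -> Em b f n = Em b g n.
Proof.
  intros E n Hn; apply Csum_ext; intros k _; f_equal; apply iter_raise_local; assumption.
Qed.

Lemma annihilate_raise (kap : nat -> R) (L m : nat) (b : nat -> C) (f : occ -> C) :
  (m < L)%nat ->
  annihilate kap m (raise L b f)
  = (fun n => raise L b (annihilate kap m f) n + RtoC (kap m) * b m * f n)%C.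
Proof.
  intros Hm; apply functional_extensionality; intros n.
  transitivity (Csum (fun k => b k * annihilate kap m (create k f) n)%C L).
  { unfold annihilate, raise; rewrite <- Csum_scal; apply Csum_ext; intros; ring. }
  transitivity (Csum (fun k => b k * create k (annihilate kap m f) n
    + b k * RtoC (if Nat.eqb m k then kap m else 0) * f n)%C L).
  { apply Csum_ext; intros k _; rewrite annihilate_create; ring. }
  rewrite Csum_plus; f_equal.
  rewrite (Csum_single _ L m Hm).
  - rewrite Nat.eqb_refl; ring.
  - intros k Hk; rewrite (proj2 (Nat.eqb_neq m k)) by lia; ring.
Qed.

(** For a scalar commutator [[A, R] = c] one has [[A, R^(k+1)] = (k + 1) c R^k]; summed against the
    inverse factorials this yields [[A, exp R] = c exp R]. *)
Lemma annihilate_iter_raise (kap : nat -> R) (L m : nat) (b : nat -> C) (f : occ -> C) (k : nat) :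
  (m < L)%nat ->
  annihilate kap m (Nat.iter (S k) (raise L b) f)
  = (fun n => Nat.iter (S k) (raise L b) (annihilate kap m f) n
       + RtoC (INR (S k)) * (RtoC (kap m) * b m * Nat.iter k (raise L b) f n))%C.
Proof.
  intros Hm; induction k as [|k IH].
  - simpl; rewrite annihilate_raise by exact Hm.
    apply functional_extensionality; intros n; ring.
  - change (Nat.iter (S (S k)) (raise L b) f) with (raise L b (Nat.iter (S k) (raise L b) f)).
    rewrite annihilate_raise, IH by exact Hm.
    apply functional_extensionality; intros n.
    rewrite raise_plus, raise_scal, raise_scal.
    change (raise L b (Nat.iter k (raise L b) f) n) with (Nat.iter (S k) (raise L b) f n).
    change (raise L b (Nat.iter (S k) (raise L b) (annihilate kap m f)) n)
      with (Nat.iter (S (S k)) (raise L b) (annihilate kap m f) n).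
    rewrite (S_INR (S k)), RtoC_plus; ring.
Qed.

Lemma annihilate_Em (kap : nat -> R) (m : nat) (b : nat -> C) (f : occ -> C) (n : occ) :
  finite_occ n ->
  annihilate kap m (Em b f) n
  = (Em b (annihilate kap m f) n + RtoC (kap m) * b m * Em b f n)%C.
Proof.
  intros Hn; pose proof (finite_incr m n Hn) as Hi.
  destruct (Lev_exists _ Hn) as [L1 H1], (Lev_exists _ Hi) as [L2 H2].
  (* One truncation [S K] must serve both [n] and [incr (mode m) n]. The commutator shortens the
     exponential sum by one term, so the term of index [K] has to vanish at [n], which is the
     purpose of [Hsz]. *)
  set (K := (L1 + L2 + S m)%nat).
  assert (HK : Lev (S K) n) by (apply Lev_mono with L1; [exact H1 | unfold K; lia]).
  assert (HKi : Lev (S K) (incr (mode m) n))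
    by (apply Lev_mono with L2; [exact H2 | unfold K; lia]).
  assert (Hm : (m < S K)%nat) by (unfold K; lia).
  assert (Hsz : (nsum (S K) n < K)%nat).
  { destruct HKi as [_ G]; rewrite nsum_incr, (proj2 (Nat.ltb_lt m (S K)) Hm) in G; lia. }
  set (A := raise (S K) b).
  transitivity (exp_upto (S K) A (annihilate kap m f) n
    + RtoC (kap m) * b m * exp_upto K A f n)%C.
  - transitivity (Csum (fun k => RtoC (/ INR (fact k))
      * annihilate kap m (Nat.iter k A f) n)%C (S K)).
    { unfold annihilate at 1; rewrite (Em_Lev (S K)) by assumption.
      unfold exp_upto; rewrite <- Csum_scal; apply Csum_ext; intros k _.
      unfold annihilate, A; ring. }
    unfold exp_upto at 1; rewrite !Csum_shift.
    unfold exp_upto; rewrite <- Csum_scal, <- Cplus_assoc, <- Csum_plus.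
    f_equal; apply Csum_ext; intros k _.
    unfold A; rewrite annihilate_iter_raise by exact Hm.
    rewrite (RtoC_inv_fact k); ring.
  - rewrite !(Em_Lev (S K)) by assumption; do 2 f_equal.
    unfold exp_upto; simpl Csum; unfold A.
    rewrite iter_raise_vanish by assumption; ring.
Qed.

(* [[alpha_m, W] = kappa_m w_m W] for [m > 0]; on such states annihilation
   operators act by convergent series even though the states are infinite. *)
Record creation (kap : nat -> R) (W : (occ -> C) -> occ -> C) (w : nat -> C) : Prop := {
  creation_scal : forall c f n, W (fun n => c * f n)%C n = (c * W f n)%C;
  creation_plus : forall f g n, W (fun n => f n + g n)%C n = (W f n + W g n)%C;
  creation_local : forall f g, (forall n, finite_occ n -> f n = g n) ->
    forall n, finite_occ n -> W f n = W g n;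
  creation_series : forall (s : nat -> occ -> C) f,
    (forall n, finite_occ n -> is_Cseries (fun k => s k n) (f n)) ->
    forall n, finite_occ n -> is_Cseries (fun k => W (s k) n) (W f n);
  creation_annihilate : forall m f n, finite_occ n ->
    annihilate kap m (W f) n = (W (annihilate kap m f) n + RtoC (kap m) * w m * W f n)%C }.

Lemma creation_id (kap : nat -> R) : creation kap (fun f => f) (fun _ => RtoC 0).
Proof.
  split; intros; cbv beta; try reflexivity; try (apply H; assumption); ring.
Qed.

Lemma creation_Em (kap : nat -> R) (b : nat -> C) (W : (occ -> C) -> occ -> C) (w : nat -> C) :
  creation kap W w -> creation kap (fun f => Em b (W f)) (fun k => b k + w k)%C.
Proof.
  intros [H1 H2 H3 H4 H5]; split.
  - intros c f n.
    replace (W (fun n => c * f n)%C) with (fun n => c * W f n)%C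
      by (apply functional_extensionality; intros; rewrite H1; reflexivity).
    apply Em_scal.
  - intros f g n.
    replace (W (fun n => f n + g n)%C) with (fun n => W f n + W g n)%C
      by (apply functional_extensionality; intros; rewrite H2; reflexivity).
    apply Em_plus.
  - intros f g E n Hn; apply Em_local; [apply H3, E | exact Hn].
  - intros s f Hs n Hn; apply Em_series; [|exact Hn]; intros m Hm; apply H4; assumption.
  - intros m f n Hn; rewrite annihilate_Em by exact Hn.
    rewrite (Em_local b (annihilate kap m (W f))
      (fun n => W (annihilate kap m f) n + RtoC (kap m) * w m * W f n)%C)
      by (try assumption; intros; apply H5; assumption).
    rewrite Em_plus, Em_scal; ring.
Qed.

(* States of finitely many modes, on which annihilation is nilpotent. *)
Definition Fin (N d : nat) (f : occ -> C) : Prop :=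
  forall n, f n <> RtoC 0 ->
    (forall k, (N <= k)%nat -> n (mode k) = O) /\ (nsum N n < d)%nat.

Definition lower (kap : nat -> R) (N : nat) (a : nat -> C) (f : occ -> C) (n : occ) : C :=
  Csum (fun k => a k * annihilate kap k f n)%C N.

(** On [Fin N d] the [d]-th power of [lower] is zero, so cutting the exponential at [d] terms and
    [N] modes loses nothing. *)
Definition Ep (kap : nat -> R) (N d : nat) (a : nat -> C) (f : occ -> C) (n : occ) : C :=
  exp_upto d (lower kap N a) f n.

Lemma Csum_neq_0 (a : nat -> C) (N : nat) :
  Csum a N <> RtoC 0 -> exists k, (k < N)%nat /\ a k <> RtoC 0.
Proof.
  induction N as [|N IH]; simpl; intros H; [congruence|].
  destruct (excluded_middle_informative (a N = RtoC 0)) as [E|E]; [|exists N; split; [lia | exact E]].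
  destruct IH as [k [Hk Ek]].
  - intros Z; apply H; rewrite Z, E; ring.
  - exists k; split; [lia | exact Ek].
Qed.

Lemma Cmult_neq_0_inv (a b : C) : (a * b)%C <> RtoC 0 -> a <> RtoC 0 /\ b <> RtoC 0.
Proof. intros H; split; intros E; apply H; rewrite E; ring. Qed.

Lemma Fin_annihilate (kap : nat -> R) (N d k : nat) (f : occ -> C) :
  Fin N d f -> forall n, annihilate kap k f n <> RtoC 0 ->
  (k < N)%nat /\ (forall k, (N <= k)%nat -> n (mode k) = O) /\ (S (nsum N n) < d)%nat.
Proof.
  intros H n Hn; apply Cmult_neq_0_inv in Hn; destruct Hn as [_ Hn].
  apply H in Hn; destruct Hn as [H1 H2].
  assert (Hk : (k < N)%nat).
  { destruct (Nat.lt_ge_cases k N) as [|G]; [assumption|].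
    apply H1 in G; rewrite incr_same in G; discriminate. }
  split; [exact Hk|]; split.
  - intros l Hl; rewrite <- (H1 l Hl), incr_other; [reflexivity|].
    intros E; apply mode_inj in E; lia.
  - rewrite nsum_incr, (proj2 (Nat.ltb_lt k N) Hk) in H2; lia.
Qed.

Lemma Fin_lower (kap : nat -> R) (N d : nat) (a : nat -> C) (f : occ -> C) :
  Fin N d f -> Fin N (pred d) (lower kap N a f).
Proof.
  intros H n Hn; apply Csum_neq_0 in Hn; destruct Hn as [k [Hk Hn]].
  apply Cmult_neq_0_inv in Hn; destruct Hn as [_ Hn].
  apply (Fin_annihilate kap N d k f H) in Hn; destruct Hn as [_ [H1 H2]].
  split; [exact H1 | lia].
Qed.

Lemma Fin_mono (N d d' : nat) (f : occ -> C) : (d <= d')%nat -> Fin N d f -> Fin N d' f.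
Proof. intros Hd H n Hn; destruct (H n Hn) as [H1 H2]; split; [exact H1 | lia]. Qed.

Lemma Fin_iter (kap : nat -> R) (N d : nat) (a : nat -> C) (f : occ -> C) (k : nat) :
  Fin N d f -> Fin N (d - k) (Nat.iter k (lower kap N a) f).
Proof.
  intros H; induction k as [|k IH]; [rewrite Nat.sub_0_r; exact H|].
  simpl; replace (d - S k)%nat with (pred (d - k)) by lia; apply Fin_lower, IH.
Qed.

Lemma Fin_0 (N : nat) (f : occ -> C) : Fin N 0 f -> f = (fun _ => RtoC 0).
Proof.
  intros H; apply functional_extensionality; intros n.
  destruct (excluded_middle_informative (f n = RtoC 0)) as [E|E]; [exact E|].
  apply H in E; lia.
Qed.

Lemma Fin_scal (N d : nat) (c : C) (f : occ -> C) : Fin N d f -> Fin N d (fun n => c * f n)%C.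
Proof. intros H n Hn; apply Cmult_neq_0_inv in Hn; apply H, Hn. Qed.

Lemma Fin_Ep (kap : nat -> R) (N d : nat) (a : nat -> C) (f : occ -> C) :
  Fin N d f -> Fin N d (Ep kap N d a f).
Proof.
  intros H n Hn; apply Csum_neq_0 in Hn; destruct Hn as [k [Hk Hn]].
  apply Cmult_neq_0_inv in Hn; destruct Hn as [_ Hn].
  apply (Fin_mono N (d - k) d _ ltac:(lia) (Fin_iter kap N d a f k H)), Hn.
Qed.

Lemma lower_scal (kap : nat -> R) (N : nat) (a : nat -> C) (c : C) (f : occ -> C) :
  lower kap N a (fun n => c * f n)%C = (fun n => c * lower kap N a f n)%C.
Proof.
  apply functional_extensionality; intros n; unfold lower; rewrite <- Csum_scal.
  apply Csum_ext; intros k _; unfold annihilate; ring.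
Qed.

Lemma lower_plus (kap : nat -> R) (N : nat) (a : nat -> C) (f g : occ -> C) :
  lower kap N a (fun n => f n + g n)%C = (fun n => lower kap N a f n + lower kap N a g n)%C.
Proof.
  apply functional_extensionality; intros n; unfold lower; rewrite <- Csum_plus.
  apply Csum_ext; intros k _; unfold annihilate; ring.
Qed.

Lemma Ep_scal (kap : nat -> R) (N d : nat) (a : nat -> C) (c : C) (f : occ -> C) :
  Ep kap N d a (fun n => c * f n)%C = (fun n => c * Ep kap N d a f n)%C.
Proof.
  apply functional_extensionality; intros n; apply exp_upto_scal; intros g; apply lower_scal.
Qed.

Lemma Csum_func (A : (occ -> C) -> occ -> C) (g : nat -> occ -> C) (K : nat) :
  (forall c f, A (fun n => c * f n)%C = (fun n => c * A f n)%C) ->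
  (forall f g, A (fun n => f n + g n)%C = (fun n => A f n + A g n)%C) ->
  A (fun n => Csum (fun k => g k n) K) = (fun n => Csum (fun k => A (g k) n) K).
Proof.
  intros Hs Hp; induction K as [|K IH]; simpl.
  - specialize (Hs (RtoC 0) (fun _ => RtoC 0)).
    replace (fun _ : occ => RtoC 0) with (fun _ : occ => RtoC 0 * RtoC 0)%C
      by (apply functional_extensionality; intros; ring).
    rewrite Hs; apply functional_extensionality; intros; ring.
  - rewrite Hp, IH; reflexivity.
Qed.

(* Coefficient of [x^j / j!] in [(x + c)^k / k!]. *)
Definition exp_coef (c : C) (k j : nat) : C :=
  if Nat.leb j k then (RtoC (/ INR (fact (k - j))) * c ^ (k - j))%C else RtoC 0.

Lemma exp_coef_series (c : C) (j : nat) : is_Cseries (fun k => exp_coef c k j) (Cexp c).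
Proof.
  induction j as [|j IH].
  - eapply is_Cseries_ext; [|apply is_Cseries_Cexp].
    intros k; unfold exp_coef; simpl; rewrite Nat.sub_0_r; reflexivity.
  - apply is_Cseries_shift; [reflexivity|].
    eapply is_Cseries_ext; [|exact IH]; intros k; reflexivity.
Qed.

Lemma exp_coef_S (c : C) (k j : nat) :
  (RtoC (INR (S k)) * exp_coef c (S k) (S j)
   = c * exp_coef c k (S j) + RtoC (INR (S j)) * exp_coef c k j)%C.
Proof.
  unfold exp_coef; simpl Nat.leb at 1; simpl Nat.sub at 1 2.
  destruct (Nat.leb_spec j k) as [H|H].
  - destruct (Nat.leb_spec (S j) k) as [H'|H'].
    + replace (k - j)%nat with (S (k - S j)) by lia.
      set (p := (k - S j)%nat).
      replace (S k) with (S p + S j)%nat by (unfold p; lia).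
      rewrite plus_INR, RtoC_plus.
      rewrite (RtoC_inv_fact p), Cpow_S; ring.
    + replace k with j by lia; ring.
  - rewrite (proj2 (Nat.leb_gt (S j) k)) by lia; ring.
Qed.

Lemma exp_coef_S0 (c : C) (k : nat) :
  (RtoC (INR (S k)) * exp_coef c (S k) 0 = c * exp_coef c k 0)%C.
Proof.
  unfold exp_coef; simpl Nat.leb; rewrite !Nat.sub_0_r, Cpow_S.
  rewrite (RtoC_inv_fact k); ring.
Qed.

(** The binomial expansion of [(P + c)^k], cut at [j < d] because [P^d f = 0]; both sides satisfy
    the recursion in [k] expressed by [exp_coef_S]. *)
Lemma iter_lower_shift (kap : nat -> R) (N d : nat) (a : nat -> C) (c : C) (f : occ -> C) (k : nat) :
  Fin N d f ->
  Nat.iter k (fun g n => lower kap N a g n + c * g n)%C f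
  = (fun n => RtoC (INR (fact k)) * Csum (fun j => exp_coef c k j * (RtoC (/ INR (fact j))
        * Nat.iter j (lower kap N a) f n)) d)%C.
Proof.
  intros Hf; set (P := lower kap N a).
  assert (Pd : forall n, Nat.iter d P f n = RtoC 0).
  { intros n; pose proof (Fin_iter kap N d a f d Hf) as H.
    rewrite Nat.sub_diag in H; unfold P; rewrite (Fin_0 N _ H); reflexivity. }
  induction k as [|k IH].
  - apply functional_extensionality; intros n; simpl Nat.iter.
    destruct d as [|d]; [specialize (Pd n); simpl in Pd; rewrite Pd; simpl; ring|].
    rewrite Csum_shift, Csum_zero by (intros; unfold exp_coef; simpl; ring).
    unfold exp_coef; simpl; rewrite Rinv_1; ring.
  - simpl Nat.iter; rewrite IH; apply functional_extensionality; intros n.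
    unfold P at 1; rewrite lower_scal; fold P.
    rewrite (Csum_func P (fun j n => exp_coef c k j * (RtoC (/ INR (fact j)) * Nat.iter j P f n))%C)
      by (intros; first [apply lower_scal | apply lower_plus]).
    cbv beta.
    change (fact (S k)) with (S k * fact k)%nat; rewrite mult_INR, RtoC_mult.
    transitivity (RtoC (INR (fact k)) * (Csum (fun j => exp_coef c k j * (RtoC (/ INR (fact j))
        * Nat.iter (S j) P f n)) d + c * Csum (fun j => exp_coef c k j * (RtoC (/ INR (fact j))
        * Nat.iter j P f n)) d))%C.
    { match goal with |- (?A * ?B + c * (?A * ?D))%C = _ =>
        transitivity (A * (B + c * D))%C; [ring|]; do 2 f_equal end.
      apply Csum_ext; intros j _; unfold P; rewrite !lower_scal; reflexivity. }
    transitivity (RtoC (INR (fact k)) * Csum (fun j => RtoC (INR (S k)) * exp_coef c (S k) j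
        * (RtoC (/ INR (fact j)) * Nat.iter j P f n)) d)%C.
    2:{ rewrite (Csum_ext _ (fun j => RtoC (INR (S k)) * (exp_coef c (S k) j
          * (RtoC (/ INR (fact j)) * Nat.iter j P f n)))%C) by (intros; ring).
        rewrite Csum_scal; ring. }
    f_equal.
    destruct d as [|d]; [simpl; ring|].
    (* The term [j = d] contains [P^(S d) f = 0]; without it the shift of [j] by one matches the two
       sums. *)
    assert (E : Csum (fun j => exp_coef c k j * (RtoC (/ INR (fact j)) * Nat.iter (S j) P f n))%C (S d)
      = Csum (fun j => exp_coef c k j * (RtoC (/ INR (fact j)) * Nat.iter (S j) P f n))%C d).
    { cbn [Csum]; rewrite Pd; ring. }
    rewrite E, !(Csum_shift _ d), exp_coef_S0, Cmult_plus_distr_l, <- Csum_scal.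
    match goal with |- (?A + (?B + ?D))%C = _ => transitivity (B + (A + D))%C; [ring|] end.
    rewrite <- Csum_plus; f_equal; [ring|]; apply Csum_ext; intros j _.
    rewrite exp_coef_S.
    rewrite (RtoC_inv_fact j); ring.
Qed.

(** The scalar [c] makes the exponential series infinite although [lower] is nilpotent; for each [j]
    the coefficient of the [j]-th power is the series of [exp c] shifted by [j] places. *)
Lemma exp_lower_shift (kap : nat -> R) (N d : nat) (a : nat -> C) (c : C) (f : occ -> C) (n : occ) :
  Fin N d f ->
  is_Cseries (fun k => RtoC (/ INR (fact k))
      * Nat.iter k (fun g n => lower kap N a g n + c * g n)%C f n)%C
    (Cexp c * Ep kap N d a f n)%C.
Proof.
  intros Hf.
  eapply is_Cseries_ext; [|unfold Ep, exp_upto; rewrite <- Csum_scal; apply (is_Cseries_Csum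
    (fun k j => exp_coef c k j * (RtoC (/ INR (fact j)) * Nat.iter j (lower kap N a) f n))%C)].
  - intros k; cbv beta; rewrite (iter_lower_shift kap N d) by exact Hf.
    rewrite Cmult_assoc, <- RtoC_mult, Rinv_l by apply INR_fact_neq_0.
    rewrite Cmult_1_l; reflexivity.
  - intros j _; cbv beta; rewrite (Cmult_comm (Cexp c)).
    apply (is_Cseries_ext (fun k => (RtoC (/ INR (fact j)) * Nat.iter j (lower kap N a) f n)
      * exp_coef c k j)%C); [intros k; apply Cmult_comm|].
    apply is_Cseries_scal, exp_coef_series.
Qed.

(** * Vertex operators *)

Lemma IZR_mode (k : nat) : IZR (Zpos (mode k)) = INR (S k).
Proof. unfold mode; rewrite INR_IZR_INZ, Zpos_P_of_succ_nat, Nat2Z.inj_succ; reflexivity. Qed.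

Lemma IZR_neg_mode (k : nat) : IZR (Zneg (mode k)) = - INR (S k).
Proof. rewrite <- IZR_mode, <- opp_IZR; reflexivity. Qed.

(** One treatment for both kinds of modes: [tau] is 1 for [alpha] and [[(r-1)m] / [rm]] for
    [beta]. *)
Definition scaled_modes (kap : nat -> R) (T : Z -> state -> state) (tau : Z -> R) : Prop :=
  forall k v n i j,
    T (Zpos (mode k)) v n i j
      = (RtoC (tau (Zpos (mode k))) * annihilate kap k (fun n => v n i j) n)%C /\
    T (Zneg (mode k)) v n i j
      = (RtoC (tau (Zneg (mode k))) * create k (fun n => v n i j) n)%C.

Definition pos_symbol (q : R) (a : nat -> R) (u : C) (k : nat) : C :=
  (RtoC (a k) * zpow q u (RtoC (- INR (S k))))%C.
Definition neg_symbol (q : R) (b : nat -> R) (u : C) (k : nat) : C :=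
  (RtoC (b k) * zpow q u (RtoC (INR (S k))))%C.

Definition pos_coef (a tau : Z -> R) (k : nat) : R := a (Zpos (mode k)) * tau (Zpos (mode k)).
Definition neg_coef (a tau : Z -> R) (k : nat) : R := a (Zneg (mode k)) * tau (Zneg (mode k)).

Lemma op_exp_neg (q : R) (kap : nat -> R) (T : Z -> state -> state) (tau a : Z -> R) (u : C)
    (v : state) :
  scaled_modes kap T tau ->
  op_exp (mode_sum q Zneg T a u) v
    (fun n i j => Em (neg_symbol q (neg_coef a tau) u) (fun n => v n i j) n).
Proof.
  intros HT; set (b := neg_symbol q (neg_coef a tau) u).
  exists (fun k n i j => Nat.iter k (raise_all b) (fun n => v n i j) n).
  split; [reflexivity|]; split.
  - intros k n i j Hn; simpl Nat.iter; unfold raise_all at 1.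
    set (x := Nat.iter k (raise_all b) (fun n => v n i j)).
    pose proof (lev_spec n Hn) as HL.
    apply (is_Cseries_ext (fun l => b l * create l x n)%C).
    + intros l; cbv zeta; fold (mode l).
      rewrite (proj2 (HT l _ n i j)), IZR_neg_mode, Ropp_involutive.
      change (create l _ n) with (create l x n) at 2.
      unfold b, neg_symbol, neg_coef; rewrite RtoC_mult; ring.
    + apply is_Cseries_finite with (lev n); [|reflexivity].
      intros l Hl; unfold create; rewrite (proj1 HL l Hl); ring.
  - intros n i j Hn; pose proof (lev_spec n Hn) as HL.
    apply is_Cseries_finite with (lev n).
    + intros k Hk; rewrite (iter_raise_all (lev n)), iter_raise_vanish; try assumption;
        [ring | destruct HL; lia].
    + apply Csum_ext; intros k _; rewrite (iter_raise_all (lev n)) by assumption; reflexivity.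
Qed.

Lemma creation_zero (kap : nat -> R) W w n :
  creation kap W w -> W (fun _ => RtoC 0) n = RtoC 0.
Proof.
  intros H; transitivity (RtoC 0 * W (fun _ => RtoC 0) n)%C; [|ring].
  rewrite <- (creation_scal _ _ _ H); f_equal.
  apply functional_extensionality; intros; ring.
Qed.

Lemma creation_Csum (kap : nat -> R) W w (g : nat -> occ -> C) (K : nat) (n : occ) :
  creation kap W w -> W (fun n => Csum (fun k => g k n) K) n = Csum (fun k => W (g k) n) K.
Proof.
  intros H; induction K as [|K IH]; simpl; [apply (creation_zero _ _ _ _ H)|].
  rewrite (creation_plus _ _ _ H), IH; reflexivity.
Qed.

(** On [W x] the annihilation sum acts as [W (Q x)] with [Q = lower + c]: the commutators with [W]
    add up to the scalar [c], a convergent infinite sum, and the rest is finite since [x] occupies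
    only the first [N] modes. *)
Lemma op_exp_pos (q : R) (kap : nat -> R) (T : Z -> state -> state) (tau a : Z -> R) (u : C)
    W w c N d (f : Z -> Z -> occ -> C) :
  scaled_modes kap T tau -> creation kap W w -> (forall i j, Fin N d (f i j)) ->
  let b := pos_symbol q (pos_coef a tau) u in
  is_Cseries (fun k => b k * RtoC (kap k) * w k)%C c ->
  op_exp (mode_sum q Zpos T a u) (fun n i j => W (f i j) n)
    (fun n i j => Cexp c * W (Ep kap N d b (f i j)) n)%C.
Proof.
  intros HT HW Hf b Hc.
  set (Q := fun g n => (lower kap N b g n + c * g n)%C).
  assert (HQ : forall k i j, Fin N d (Nat.iter k Q (f i j))).
  { intros k i j; induction k as [|k IH]; [apply Hf|].
    intros n Hn; simpl in Hn; unfold Q at 1 in Hn.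
    destruct (excluded_middle_informative
      (lower kap N b (Nat.iter k Q (f i j)) n = RtoC 0)) as [E|E].
    - rewrite E, Cplus_0_l in Hn; apply Cmult_neq_0_inv in Hn; apply IH, Hn.
    - apply (Fin_mono N (pred d) d) with (f := lower kap N b (Nat.iter k Q (f i j)));
        [lia | apply Fin_lower, IH | exact E]. }
  exists (fun k n i j => W (Nat.iter k Q (f i j)) n).
  split; [reflexivity|]; split.
  - intros k n i j Hn; simpl Nat.iter.
    set (x := Nat.iter k Q (f i j)).
    assert (Hx : Fin N d x) by apply HQ.
    assert (EQ : W (Q x) n = (W (lower kap N b x) n + c * W x n)%C).
    { unfold Q; rewrite (creation_plus _ _ _ HW (lower kap N b x) (fun n => c * x n)%C).
      rewrite (creation_scal _ _ _ HW); reflexivity. }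
    change (is_Cseries (fun l => RtoC (a (Zpos (mode l))) * zpow q u (RtoC (- IZR (Zpos (mode l))))
      * T (Zpos (mode l)) (fun n i j => W (Nat.iter k Q (f i j)) n) n i j)%C (W (Q x) n)).
    rewrite EQ.
    apply (is_Cseries_ext (fun l => b l * W (annihilate kap l x) n
      + W x n * (b l * RtoC (kap l) * w l))%C).
    + intros l; rewrite (proj1 (HT l _ n i j)), IZR_mode; fold x.
      change (fun n0 => W x n0) with (W x).
      rewrite (creation_annihilate _ _ _ HW) by exact Hn.
      unfold b, pos_symbol, pos_coef; rewrite RtoC_mult; ring.
    + apply is_Cseries_plus; [|rewrite (Cmult_comm c); apply is_Cseries_scal, Hc].
      apply is_Cseries_finite with N.
      * intros l Hl; rewrite (creation_local _ _ _ HW (annihilate kap l x) (fun _ => RtoC 0)).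
        -- rewrite (creation_zero _ _ _ _ HW); ring.
        -- intros m _; destruct (excluded_middle_informative (annihilate kap l x m = RtoC 0))
             as [E|E]; [exact E|].
           apply (Fin_annihilate kap N d l x Hx) in E; lia.
        -- exact Hn.
      * unfold lower; rewrite (creation_Csum _ _ _ (fun k n => b k * annihilate kap k x n)%C _ _ HW).
        apply Csum_ext; intros l _; symmetry; apply (creation_scal _ _ _ HW).
  - intros n i j Hn.
    rewrite <- (creation_scal _ _ _ HW (Cexp c) (Ep kap N d b (f i j))).
    apply (is_Cseries_ext (fun k => W (fun n => RtoC (/ INR (fact k)) * Nat.iter k Q (f i j) n)%C n)).
    + intros k; apply (creation_scal _ _ _ HW).
    + apply (creation_series _ _ _ HW
        (fun k n => RtoC (/ INR (fact k)) * Nat.iter k Q (f i j) n)%C); [|exact Hn].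
      intros m _; apply exp_lower_shift, Hf.
Qed.

(* [A] is the ordered product of [exp (sum_m b_m alpha_(-m))],
   [exp (sum_m a_m alpha_m)] and a zero mode part; moving the second factor past
   the creation operator [W] costs [exp c] with [c = sum_m a_m kappa_m w_m]. *)
Definition vertex_op (kap : nat -> R) (A : op) (a b : nat -> C) (zeta : Z -> Z -> C) (s t : Z) : Prop :=
  forall W w c N d (f : Z -> Z -> occ -> C),
    creation kap W w -> is_Cseries (fun k => a k * RtoC (kap k) * w k)%C c ->
    (forall i j, Fin N d (f i j)) ->
    A (fun n i j => W (f i j) n)
      (fun n i j => Cexp c * zeta i j
         * Em b (W (Ep kap N d a (f (i - s)%Z (j - t)%Z))) n)%C.

(** * Zero mode factors *)

Definition zero_mode_op (A : op) (zeta : Z -> Z -> C) (s t : Z) : Prop :=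
  forall v, A v (fun n i j => zeta i j * v n (i - s)%Z (j - t)%Z)%C.

Lemma state_ext (v w : state) : (forall n i j, v n i j = w n i j) -> v = w.
Proof.
  intros H; apply functional_extensionality; intros n; apply functional_extensionality; intros i.
  apply functional_extensionality; intros j; apply H.
Qed.

Lemma op_eq (A : op) (v v' w w' : state) :
  A v w -> (forall n i j, v n i j = v' n i j) -> (forall n i j, w n i j = w' n i j) -> A v' w'.
Proof. intros H Hv Hw; rewrite <- (state_ext _ _ Hv), <- (state_ext _ _ Hw); exact H. Qed.

Lemma zero_mode_op_comp (A B : op) (zA zB : Z -> Z -> C) (sA tA sB tB : Z) :
  zero_mode_op A zA sA tA -> zero_mode_op B zB sB tB ->
  zero_mode_op (A ∘ B) (fun i j => zA i j * zB (i - sA)%Z (j - tA)%Z)%C (sA + sB) (tA + tB).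
Proof.
  intros HA HB v.
  exists (fun n i j => zB i j * v n (i - sB)%Z (j - tB)%Z)%C; split; [apply HB|].
  eapply op_eq; [apply HA | reflexivity|].
  intros n i j; cbv beta.
  replace (i - sA - sB)%Z with (i - (sA + sB))%Z by lia.
  replace (j - tA - tB)%Z with (j - (tA + tB))%Z by lia; ring.
Qed.

Lemma zero_mode_hP (h0 P0 : C) (f : C -> C -> C) :
  zero_mode_op (lift (hP_fun h0 P0 f))
    (fun i j => f (h0 + RtoC (2 * IZR i))%C (P0 + RtoC (IZR j))%C) 0 0.
Proof.
  intros v; unfold lift; apply state_ext; intros n i j; rewrite !Z.sub_0_r; reflexivity.
Qed.

Lemma zero_mode_exp_alphahat (k : Z) : zero_mode_op (lift (exp_alphahat k)) (fun _ _ => RtoC 1) k 0.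
Proof.
  intros v; unfold lift, exp_alphahat; apply state_ext; intros n i j; rewrite Z.sub_0_r; ring.
Qed.

Lemma zero_mode_exp_Q (k : Z) :
  zero_mode_op (lift (exp_Q k)) (fun i _ => RtoC (if Z.even (k * i) then 1 else -1)) 0 k.
Proof.
  intros v; unfold lift, exp_Q; apply state_ext; intros n i j; rewrite Z.sub_0_r; reflexivity.
Qed.

Lemma vertex_op_zero_mode_r (kap : nat -> R) (A B : op) a b (zA zB : Z -> Z -> C) sA tA sB tB :
  vertex_op kap A a b zA sA tA -> zero_mode_op B zB sB tB ->
  vertex_op kap (A ∘ B) a b (fun i j => zA i j * zB (i - sA)%Z (j - tA)%Z)%C (sA + sB) (tA + tB).
Proof.
  intros HA HB W w c N d f HW Hc Hf.
  set (g := fun i j n => (zB i j * f (i - sB)%Z (j - tB)%Z n)%C).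
  exists (fun n i j => W (g i j) n); split.
  - eapply op_eq; [apply (HB (fun n i j => W (f i j) n)) | reflexivity|].
    intros n i j; unfold g; rewrite (creation_scal _ _ _ HW); reflexivity.
  - eapply op_eq; [apply (HA W w c N d g HW Hc) | reflexivity|].
    + intros i j; apply Fin_scal, Hf.
    + intros n i j; unfold g; cbv beta; rewrite Ep_scal.
      replace (W (fun n0 => zB (i - sA)%Z (j - tA)%Z
          * Ep kap N d a (f (i - sA - sB)%Z (j - tA - tB)%Z) n0)%C)
        with (fun n0 => zB (i - sA)%Z (j - tA)%Z
          * W (Ep kap N d a (f (i - sA - sB)%Z (j - tA - tB)%Z)) n0)%C
        by (apply functional_extensionality; intros; rewrite (creation_scal _ _ _ HW); reflexivity).
      rewrite Em_scal.
      replace (i - sA - sB)%Z with (i - (sA + sB))%Z by lia.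
      replace (j - tA - tB)%Z with (j - (tA + tB))%Z by lia; ring.
Qed.

Lemma vertex_op_zero_mode_l (kap : nat -> R) (A B : op) a b (zA zB : Z -> Z -> C) sA tA sB tB :
  zero_mode_op B zB sB tB -> vertex_op kap A a b zA sA tA ->
  vertex_op kap (B ∘ A) a b (fun i j => zB i j * zA (i - sB)%Z (j - tB)%Z)%C (sB + sA) (tB + tA).
Proof.
  intros HB HA W w c N d f HW Hc Hf.
  eexists; split; [apply (HA W w c N d f HW Hc Hf)|].
  eapply op_eq; [apply HB | reflexivity|].
  intros n i j; cbv beta.
  replace (i - sB - sA)%Z with (i - (sB + sA))%Z by lia.
  replace (j - tB - tA)%Z with (j - (tB + tA))%Z by lia; ring.
Qed.

Lemma vertex_op_scale (kap : nat -> R) (A : op) a b zeta s t (e : C) :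
  vertex_op kap A a b zeta s t -> vertex_op kap (scale e A) a b (fun i j => e * zeta i j)%C s t.
Proof.
  intros HA W w c N d f HW Hc Hf.
  eexists; split; [apply (HA W w c N d f HW Hc Hf)|].
  apply state_ext; intros n i j; ring.
Qed.

Lemma vertex_op_eq (kap : nat -> R) (A : op) a b (zeta zeta' : Z -> Z -> C) s t s' t' :
  vertex_op kap A a b zeta s t -> (forall i j, zeta i j = zeta' i j) -> s = s' -> t = t' ->
  vertex_op kap A a b zeta' s' t'.
Proof.
  intros HA E <- <- W w c N d f HW Hc Hf.
  eapply op_eq; [apply (HA W w c N d f HW Hc Hf) | reflexivity|].
  intros n i j; cbv beta; rewrite E; reflexivity.
Qed.

Lemma vertex_op_normal_exp (q : R) (kap : nat -> R) (T : Z -> state -> state) (tau a : Z -> R) (u : C) :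
  scaled_modes kap T tau ->
  vertex_op kap (normal_exp q T a u)
    (pos_symbol q (pos_coef a tau) u) (neg_symbol q (neg_coef a tau) u) (fun _ _ => RtoC 1) 0 0.
Proof.
  intros HT W w c N d f HW Hc Hf.
  eexists; split; [apply (op_exp_pos q kap T tau a u W w c N d f HT HW Hf Hc)|].
  eapply op_eq; [apply (op_exp_neg q kap T tau a u _ HT) | reflexivity|].
  intros n i j; cbv beta; rewrite Em_scal, !Z.sub_0_r.
  change (fun n0 => W (Ep kap N d (pos_symbol q (pos_coef a tau) u) (f i j)) n0)
    with (W (Ep kap N d (pos_symbol q (pos_coef a tau) u) (f i j))); ring.
Qed.

(** The creation half acts first and joins [W], so the annihilation half contracts with both: the
    exponent is [cc + c], and the self-contraction [cc] goes into the scalar. *)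
Lemma vertex_op_anti_normal_exp (q : R) (kap : nat -> R) (T : Z -> state -> state) (tau a : Z -> R)
    (u cc : C) :
  scaled_modes kap T tau ->
  let ap := pos_symbol q (pos_coef a tau) u in
  let an := neg_symbol q (neg_coef a tau) u in
  is_Cseries (fun k => ap k * RtoC (kap k) * an k)%C cc ->
  vertex_op kap (op_exp (mode_sum q Zpos T a u) ∘ op_exp (mode_sum q Zneg T a u))
    ap an (fun _ _ => Cexp cc) 0 0.
Proof.
  intros HT ap an Hcc W w c N d f HW Hc Hf.
  eexists; split; [apply (op_exp_neg q kap T tau a u _ HT)|].
  eapply op_eq; [apply (op_exp_pos q kap T tau a u (fun f => Em an (W f)) _ (cc + c)%C N d f HT
    (creation_Em kap an W w HW) Hf) | reflexivity|].
  - eapply is_Cseries_ext; [|exact (is_Cseries_plus _ _ _ _ Hcc Hc)].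
    intros k; cbv beta; fold ap; ring.
  - intros n i j; cbv beta; rewrite Cexp_add, !Z.sub_0_r; fold ap; ring.
Qed.

Lemma scaled_modes_alpha (q r : R) :
  scaled_modes (fun k => kappa q r (Zpos (mode k))) (alpha q r) (fun _ => 1).
Proof.
  intros k v n i j; unfold alpha, annihilate, create; split.
  - ring.
  - destruct (n (mode k)); ring.
Qed.

Lemma scaled_modes_beta (q r : R) :
  scaled_modes (fun k => kappa q r (Zpos (mode k))) (beta q r)
    (fun m => qnum q ((r - 1) * IZR m) / qnum q (r * IZR m)).
Proof.
  intros k v n i j; unfold beta, alpha, annihilate, create; split; [reflexivity|].
  destruct (n (mode k)); ring.
Qed.

(** * Exchange relations of vertex operators *)

Lemma entire_ext (f g : C -> C) : (forall u, f u = g u) -> entire f -> entire g.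
Proof. intros E H; replace g with f; [exact H | apply functional_extensionality, E]. Qed.

Lemma entire_const (c : C) : entire (fun _ => c).
Proof. intros u; exists (RtoC 0); apply Cder_const. Qed.

Lemma entire_id : entire (fun u => u).
Proof. intros u; exists (RtoC 1); apply Cder_id. Qed.

Lemma entire_plus (f g : C -> C) : entire f -> entire g -> entire (fun u => f u + g u)%C.
Proof.
  intros Hf Hg u; destruct (Hf u) as [l Hl], (Hg u) as [m Hm].
  exists (l + m)%C; apply Cder_plus; assumption.
Qed.

Lemma entire_mult (f g : C -> C) : entire f -> entire g -> entire (fun u => f u * g u)%C.
Proof.
  intros Hf Hg u; destruct (Hf u) as [l Hl], (Hg u) as [m Hm].
  eexists; apply Cder_mult; eassumption.
Qed.

Lemma entire_comp (f g : C -> C) : entire f -> entire g -> entire (fun u => f (g u)).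
Proof.
  intros Hf Hg u; destruct (Hg u) as [m Hm], (Hf (g u)) as [l Hl].
  eexists; apply Cder_comp; eassumption.
Qed.

Lemma entire_opp (f : C -> C) : entire f -> entire (fun u => - f u)%C.
Proof.
  intros H; apply (entire_ext (fun u => RtoC (-1) * f u)%C); [intros; ring|].
  apply entire_mult; [apply entire_const | exact H].
Qed.

Lemma entire_minus (f g : C -> C) : entire f -> entire g -> entire (fun u => f u - g u)%C.
Proof. intros Hf Hg; apply entire_plus; [|apply entire_opp]; assumption. Qed.

Lemma entire_Cexp : entire Cexp.
Proof. intros u; exists (Cexp u); apply Cder_Cexp. Qed.

Lemma entire_qpow (q : R) (f : C -> C) : entire f -> entire (fun u => qpow q (f u)).
Proof.
  intros H; apply (entire_comp Cexp); [apply entire_Cexp|].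
  apply entire_mult; [exact H | apply entire_const].
Qed.

Lemma entire_zpow (q : R) (f g : C -> C) :
  entire f -> entire g -> entire (fun u => zpow q (f u) (g u)).
Proof.
  intros Hf Hg; apply entire_qpow, (entire_mult (fun u => RtoC 2 * f u)%C g); [|exact Hg].
  apply (entire_mult (fun _ => RtoC 2) f); [apply entire_const | exact Hf].
Qed.

Lemma entire_Csum (f : C -> nat -> C) (N : nat) :
  (forall k, entire (fun u => f u k)) -> entire (fun u => Csum (f u) N).
Proof.
  intros H; induction N as [|N IH]; simpl; [apply entire_const|].
  apply entire_plus; [exact IH | apply H].
Qed.

Lemma unit_entire_entire (f : C -> C) : unit_entire f -> entire f.
Proof. intros H u; exact (unit_entire_Cder f u H). Qed.

Ltac entire_tac :=
  repeat match goal with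
    | H : entire ?f |- entire ?f => exact H
    | |- entire (fun _ => ?c) => exact (entire_const c)
    | |- entire (fun u => u) => exact entire_id
    | |- entire (fun u => @?f u + @?g u)%C => apply (entire_plus f g)
    | |- entire (fun u => @?f u - @?g u)%C => apply (entire_minus f g)
    | |- entire (fun u => - @?f u)%C => apply (entire_opp f)
    | |- entire (fun u => @?f u * @?g u)%C => apply (entire_mult f g)
    | |- entire (fun u => zpow ?q (@?f u) (@?g u)) => apply (entire_zpow q f g)
    | |- entire (fun u => qpow ?q (@?f u)) => apply (entire_qpow q f)
    end.

Lemma qpow_add (q : R) (a b : C) : qpow q (a + b)%C = (qpow q a * qpow q b)%C.
Proof. unfold qpow; rewrite <- Cexp_add; f_equal; ring. Qed.

Lemma qpow_0 (q : R) : qpow q (RtoC 0) = RtoC 1.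
Proof. unfold qpow; rewrite Cmult_0_l; apply Cexp_0. Qed.

Lemma qpow_neq_0 (q : R) (a : C) : qpow q a <> RtoC 0.
Proof. apply Cexp_neq_0. Qed.

Lemma qpow_opp (q : R) (a : C) : qpow q (- a)%C = (/ qpow q a)%C.
Proof. unfold qpow; rewrite <- Cexp_opp; f_equal; ring. Qed.

Lemma qpow_pow (q : R) (a : C) (n : nat) : (qpow q a ^ n)%C = qpow q (RtoC (INR n) * a)%C.
Proof.
  induction n as [|n IH].
  - simpl; rewrite Cmult_0_l, qpow_0; reflexivity.
  - rewrite Cpow_S, IH, <- qpow_add, S_INR, RtoC_plus; f_equal; ring.
Qed.

Lemma Cmod_qpow (q : R) (a : C) : Cmod (qpow q a) = exp (Re a * ln q).
Proof.
  unfold qpow; rewrite Cmod_Cexp; f_equal; unfold Re; simpl; ring.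
Qed.

Lemma entire_create (f : C -> occ -> C) (k : nat) :
  (forall n, finite_occ n -> entire (fun u => f u n)) ->
  forall n, finite_occ n -> entire (fun u => create k (f u) n).
Proof.
  intros H n Hn; unfold create; destruct (n (mode k)).
  - apply entire_const.
  - apply H, finite_decr, Hn.
Qed.

(** At a fixed occupation this is a polynomial in finitely many symbols and coefficients. *)
Lemma entire_Em (b : C -> nat -> C) (f : C -> occ -> C) :
  (forall k, entire (fun u => b u k)) ->
  (forall n, finite_occ n -> entire (fun u => f u n)) ->
  forall n, finite_occ n -> entire (fun u => Em (b u) (f u) n).
Proof.
  intros Hb Hf n Hn.
  apply (entire_Csum (fun u k => RtoC (/ INR (fact k))
    * Nat.iter k (raise (lev n) (b u)) (f u) n)%C); intros k.
  apply entire_mult; [apply entire_const|].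
  generalize (lev n) as L; intros L; revert n Hn; induction k as [|k IH]; intros n Hn.
  - apply Hf, Hn.
  - simpl; apply (entire_Csum (fun u l => b u l * create l (Nat.iter k (raise L (b u)) (f u)) n)%C).
    intros l; apply entire_mult; [apply Hb|].
    apply (entire_create (fun u => Nat.iter k (raise L (b u)) (f u))); assumption.
Qed.

Lemma entire_Ep (kap : nat -> R) (N d : nat) (a : C -> nat -> C) (f : C -> occ -> C) :
  (forall k, entire (fun u => a u k)) ->
  (forall n, finite_occ n -> entire (fun u => f u n)) ->
  forall n, finite_occ n -> entire (fun u => Ep kap N d (a u) (f u) n).
Proof.
  intros Ha Hf n Hn.
  apply (entire_Csum (fun u k => RtoC (/ INR (fact k))
    * Nat.iter k (lower kap N (a u)) (f u) n)%C); intros k.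
  apply entire_mult; [apply entire_const|].
  revert n Hn; induction k as [|k IH]; intros n Hn.
  - apply Hf, Hn.
  - simpl; apply (entire_Csum (fun u l => a u l
      * annihilate kap l (Nat.iter k (lower kap N (a u)) (f u)) n)%C).
    intros l; apply entire_mult; [apply Ha|].
    apply entire_mult; [apply entire_const | apply IH, finite_incr, Hn].
Qed.

(** * Commuting exponentials and the normally ordered product *)

Lemma exp_upto_comm (K : nat) (A B : (occ -> C) -> occ -> C) (f : occ -> C) :
  (forall c f, A (fun n => c * f n)%C = (fun n => c * A f n)%C) ->
  (forall f g, A (fun n => f n + g n)%C = (fun n => A f n + A g n)%C) ->
  (forall c f, B (fun n => c * f n)%C = (fun n => c * B f n)%C) ->
  (forall f g, B (fun n => f n + g n)%C = (fun n => B f n + B g n)%C) ->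
  (forall f, A (B f) = B (A f)) ->
  exp_upto K A (exp_upto K B f) = exp_upto K B (exp_upto K A f).
Proof.
  intros As Ap Bs Bp AB.
  assert (expand : forall A B : (occ -> C) -> occ -> C,
    (forall c f, A (fun n => c * f n)%C = (fun n => c * A f n)%C) ->
    (forall f g, A (fun n => f n + g n)%C = (fun n => A f n + A g n)%C) ->
    forall n, exp_upto K A (exp_upto K B f) n
    = Csum (fun k => Csum (fun l => RtoC (/ INR (fact k)) * RtoC (/ INR (fact l))
        * Nat.iter k A (Nat.iter l B f) n)%C K) K).
  { clear; intros A B As Ap n; apply Csum_ext; intros k _.
    rewrite (Csum_ext _ (fun l => RtoC (/ INR (fact k)) * (RtoC (/ INR (fact l))
      * Nat.iter k A (Nat.iter l B f) n))%C) by (intros; ring).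
    rewrite Csum_scal; f_equal.
    unfold exp_upto.
    rewrite (Csum_func (fun g => Nat.iter k A g)
      (fun l n => RtoC (/ INR (fact l)) * Nat.iter l B f n)%C);
      [|intros; apply iter_scal, As | intros; apply iter_plus, Ap].
    apply Csum_ext; intros l _.
    rewrite (iter_scal A) by apply As; reflexivity. }
  assert (comm : forall k l, Nat.iter k A (Nat.iter l B f) = Nat.iter l B (Nat.iter k A f)).
  { assert (c1 : forall l g, A (Nat.iter l B g) = Nat.iter l B (A g)).
    { induction l as [|l IH]; intros g; [reflexivity|]; simpl; rewrite AB, IH; reflexivity. }
    induction k as [|k IH]; intros l; [reflexivity|]; simpl; rewrite IH, c1; reflexivity. }
  apply functional_extensionality; intros n.
  rewrite (expand A B As Ap), (expand B A Bs Bp), Csum_swap.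
  apply Csum_ext; intros k _; apply Csum_ext; intros l _; rewrite comm; ring.
Qed.

Lemma Lev_finite (L : nat) (n : occ) : Lev L n -> finite_occ n.
Proof.
  intros [H _]; exists (mode L); intros m Hm; rewrite <- (mode_surj m); apply H.
  unfold mode in *; lia.
Qed.

Lemma raise_comm (L : nat) (a b : nat -> C) (f : occ -> C) :
  raise L a (raise L b f) = raise L b (raise L a f).
Proof.
  assert (E : forall a b : nat -> C, forall n, raise L a (raise L b f) n
    = Csum (fun k => Csum (fun l => a k * b l * create k (create l f) n)%C L) L).
  { clear; intros a b n; apply Csum_ext; intros k _.
    rewrite (Csum_ext _ (fun l => a k * (b l * create k (create l f) n))%C) by (intros; ring).
    rewrite Csum_scal; f_equal; unfold create at 1.
    destruct (n (mode k)) eqn:Hn.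
    - symmetry; apply Csum_zero; intros l _; unfold create; rewrite Hn; ring.
    - apply Csum_ext; intros l _; unfold create at 2; rewrite Hn; reflexivity. }
  apply functional_extensionality; intros n; rewrite !E, Csum_swap.
  apply Csum_ext; intros k _; apply Csum_ext; intros l _; rewrite create_comm; ring.
Qed.

Lemma Em_comm (a b : nat -> C) (f : occ -> C) (n : occ) :
  finite_occ n -> Em a (Em b f) n = Em b (Em a f) n.
Proof.
  intros Hn; destruct (Lev_exists n Hn) as [L HL].
  (* The inner [Em] truncates at a level depending on where it is evaluated; all these occupations
     have level [L], so one common truncation may be used. *)
  assert (E : forall a b, Em a (Em b f) n
    = exp_upto L (raise L a) (exp_upto L (raise L b) f) n).
  { intros a' b'; rewrite (Em_Lev L) by assumption; apply Csum_ext; intros k _; f_equal.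
    revert n HL Hn; induction k as [|k IH]; intros n HL Hn.
    - apply Em_Lev; assumption.
    - simpl; apply raise_local; [exact HL|].
      intros m Hm; apply IH; [exact Hm | apply (Lev_finite L), Hm]. }
  rewrite !E, (exp_upto_comm L (raise L a) (raise L b)); [reflexivity | ..];
    intros; first [apply raise_scal | apply raise_plus | apply raise_comm].
Qed.

Lemma lower_comm (kap : nat -> R) (N : nat) (a b : nat -> C) (f : occ -> C) :
  lower kap N a (lower kap N b f) = lower kap N b (lower kap N a f).
Proof.
  assert (E : forall a b : nat -> C, forall n, lower kap N a (lower kap N b f) n
    = Csum (fun k => Csum (fun l => a k * b l * annihilate kap k (annihilate kap l f) n)%C N) N).
  { clear; intros a b n; apply Csum_ext; intros k _.
    rewrite (Csum_ext _ (fun l => a k * (b l * annihilate kap k (annihilate kap l f) n))%C)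
      by (intros; ring).
    rewrite Csum_scal; f_equal; unfold annihilate at 1, lower; rewrite <- Csum_scal.
    apply Csum_ext; intros l _; unfold annihilate; ring. }
  apply functional_extensionality; intros n; rewrite !E, Csum_swap.
  apply Csum_ext; intros k _; apply Csum_ext; intros l _; rewrite annihilate_comm; ring.
Qed.

Lemma Ep_comm (kap : nat -> R) (N d : nat) (a b : nat -> C) (f : occ -> C) :
  Ep kap N d a (Ep kap N d b f) = Ep kap N d b (Ep kap N d a f).
Proof.
  apply exp_upto_comm; intros; first [apply lower_scal | apply lower_plus | apply lower_comm].
Qed.

Lemma finite_vector_Fin (v : state) :
  finite_vector v -> exists N d, forall i j, Fin N d (fun n => v n i j).
Proof.
  (* At most [N] modes are occupied, each at most [N] times. *)
  intros [N0 H]; set (N := Pos.to_nat N0); exists N, (S (N * N)); intros i j n Hn.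
  destruct (H n i j Hn) as [H1 [H2 _]]; split.
  - intros k Hk; apply H2; unfold mode, N in *; lia.
  - assert (G : forall L, (nsum L n <= L * N)%nat).
    { induction L as [|L IH]; simpl; [lia|]; specialize (H1 (mode L)); fold N in H1; lia. }
    specialize (G N); lia.
Qed.

Definition normal_product (kap : nat -> R) (N d : nat) (aX bX aY bY : nat -> C) (f : occ -> C) : occ -> C :=
  Em bX (Em bY (Ep kap N d aX (Ep kap N d aY f))).

(** [Y] meets no creation operator ([W] is the identity, contraction 0), while [X] meets the
    creation exponential of [Y]; this is the only source of [Cexp c]. *)
Lemma vertex_op_comp (kap : nat -> R) (X Y : op) aX bX aY bY zX zY sX tX sY tY (c : C) N d (v : state) :
  vertex_op kap X aX bX zX sX tX -> vertex_op kap Y aY bY zY sY tY ->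
  is_Cseries (fun k => aX k * RtoC (kap k) * bY k)%C c ->
  (forall i j, Fin N d (fun n => v n i j)) ->
  (X ∘ Y) v (fun n i j => Cexp c * (zX i j * zY (i - sX)%Z (j - tX)%Z)
    * normal_product kap N d aX bX aY bY (fun n => v n (i - (sX + sY))%Z (j - (tX + tY))%Z) n)%C.
Proof.
  intros HX HY Hc Hv.
  set (g := fun i j n => (zY i j * Ep kap N d aY (fun n => v n (i - sY)%Z (j - tY)%Z) n)%C).
  exists (fun n i j => Em bY (g i j) n); split.
  - eapply op_eq; [apply (HY (fun f => f) (fun _ => RtoC 0) (RtoC 0) N d (fun i j n => v n i j)
      (creation_id kap)) | reflexivity |].
    + apply is_Cseries_finite with O; [intros; ring | reflexivity].
    + exact Hv.
    + intros n i j; cbv beta; unfold g; rewrite Cexp_0, Em_scal.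
      change (fun n0 => Ep kap N d aY (fun n1 => v n1 (i - sY)%Z (j - tY)%Z) n0)
        with (Ep kap N d aY (fun n1 => v n1 (i - sY)%Z (j - tY)%Z)); ring.
  - eapply op_eq; [apply (HX _ _ c N d g (creation_Em kap bY _ _ (creation_id kap)))
      | reflexivity |].
    + eapply is_Cseries_ext; [|exact Hc]; intros k; cbv beta; ring.
    + intros i j; apply Fin_scal, Fin_Ep, Hv.
    + intros n i j; cbv beta; unfold g, normal_product; rewrite Ep_scal.
      replace (Em bY (fun n0 => zY (i - sX)%Z (j - tX)%Z * Ep kap N d aX
          (Ep kap N d aY (fun n1 => v n1 (i - sX - sY)%Z (j - tX - tY)%Z)) n0)%C)
        with (fun n0 => zY (i - sX)%Z (j - tX)%Z * Em bY (Ep kap N d aX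
          (Ep kap N d aY (fun n1 => v n1 (i - sX - sY)%Z (j - tX - tY)%Z))) n0)%C
        by (apply functional_extensionality; intros; rewrite <- Em_scal; reflexivity).
      rewrite Em_scal.
      replace (i - sX - sY)%Z with (i - (sX + sY))%Z by lia.
      replace (j - tX - tY)%Z with (j - (tX + tY))%Z by lia; ring.
Qed.

Lemma normal_product_comm (kap : nat -> R) (N d : nat) (aX bX aY bY : nat -> C) (f : occ -> C) (n : occ) :
  finite_occ n ->
  normal_product kap N d aX bX aY bY f n = normal_product kap N d aY bY aX bX f n.
Proof. intros Hn; unfold normal_product; rewrite Em_comm, Ep_comm by exact Hn; reflexivity. Qed.

(** Index [k] stands for mode [k + 1], so the series is that of [lg alpha] without its vanishing
    constant term; the two powers of the spectral parameters combine into [x^(k+1)]. *)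
Lemma contraction_series (q : R) (kap a b alpha : nat -> R) (F : C -> C) (rho : R) (u v : C) :
  (forall k, a k * kap k * b k = alpha (S k) / INR (S k)) ->
  conv_on (lg alpha) rho ->
  let x := qpow q (RtoC 2 * (v - u))%C in
  Cmod x < rho -> Cexp (Cps (lg alpha) x) = F x ->
  exists c, is_Cseries (fun k => pos_symbol q a u k * RtoC (kap k) * neg_symbol q b v k)%C c
    /\ Cexp c = F x.
Proof.
  intros E Hc x Hx HF; exists (Cps (lg alpha) x); split; [|exact HF].
  eapply is_Cseries_ext;
    [|exact (is_Cseries_unshift (fun k => lg alpha k * x ^ k)%C _
        ltac:(cbv beta; rewrite lg_0; ring) (is_Cseries_Cps _ rho x Hc Hx))].
  intros k; cbv beta; unfold lg; rewrite <- E, !RtoC_mult.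
  unfold x; rewrite qpow_pow; unfold pos_symbol, neg_symbol, zpow.
  replace (RtoC (INR (S k)) * (RtoC 2 * (v - u)))%C
    with (RtoC 2 * u * RtoC (- INR (S k)) + RtoC 2 * v * RtoC (INR (S k)))%C
    by (rewrite RtoC_opp; ring).
  rewrite qpow_add; ring.
Qed.

Lemma nonzero_entire_shift (d : C -> C) (c : C) :
  nonzero_entire d -> nonzero_entire (fun u => d (u - c)%C).
Proof.
  intros [H [u Hu]]; split.
  - apply (entire_comp d); [exact H | entire_tac].
  - exists (u + c)%C; replace (u + c - c)%C with u by ring; exact Hu.
Qed.

Lemma meromorphic_quotient (A B H F : C -> C) (c : C) :
  entire A -> nonzero_entire B -> (forall t, B t <> RtoC 0 -> F t = (A t / B t)%C) -> entire H ->
  meromorphic (fun u => F (u - c) * H u)%C.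
Proof.
  intros HA HB E HH; exists (fun u => A (u - c) * H u)%C, (fun u => B (u - c)%C).
  split; [apply entire_mult; [apply (entire_comp A); [exact HA | entire_tac] | exact HH]|].
  split; [apply nonzero_entire_shift, HB|].
  intros u Hu; rewrite E by exact Hu; field; exact Hu.
Qed.

Lemma small_qpow (q rho d : R) (t : C) :
  0 < q < 1 -> 0 < rho ->
  Re t > Rabs d + Rabs (ln rho) / (- 2 * ln q) ->
  Cmod (qpow q (RtoC 2 * (t + RtoC d))%C) < rho.
Proof.
  intros Hq Hr Ht.
  assert (Hl : ln q < 0) by (rewrite <- ln_1; apply ln_increasing; lra).
  rewrite Cmod_qpow; rewrite <- (exp_ln rho Hr); apply exp_increasing.
  replace (Re (RtoC 2 * (t + RtoC d))%C) with (2 * (Re t + d)) by (unfold Re; simpl; ring).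
  set (L := - 2 * ln q) in *.
  assert (HL : 0 < L) by (unfold L; lra).
  assert (B : Rabs (ln rho) < L * (Re t + d)).
  { assert (Rabs (ln rho) / L < Re t + d) by (pose proof (Rle_abs (- d)); rewrite Rabs_Ropp in *; lra).
    apply Rmult_lt_compat_l with (r := L) in H; [|exact HL].
    replace (L * (Rabs (ln rho) / L)) with (Rabs (ln rho)) in H by (field; lra); exact H. }
  pose proof (Rle_abs (- ln rho)) as P; rewrite Rabs_Ropp in P.
  unfold L in B; nra.
Qed.

(* Both products are scalar multiples of the same normal ordered product. *)
Lemma exchange_vertex (q : R) (kap : nat -> R) (X Y : C -> op) (aX bX aY bY : nat -> R)
    (zX zY : C -> Z -> Z -> C) (sX tX sY tY : Z) (dX dY : R)
    (al : nat -> R) (F A12 B12 A21 B21 Zr D f g : C -> C) :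
  0 < q < 1 ->
  (forall u, vertex_op kap (X u) (pos_symbol q aX (u + RtoC dX)%C) (neg_symbol q bX (u + RtoC dX)%C)
     (zX u) sX tX) ->
  (forall u, vertex_op kap (Y u) (pos_symbol q aY (u + RtoC dY)%C) (neg_symbol q bY (u + RtoC dY)%C)
     (zY u) sY tY) ->
  (forall i j, entire (fun u => zX u i j)) ->
  (forall k, aX k * kap k * bY k = al (S k) / INR (S k)) ->
  (forall k, aY k * kap k * bX k = al (S k) / INR (S k)) -> exp_series al F ->
  let x := fun t => qpow q (RtoC 2 * (- t + RtoC (dY - dX)))%C in
  let y := fun t => qpow q (RtoC 2 * (t + RtoC (dX - dY)))%C in
  entire A12 -> nonzero_entire B12 -> (forall t, B12 t <> RtoC 0 -> F (x t) = A12 t / B12 t)%C ->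
  entire A21 -> nonzero_entire B21 -> (forall t, B21 t <> RtoC 0 -> F (y t) = A21 t / B21 t)%C ->
  (forall u1 u2 i j, zX u1 i j * zY u2 (i - sX)%Z (j - tX)%Z
     = Zr (u1 - u2) * (zY u2 i j * zX u1 (i - sY)%Z (j - tY)%Z))%C ->
  nonzero_entire D ->
  (forall t, D t <> RtoC 0 -> f t * Zr t * F (x t) = g t * F (y t))%C ->
  exchange f X Y g.
Proof.
  intros Hq HX HY EzX H12 H21 [r1 [Hr1 [Hc1 E1]]] x y
    EA12 EB12 HF12 EA21 EB21 HF21 HZ HD Hfg.
  (* The threshold of [small_qpow]. It is symmetric in the two shifts, so it puts both [x] and [y]
     inside the disc where the contraction series converges. *)
  exists (Rabs (dY - dX) + Rabs (ln r1) / (- 2 * ln q)).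
  assert (Hl : ln q < 0) by (rewrite <- ln_1; apply ln_increasing; lra).
  assert (Hp1 : 0 <= Rabs (ln r1) / (- 2 * ln q)).
  { apply Rmult_le_pos; [apply Rabs_pos | apply Rlt_le, Rinv_0_lt_compat; lra]. }
  intros u2 v n i j Hv Hn.
  destruct (finite_vector_Fin v Hv) as [N [d HN]].
  set (aXs := fun u => pos_symbol q aX (u + RtoC dX)%C).
  set (bXs := fun u => neg_symbol q bX (u + RtoC dX)%C).
  set (aYs := fun u => pos_symbol q aY (u + RtoC dY)%C).
  set (bYs := fun u => neg_symbol q bY (u + RtoC dY)%C).
  set (NP := fun u => normal_product kap N d (aXs u) (bXs u) (aYs u2) (bYs u2)
    (fun n => v n (i - (sX + sY))%Z (j - (tX + tY))%Z) n).
  assert (ENP : entire NP).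
  { unfold NP, normal_product; apply entire_Em.
    - intros k; unfold bXs, neg_symbol; entire_tac.
    - apply entire_Em; [intros k; apply entire_const|].
      apply entire_Ep; [intros k; unfold aXs, pos_symbol; entire_tac|].
      intros m Hm; apply entire_const.
    - exact Hn. }
  exists (fun u1 => F (x (u1 - u2)) * ((zX u1 i j * zY u2 (i - sX)%Z (j - tX)%Z) * NP u1))%C.
  exists (fun u1 => F (y (u1 - u2)) * ((zY u2 i j * zX u1 (i - sY)%Z (j - tY)%Z) * NP u1))%C.
  split.
  { apply (meromorphic_quotient A12 B12 _ (fun t => F (x t))); try assumption.
    pose proof (EzX i j); entire_tac. }
  split.
  { apply (meromorphic_quotient A21 B21 _ (fun t => F (y t))); try assumption.
    pose proof (EzX (i - sY)%Z (j - tY)%Z); entire_tac. }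
  split; [|split].
  - intros u1 Hu.
    assert (Hx : qpow q (RtoC 2 * (u2 + RtoC dY - (u1 + RtoC dX)))%C = x (u1 - u2)%C).
    { unfold x; f_equal; rewrite RtoC_minus; ring. }
    assert (Hs : Cmod (x (u1 - u2)%C) < r1).
    { unfold x; apply small_qpow; try assumption.
      replace (Re (- (u1 - u2))%C) with (Re u2 - Re u1) by (unfold Re; simpl; ring); lra. }
    destruct (contraction_series q kap aX bY al F r1 (u1 + RtoC dX)%C (u2 + RtoC dY)%C
      H12 Hc1) as [c [Hc Ec]]; [rewrite Hx; exact Hs | rewrite Hx; apply E1, Hs|].
    rewrite Hx in Ec.
    eexists; split; [apply (vertex_op_comp kap _ _ _ _ _ _ _ _ _ _ _ _ c N d v (HX u1) (HY u2) Hc HN)|].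
    cbv beta; rewrite Ec; unfold NP, aXs, bXs, aYs, bYs; ring.
  - intros u1 Hu.
    assert (Hx : qpow q (RtoC 2 * (u1 + RtoC dX - (u2 + RtoC dY)))%C = y (u1 - u2)%C).
    { unfold y; f_equal; rewrite RtoC_minus; ring. }
    assert (Hs : Cmod (y (u1 - u2)%C) < r1).
    { unfold y; apply small_qpow; try assumption.
      replace (Re (u1 - u2)%C) with (Re u1 - Re u2) by (unfold Re; simpl; ring).
      replace (dX - dY) with (- (dY - dX)) by ring; rewrite Rabs_Ropp; lra. }
    destruct (contraction_series q kap aY bX al F r1 (u2 + RtoC dY)%C (u1 + RtoC dX)%C
      H21 Hc1) as [c [Hc Ec]]; [rewrite Hx; exact Hs | rewrite Hx; apply E1, Hs|].
    rewrite Hx in Ec.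
    eexists; split; [apply (vertex_op_comp kap _ _ _ _ _ _ _ _ _ _ _ _ c N d v (HY u2) (HX u1) Hc HN)|].
    cbv beta; rewrite Ec; unfold NP; rewrite normal_product_comm by exact Hn.
    rewrite (Z.add_comm sX sY), (Z.add_comm tX tY).
    unfold aXs, bXs, aYs, bYs; ring.
  - exists (fun u1 => D (u1 - u2)%C); split; [apply nonzero_entire_shift, HD|].
    intros u1 Hu; rewrite HZ.
    specialize (Hfg _ Hu).
    transitivity (f (u1 - u2) * Zr (u1 - u2) * F (x (u1 - u2))
      * ((zY u2 i j * zX u1 (i - sY)%Z (j - tY)%Z) * NP u1))%C; [ring|].
    rewrite Hfg; ring.
Qed.

Lemma commutes_vertex (kap : nat -> R) (A : op) a b zeta s t (h0 P0 : C) (f : C -> C -> C) :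
  vertex_op kap A a b zeta s t ->
  (forall i j, f (h0 + RtoC (2 * IZR (i - s)))%C (P0 + RtoC (IZR (j - t)))%C
     = f (h0 + RtoC (2 * IZR i))%C (P0 + RtoC (IZR j))%C) ->
  commutes A (hP_fun h0 P0 f).
Proof.
  intros HA Hf v Hv; destruct (finite_vector_Fin v Hv) as [N [d HN]].
  assert (Hc : is_Cseries (fun k => a k * RtoC (kap k) * RtoC 0)%C (RtoC 0)).
  { apply is_Cseries_finite with O; [intros; ring | reflexivity]. }
  eexists; split.
  - apply (HA (fun f => f) (fun _ => RtoC 0) (RtoC 0) N d (fun i j n => v n i j)
      (creation_id kap) Hc HN).
  - set (g := fun (i j : Z) n => (f (h0 + RtoC (2 * IZR i)) (P0 + RtoC (IZR j)) * v n i j)%C).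
    eapply op_eq; [apply (HA (fun f => f) (fun _ => RtoC 0) (RtoC 0) N d g
      (creation_id kap) Hc) | reflexivity|].
    + intros i j; apply Fin_scal, HN.
    + intros n i j; unfold g, hP_fun; cbv beta; rewrite Hf, Ep_scal, Em_scal; ring.
Qed.

(** * Contractions *)

Lemma Rpower_INR (q a : R) (k : nat) : Rpower q (a * INR k) = Rpower q a ^ k.
Proof. rewrite <- Rpower_mult, Rpower_pow; [reflexivity | apply exp_pos]. Qed.

Lemma Rpower_lt_1 (q x : R) : 0 < q < 1 -> 0 < x -> 0 < Rpower q x < 1.
Proof.
  intros Hq Hx; split; [apply exp_pos|].
  unfold Rpower; rewrite <- exp_0; apply exp_increasing.
  assert (ln q < 0) by (rewrite <- ln_1; apply ln_increasing; lra); nra.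
Qed.

Lemma nome_pow (q r : R) (k : nat) : nome q r ^ k = (Rpower q r ^ k) ^ 2.
Proof.
  unfold nome; replace (2 * r) with (r * INR 2) by (simpl; ring).
  rewrite Rpower_INR, <- !pow_mult, Nat.mul_comm; reflexivity.
Qed.

Lemma nome_bounds (q r : R) : 0 < q < 1 -> 0 < r -> 0 < nome q r < 1.
Proof. intros Hq Hr; apply Rpower_lt_1; lra. Qed.

Lemma qnum_INR (q r : R) (k : nat) :
  0 < q < 1 ->
  qnum q (r * INR k) = (Rpower q r ^ k - / Rpower q r ^ k) / (q - / q).
Proof.
  intros Hq; unfold qnum.
  rewrite Rpower_Ropp, Rpower_INR; reflexivity.
Qed.

Lemma Rinv_gt (x : R) : 0 < x < 1 -> x < / x.
Proof.
  intros Hx; apply Rlt_trans with 1; [lra|].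
  rewrite <- Rinv_1; apply Rinv_lt_contravar; lra.
Qed.

Lemma qnum_pos (q x : R) : 0 < q < 1 -> 0 < x -> 0 < qnum q x.
Proof.
  intros Hq Hx; unfold qnum; rewrite Rpower_Ropp.
  pose proof (Rinv_gt q Hq); pose proof (Rinv_gt _ (Rpower_lt_1 q x Hq Hx)).
  replace ((Rpower q x - / Rpower q x) / (q - / q))
    with ((/ Rpower q x - Rpower q x) / (/ q - q))
    by (assert (q * q < 1) by nra; pose proof (exp_pos (x * ln q)); unfold Rpower;
        field; repeat split; lra).
  apply Rdiv_lt_0_compat; lra.
Qed.

Definition qdiff (q x : R) : R := qnum q (2 * x) - qnum q x.

Lemma qnum_eq (q x s : R) : Rpower q x = s -> qnum q x = (s - / s) / (q - / q).
Proof. intros <-; unfold qnum; rewrite Rpower_Ropp; reflexivity. Qed.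

Lemma Rpower_double (q x : R) : Rpower q (2 * x) = Rpower q x ^ 2.
Proof. rewrite Rmult_comm; replace 2 with (INR 2) by reflexivity; apply Rpower_INR. Qed.

Lemma qdiff_pos (q x : R) : 0 < q < 1 -> 0 < x -> 0 < qdiff q x.
Proof.
  intros Hq Hx; unfold qdiff.
  pose proof (Rpower_lt_1 q x Hq Hx) as Hs.
  rewrite (qnum_eq q (2 * x) _ (Rpower_double q x)), (qnum_eq q x _ eq_refl).
  set (s := Rpower q x) in *; pose proof (Rinv_gt q Hq).
  replace ((s ^ 2 - / s ^ 2) / (q - / q) - (s - / s) / (q - / q))
    with ((1 - s) * (1 + s ^ 3) / s ^ 2 / (/ q - q)).
  - assert (0 < s ^ 2) by (apply pow_lt; lra); assert (0 < s ^ 3) by (apply pow_lt; lra).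
    repeat apply Rdiv_lt_0_compat; try lra; apply Rmult_lt_0_compat; lra.
  - assert (q * q < 1) by nra; field; repeat split; lra.
Qed.

Definition kap (q r : R) (k : nat) : R := kappa q r (Zpos (mode k)).
Definition tau_beta (q r : R) (m : Z) : R := qnum q ((r - 1) * IZR m) / qnum q (r * IZR m).
Definition coefE (q : R) (m : Z) : R := - / qnum q (IZR m).
Definition coefF (q : R) (m : Z) : R := / qnum q (IZR m).
Definition coefPhi (q : R) (m : Z) : R := - / (qnum q (2 * IZR m) - qnum q (IZR m)).
Definition coefPsi (q : R) (m : Z) : R := / (qnum q (2 * IZR m) - qnum q (IZR m)).
Definition coefKinv (q r : R) (m : Z) : R := - coefK q r m.

Lemma qnums_neq_0 (q r x : R) :
  0 < q < 1 -> 0 < r - 1 -> 0 < x ->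
  x <> 0 /\ qnum q x <> 0 /\ qnum q (r * x) <> 0 /\ qnum q ((r - 1) * x) <> 0 /\
  qnum q (2 * x) - qnum q x <> 0.
Proof.
  intros Hq Hr Hx.
  assert (H1 : 0 < r * x) by nra; assert (H2 : 0 < (r - 1) * x) by nra.
  pose proof (qnum_pos q x Hq Hx); pose proof (qnum_pos q _ Hq H1); pose proof (qnum_pos q _ Hq H2).
  pose proof (qdiff_pos q x Hq Hx); unfold qdiff in *; repeat split; lra.
Qed.

(** All contraction coefficients are rational in [m] and in q-numbers whose denominators are
    nonzero; [[-m] = - [m]] reduces negative modes to positive ones. *)
Ltac contraction q r k :=
  let Hx := fresh "Hx" in
  intros; unfold pos_coef, neg_coef, kap, kappa, tau_beta, coefE, coefF, coefPhi, coefPsi,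
    coefKinv, coefK;
  rewrite ?IZR_neg_mode, ?IZR_mode, ?Ropp_mult_distr_r_reverse, ?qnum_opp;
  assert (Hx : 0 < INR (S k)) by (apply lt_0_INR; lia);
  destruct (qnums_neq_0 q r (INR (S k))) as [? [? [? [? ?]]]]; try assumption;
  set (x := INR (S k)) in *;
  field; repeat split; try assumption; try lra.

Lemma contraction_Phi_E (q r : R) (k : nat) :
  0 < q < 1 -> 0 < r - 1 ->
  pos_coef (coefPhi q) (tau_beta q r) k * kap q r k * neg_coef (coefE q) (fun _ => 1) k
  = - 1 / INR (S k).
Proof. contraction q r k. Qed.

Lemma contraction_E_Phi (q r : R) (k : nat) :
  0 < q < 1 -> 0 < r - 1 ->
  pos_coef (coefE q) (fun _ => 1) k * kap q r k * neg_coef (coefPhi q) (tau_beta q r) k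
  = - 1 / INR (S k).
Proof. contraction q r k. Qed.

Lemma contraction_Psi_F (q r : R) (k : nat) :
  0 < q < 1 -> 0 < r - 1 ->
  pos_coef (coefPsi q) (fun _ => 1) k * kap q r k * neg_coef (coefF q) (tau_beta q r) k
  = - 1 / INR (S k).
Proof. contraction q r k. Qed.

Lemma contraction_F_Psi (q r : R) (k : nat) :
  0 < q < 1 -> 0 < r - 1 ->
  pos_coef (coefF q) (tau_beta q r) k * kap q r k * neg_coef (coefPsi q) (fun _ => 1) k
  = - 1 / INR (S k).
Proof. contraction q r k. Qed.

Lemma contraction_Phi_F (q r : R) (k : nat) :
  0 < q < 1 -> 0 < r - 1 ->
  pos_coef (coefPhi q) (tau_beta q r) k * kap q r k * neg_coef (coefF q) (tau_beta q r) k
  = qnum q ((r - 1) * INR (S k)) / qnum q (r * INR (S k)) / INR (S k).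
Proof. contraction q r k. Qed.

Lemma contraction_F_Phi (q r : R) (k : nat) :
  0 < q < 1 -> 0 < r - 1 ->
  pos_coef (coefF q) (tau_beta q r) k * kap q r k * neg_coef (coefPhi q) (tau_beta q r) k
  = qnum q ((r - 1) * INR (S k)) / qnum q (r * INR (S k)) / INR (S k).
Proof. contraction q r k. Qed.

Lemma contraction_Psi_E (q r : R) (k : nat) :
  0 < q < 1 -> 0 < r - 1 ->
  pos_coef (coefPsi q) (fun _ => 1) k * kap q r k * neg_coef (coefE q) (fun _ => 1) k
  = qnum q (r * INR (S k)) / qnum q ((r - 1) * INR (S k)) / INR (S k).
Proof. contraction q r k. Qed.

Lemma contraction_E_Psi (q r : R) (k : nat) :
  0 < q < 1 -> 0 < r - 1 ->
  pos_coef (coefE q) (fun _ => 1) k * kap q r k * neg_coef (coefPsi q) (fun _ => 1) k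
  = qnum q (r * INR (S k)) / qnum q ((r - 1) * INR (S k)) / INR (S k).
Proof. contraction q r k. Qed.

(** With [r] it is the contraction of [K^(-1)] with [Phi_minus]; with [r - 1] and the opposite sign,
    the one with [Psi_minus_star]. Hence the same function [rho] governs both types. *)
Definition qK (q r x : R) : R := qnum q x ^ 2 / (qnum q (r * x) * qdiff q x).

Lemma contraction_K_Phi (q r : R) (k : nat) :
  0 < q < 1 -> 0 < r - 1 ->
  pos_coef (coefKinv q r) (fun _ => 1) k * kap q r k * neg_coef (coefPhi q) (tau_beta q r) k
  = qK q r (INR (S k)) / INR (S k).
Proof. unfold qK, qdiff; contraction q r k. Qed.

Lemma contraction_Phi_K (q r : R) (k : nat) :
  0 < q < 1 -> 0 < r - 1 ->
  pos_coef (coefPhi q) (tau_beta q r) k * kap q r k * neg_coef (coefKinv q r) (fun _ => 1) k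
  = qK q r (INR (S k)) / INR (S k).
Proof. unfold qK, qdiff; contraction q r k. Qed.

Lemma contraction_K_Psi (q r : R) (k : nat) :
  0 < q < 1 -> 0 < r - 1 ->
  pos_coef (coefKinv q r) (fun _ => 1) k * kap q r k * neg_coef (coefPsi q) (fun _ => 1) k
  = - qK q (r - 1) (INR (S k)) / INR (S k).
Proof. unfold qK, qdiff; contraction q r k. Qed.

Lemma contraction_Psi_K (q r : R) (k : nat) :
  0 < q < 1 -> 0 < r - 1 ->
  pos_coef (coefPsi q) (fun _ => 1) k * kap q r k * neg_coef (coefKinv q r) (fun _ => 1) k
  = - qK q (r - 1) (INR (S k)) / INR (S k).
Proof. unfold qK, qdiff; contraction q r k. Qed.

(* [[m]^3 / (m [rm] [r^* m] ([2m] - [m]))], from reordering [K^(-1)] itself. *)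
Lemma contraction_K_K (q r : R) (k : nat) :
  0 < q < 1 -> 0 < r - 1 ->
  pos_coef (coefKinv q r) (fun _ => 1) k * kap q r k * neg_coef (coefKinv q r) (fun _ => 1) k
  = - qK q r (INR (S k)) * (qnum q (INR (S k)) / qnum q ((r - 1) * INR (S k))) / INR (S k).
Proof. unfold qK, qdiff; contraction q r k. Qed.

(** * Rational forms of the contraction coefficients *)

Lemma qnum_ratio_lower (q r : R) (k : nat) :
  0 < q < 1 -> 0 < r - 1 ->
  qnum q ((r - 1) * INR (S k)) / qnum q (r * INR (S k))
  = (q ^ S k - (nome q r / q) ^ S k) / (1 - nome q r ^ S k).
Proof.
  intros Hq Hr.
  pose proof (Rpower_lt_1 q r Hq ltac:(lra)) as Ha.
  assert (Hs : 0 < q ^ S k) by (apply pow_lt; lra).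
  pose proof (pow_S_le (Rpower q r) k Ha) as Hb.
  assert (Ha' : 0 < Rpower q r ^ S k) by (apply pow_lt; lra).
  rewrite !qnum_INR by assumption.
  replace ((nome q r / q) ^ S k) with (nome q r ^ S k * / q ^ S k)
    by (unfold Rdiv; rewrite Rpow_mult_distr, pow_inv; reflexivity).
  rewrite nome_pow.
  replace (Rpower q (r - 1)) with (Rpower q r * / q)
    by (unfold Rminus; rewrite Rpower_plus, Rpower_Ropp, Rpower_1 by lra; reflexivity).
  rewrite Rpow_mult_distr, pow_inv.
  set (b := Rpower q r ^ S k) in *; set (s := q ^ S k) in *.
  assert (b * b < 1) by nra; assert (q * q < 1) by nra.
  field; repeat split; nra.
Qed.

Lemma qnum_ratio_upper (q r : R) (k : nat) :
  0 < q < 1 -> 0 < r - 1 ->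
  qnum q (r * INR (S k)) / qnum q ((r - 1) * INR (S k))
  = ((/ q) ^ S k - (nome q (r - 1) / / q) ^ S k) / (1 - nome q (r - 1) ^ S k).
Proof.
  intros Hq Hr.
  pose proof (Rpower_lt_1 q (r - 1) Hq ltac:(lra)) as Ha.
  assert (Hs : 0 < q ^ S k) by (apply pow_lt; lra).
  pose proof (pow_S_le (Rpower q (r - 1)) k Ha) as Hb.
  assert (Ha' : 0 < Rpower q (r - 1) ^ S k) by (apply pow_lt; lra).
  rewrite !qnum_INR by assumption.
  replace ((nome q (r - 1) / / q) ^ S k) with (nome q (r - 1) ^ S k * q ^ S k)
    by (unfold Rdiv; rewrite Rpow_mult_distr, Rinv_inv; reflexivity).
  rewrite nome_pow, pow_inv.
  replace (Rpower q r) with (Rpower q (r - 1) * q)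
    by (rewrite <- (Rpower_1 q) at 2 by lra; rewrite <- Rpower_plus; f_equal; ring).
  rewrite Rpow_mult_distr.
  set (b := Rpower q (r - 1) ^ S k) in *; set (s := q ^ S k) in *.
  assert (b * b < 1) by nra; assert (q * q < 1) by nra.
  field; repeat split; nra.
Qed.

(** The ratio simplifies to [q^(rm) (1 - s) (1 + s)^2 / ((1 + s^3) (1 - p^m))]. Multiplying above
    and below by [1 - s^3] produces the base [q^6] of [rho], and the expanded numerator is the
    stated polynomial. *)
Lemma qK_eq (q r : R) (k : nat) :
  0 < q < 1 -> 0 < r ->
  let s := q ^ S k in
  qK q r (INR (S k))
  = Rpower q r ^ S k * ((1 + s - s ^ 2 - 2 * s ^ 3 - s ^ 4 + s ^ 5 + s ^ 6)
      / (1 - (q ^ 6) ^ S k) / (1 - nome q r ^ S k)).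
Proof.
  intros Hq Hr s; unfold qK, qdiff.
  pose proof (Rpower_lt_1 q r Hq Hr) as Ha.
  assert (Hs : 0 < s) by (apply pow_lt; lra).
  assert (Hs1 : s < 1) by (pose proof (pow_S_le q k Hq); unfold s; lra).
  pose proof (pow_S_le (Rpower q r) k Ha) as Hb.
  assert (Ha' : 0 < Rpower q r ^ S k) by (apply pow_lt; lra).
  assert (E : Rpower q (INR (S k)) = s) by (apply Rpower_pow; lra).
  rewrite qnum_INR by assumption.
  rewrite (qnum_eq q (2 * INR (S k)) (s ^ 2)) by (rewrite Rpower_double, E; reflexivity).
  rewrite (qnum_eq q (INR (S k)) s E), nome_pow.
  replace ((q ^ 6) ^ S k) with (s ^ 6) by (unfold s; rewrite <- !pow_mult; f_equal; lia).
  set (b := Rpower q r ^ S k) in *.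
  assert (b * b < 1) by nra; assert (q * q < 1) by nra.
  assert (0 < s ^ 3) by (apply pow_lt; lra).
  assert (s ^ 3 < 1) by (replace (s ^ 3) with (s * s ^ 2) by ring; nra).
  assert (s ^ 6 < 1) by (replace (s ^ 6) with (s ^ 3 * s ^ 3) by ring; nra).
  assert (D : (s ^ 2 - / s ^ 2) / (q - / q) - (s - / s) / (q - / q)
    = (s - 1) * (s ^ 3 + 1) / s ^ 2 / (q - / q)).
  { field; repeat split; nra. }
  rewrite D; field; repeat split; nra.
Qed.

(** * The currents as vertex operators *)

Lemma zpow_add (q : R) (u a b : C) : zpow q u (a + b)%C = (zpow q u a * zpow q u b)%C.
Proof. unfold zpow; rewrite <- qpow_add; f_equal; ring. Qed.

Definition parity (i : Z) : R := if Z.even i then 1 else -1.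

Lemma parity_succ (i : Z) : parity (i + 1) = - parity i.
Proof.
  unfold parity; rewrite Z.even_add; destruct (Z.even i); simpl; ring.
Qed.

Lemma parity_pred (i : Z) : parity (i - 1) = - parity i.
Proof. unfold parity; rewrite Z.even_sub; destruct (Z.even i); simpl; ring. Qed.

Lemma parity_mul_1 (i : Z) : parity (1 * i) = parity i.
Proof. rewrite Z.mul_1_l; reflexivity. Qed.

Lemma parity_mul_m1 (i : Z) : parity (-1 * i) = parity i.
Proof. unfold parity; rewrite Z.even_mul; reflexivity. Qed.

Lemma Cdiv_RtoC (z : C) (x : R) : x <> 0 -> (z / RtoC x = z * RtoC (/ x))%C.
Proof. intros H; rewrite RtoC_inv by exact H; reflexivity. Qed.

(* A family of vertex operators whose zero modes contribute the scalar
   [c i * z^(A + B i + D j)]. *)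
Definition vertex_family (q r : R) (X : C -> op) (a b : nat -> R) (c : Z -> C) (A : C) (B D : R)
    (s t : Z) : Prop :=
  forall u, vertex_op (kap q r) (X u) (pos_symbol q a u) (neg_symbol q b u)
    (fun i j => c i * zpow q u (A + RtoC (B * IZR i + D * IZR j)))%C s t.

Ltac exponents :=
  f_equal; unfold expoK;
  rewrite ?Cdiv_RtoC by lra;
  apply injective_projections; simpl;
  rewrite ?minus_IZR, ?plus_IZR; field; lra.

Lemma vertex_family_E (q r : R) (h0 P0 : C) :
  0 < r - 1 ->
  vertex_family q r (currE q r h0 P0)
    (pos_coef (coefE q) (fun _ => 1)) (neg_coef (coefE q) (fun _ => 1))
    (fun i => RtoC (eps q) * RtoC (parity (i - 1)))%C
    (h0 * RtoC (1 / 2) - P0 * RtoC (/ (r - 1)) + RtoC (- 1 / 2 - / (r - 1)))%C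
    1 (- / (r - 1)) 1 (-1).
Proof.
  intros Hr u; unfold currE.
  eapply vertex_op_eq; [apply vertex_op_scale;
    apply vertex_op_zero_mode_r; [apply vertex_op_zero_mode_r;
      [apply vertex_op_zero_mode_r; [apply vertex_op_zero_mode_r;
        [apply vertex_op_normal_exp, scaled_modes_alpha | apply zero_mode_exp_alphahat]
      | apply zero_mode_hP] | apply zero_mode_exp_Q] | apply zero_mode_hP]
  | | reflexivity | reflexivity].
  intros i j; cbv beta.
  change (if Z.even ?x then 1 else -1) with (parity x).
  rewrite parity_mul_m1, ?Z.add_0_l, ?Z.add_0_r, ?Z.sub_0_r.
  match goal with |- (_ * (_ * _ * zpow q u ?a * _ * zpow q u ?b))%C = (_ * zpow q u ?d)%C =>
    replace (zpow q u d) with (zpow q u a * zpow q u b)%C; [ring|] end.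
  rewrite <- zpow_add; exponents.
Qed.

Lemma vertex_family_F (q r : R) (h0 P0 : C) :
  0 < r - 1 ->
  vertex_family q r (currF q r h0 P0)
    (pos_coef (coefF q) (tau_beta q r)) (neg_coef (coefF q) (tau_beta q r))
    (fun _ => RtoC (eps q))
    (h0 * RtoC (/ (2 * r) - 1 / 2) + P0 * RtoC (/ r) + RtoC (/ r - 1 / 2))%C
    (/ r - 1) (/ r) (-1) 0.
Proof.
  intros Hr u; unfold currF.
  eapply vertex_op_eq; [apply vertex_op_scale;
    apply vertex_op_zero_mode_r; [apply vertex_op_zero_mode_r;
      [apply vertex_op_zero_mode_r;
        [apply vertex_op_normal_exp, scaled_modes_beta | apply zero_mode_exp_alphahat]
      | apply zero_mode_hP] | apply zero_mode_hP]
  | | reflexivity | reflexivity].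
  intros i j; cbv beta.
  rewrite ?Z.add_0_l, ?Z.add_0_r, ?Z.sub_0_r.
  match goal with |- (_ * (_ * _ * zpow q u ?a * zpow q u ?b))%C = (_ * zpow q u ?d)%C =>
    replace (zpow q u d) with (zpow q u a * zpow q u b)%C; [ring|] end.
  rewrite <- zpow_add; exponents.
Qed.

Lemma vertex_family_Phi (q r : R) (h0 P0 : C) :
  0 < r - 1 ->
  vertex_family q r (Phi_minus q r h0 P0)
    (pos_coef (coefPhi q) (tau_beta q r)) (neg_coef (coefPhi q) (tau_beta q r))
    (fun _ => RtoC 1)
    (h0 * RtoC (1 / 2 - / (2 * r)) - P0 * RtoC (/ r) + RtoC (- 1 / 2))%C
    (1 - / r) (- / r) 1 0.
Proof.
  intros Hr u; unfold Phi_minus.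
  eapply vertex_op_eq; [
    apply vertex_op_zero_mode_r; [apply vertex_op_zero_mode_r;
      [apply vertex_op_zero_mode_r;
        [apply vertex_op_normal_exp, scaled_modes_beta | apply zero_mode_exp_alphahat]
      | apply zero_mode_hP] | apply zero_mode_hP]
  | | reflexivity | reflexivity].
  intros i j; cbv beta.
  rewrite ?Z.add_0_l, ?Z.add_0_r, ?Z.sub_0_r.
  match goal with |- (_ * _ * zpow q u ?a * zpow q u ?b)%C = (_ * zpow q u ?d)%C =>
    replace (zpow q u d) with (zpow q u a * zpow q u b)%C; [ring|] end.
  rewrite <- zpow_add; exponents.
Qed.

Lemma vertex_family_Psi (q r : R) (h0 P0 : C) :
  0 < r - 1 ->
  vertex_family q r (Psi_minus_star q r h0 P0)
    (pos_coef (coefPsi q) (fun _ => 1)) (neg_coef (coefPsi q) (fun _ => 1))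
    (fun i => RtoC (parity (i + 1)))
    (h0 * RtoC (- 1 / 2) + P0 * RtoC (/ (r - 1)) + RtoC (- 1 / 2))%C
    (-1) (/ (r - 1)) (-1) 1.
Proof.
  intros Hr u; unfold Psi_minus_star.
  eapply vertex_op_eq; [
    apply vertex_op_zero_mode_r; [apply vertex_op_zero_mode_r;
      [apply vertex_op_zero_mode_r; [apply vertex_op_zero_mode_r;
        [apply vertex_op_normal_exp, scaled_modes_alpha | apply zero_mode_exp_alphahat]
      | apply zero_mode_hP] | apply zero_mode_exp_Q] | apply zero_mode_hP]
  | | reflexivity | reflexivity].
  intros i j; cbv beta.
  change (if Z.even ?x then 1 else -1) with (parity x).
  rewrite parity_mul_1, ?Z.add_0_l, ?Z.add_0_r, ?Z.sub_0_r.
  replace (i - -1)%Z with (i + 1)%Z by lia.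
  match goal with |- (_ * _ * zpow q u ?a * _ * zpow q u ?b)%C = (_ * zpow q u ?d)%C =>
    replace (zpow q u d) with (zpow q u a * zpow q u b)%C; [ring|] end.
  rewrite <- zpow_add; exponents.
Qed.

Lemma comp_assoc (A B D : op) (v w : state) : (A ∘ (B ∘ D)) v w -> (A ∘ B ∘ D) v w.
Proof. intros [x [[y [H1 H2]] H3]]; exists y; split; [exact H1 | exists x; split; assumption]. Qed.

(* The constant produced by reordering [K^(-1)]; the series converges because [r > 1]. *)
Lemma K_self_contraction (q r : R) :
  0 < q < 1 -> 0 < r - 1 ->
  exists cc, forall u, is_Cseries (fun k =>
    pos_symbol q (pos_coef (coefKinv q r) (fun _ => 1)) u k * RtoC (kap q r k)
    * neg_symbol q (neg_coef (coefKinv q r) (fun _ => 1)) u k)%C cc.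
Proof.
  intros Hq Hr.
  set (t := fun k => - qK q r (INR (S k)) * (qnum q (INR (S k)) / qnum q ((r - 1) * INR (S k)))
    / INR (S k)).
  pose proof (nome_bounds q (r - 1) Hq Hr) as Hps.
  pose proof (nome_bounds q r Hq ltac:(lra)) as Hp.
  assert (H6 : 0 < q ^ 6 < 1).
  { split; [apply pow_lt; lra|]; pose proof (pow_S_le q 5 Hq); lra. }
  (* 4 bounds [(1 - s) (1 + s)^2 (1 - s^3) (1 - s^2)] for [0 < s < 1]; the other factors bound the
     three inverse denominators uniformly in [k]. *)
  set (M := 4 * (/ (1 - q ^ 6) * / (1 - nome q r) * / (1 - nome q (r - 1)))).
  destruct (ex_Cseries_dominated (fun k => RtoC (t k)) (fun k => M * nome q (r - 1) ^ k))
    as [cc Hcc].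
  - intros k; rewrite Cmod_R.
    assert (Hx : 1 <= INR (S k)) by (rewrite S_INR; pose proof (pos_INR k); lra).
    set (s := q ^ S k); set (B := Rpower q (r - 1) ^ S k).
    assert (Hs : 0 < s < 1).
    { split; [apply pow_lt; lra|]; unfold s; pose proof (pow_S_le q k Hq); lra. }
    pose proof (Rpower_lt_1 q (r - 1) Hq Hr) as Hb.
    assert (HB : 0 < B < 1).
    { split; [apply pow_lt; lra|]; unfold B; pose proof (pow_S_le _ k Hb); lra. }
    assert (Eb : Rpower q r ^ S k = B * s).
    { unfold B, s; rewrite <- Rpow_mult_distr; f_equal.
      rewrite <- (Rpower_1 q) at 3 by lra; rewrite <- Rpower_plus; f_equal; ring. }
    assert (N1 : (q ^ 6) ^ S k <= q ^ 6) by (apply pow_S_le, H6).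
    assert (N2 : nome q r ^ S k <= nome q r) by (apply pow_S_le, Hp).
    assert (N3 : nome q (r - 1) ^ S k <= nome q (r - 1)) by (apply pow_S_le, Hps).
    assert (E3 : nome q (r - 1) ^ S k = B ^ 2) by apply nome_pow.
    (* [B ^ 2] is a power of the nome of [r - 1]; it supplies the geometric decay. *)
    assert (E : t k = - (B ^ 2 * (((1 - s) * (1 + s) ^ 2 * (1 - s ^ 3) * (1 - s ^ 2))
      * (/ (1 - (q ^ 6) ^ S k) * / (1 - nome q r ^ S k) * / (1 - nome q (r - 1) ^ S k)))
      * / INR (S k))).
    { unfold t; rewrite qK_eq by lra; fold s; rewrite Eb, E3.
      rewrite <- (Rmult_1_l (INR (S k))) at 1.
      rewrite qnum_INR, qnum_INR, Rpower_1 by lra; fold s; fold B.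
      assert (q * q < 1) by nra; assert (B * B < 1) by nra.
      field; repeat split; nra. }
    rewrite E, Rabs_Ropp.
    assert (I1 : 0 < / (1 - (q ^ 6) ^ S k) <= / (1 - q ^ 6)).
    { split; [apply Rinv_0_lt_compat; lra | apply Rinv_le_contravar; lra]. }
    assert (I2 : 0 < / (1 - nome q r ^ S k) <= / (1 - nome q r)).
    { split; [apply Rinv_0_lt_compat; lra | apply Rinv_le_contravar; lra]. }
    assert (I3 : 0 < / (1 - nome q (r - 1) ^ S k) <= / (1 - nome q (r - 1))).
    { split; [apply Rinv_0_lt_compat; lra | apply Rinv_le_contravar; lra]. }
    assert (I4 : 0 < / INR (S k) <= 1).
    { split; [apply Rinv_0_lt_compat; lra|].
      rewrite <- Rinv_1; apply Rinv_le_contravar; lra. }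
    assert (S2 : 0 < s ^ 2 < 1) by (split; [apply pow_lt; lra | nra]).
    assert (S3 : 0 < s ^ 3 < 1)
      by (split; [apply pow_lt; lra | replace (s ^ 3) with (s * s ^ 2) by ring; nra]).
    assert (Pp : 0 <= (1 - s) * (1 + s) ^ 2 * (1 - s ^ 3) * (1 - s ^ 2) <= 4).
    { split; [repeat apply Rmult_le_pos; try lra; apply pow_le; lra|].
      apply Rle_trans with (1 * 4 * 1 * 1); [|lra].
      repeat apply Rmult_le_compat; try lra; try (apply pow_le; lra);
        repeat apply Rmult_le_pos; try lra; try (apply pow_le; lra); nra. }
    set (P := (1 - s) * (1 + s) ^ 2 * (1 - s ^ 3) * (1 - s ^ 2)) in *.
    set (i1 := / (1 - (q ^ 6) ^ S k)) in *; set (i2 := / (1 - nome q r ^ S k)) in *.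
    set (i3 := / (1 - nome q (r - 1) ^ S k)) in *.
    assert (HB2 : 0 < B ^ 2) by (apply pow_lt; lra).
    assert (Q : P * (i1 * i2 * i3) <= M).
    { assert (0 <= i1 * i2) by (apply Rmult_le_pos; lra).
      unfold M; apply Rmult_le_compat; [lra | apply Rmult_le_pos; lra | lra |].
      apply Rmult_le_compat; [lra | lra | apply Rmult_le_compat; lra | lra]. }
    assert (Q0 : 0 <= P * (i1 * i2 * i3))
      by (apply Rmult_le_pos; [lra|]; repeat apply Rmult_le_pos; lra).
    assert (T : B ^ 2 <= nome q (r - 1) ^ k).
    { rewrite <- E3; simpl; assert (0 < nome q (r - 1) ^ k) by (apply pow_lt; lra); nra. }
    rewrite Rabs_pos_eq.
    + apply Rle_trans with (B ^ 2 * (P * (i1 * i2 * i3))).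
      * rewrite <- (Rmult_1_r (B ^ 2 * (P * (i1 * i2 * i3)))) at 2.
        apply Rmult_le_compat_l; [apply Rmult_le_pos; lra | lra].
      * rewrite (Rmult_comm M); apply Rmult_le_compat; lra.
    + apply Rmult_le_pos; [apply Rmult_le_pos; lra | lra].
  - apply (ex_series_scal (K := R_AbsRing) (V := R_NormedModule)), ex_series_geom.
    rewrite Rabs_pos_eq; lra.
  - exists cc; intros u; eapply is_Cseries_ext; [|exact Hcc].
    intros k; cbv beta; unfold t; rewrite <- contraction_K_K by assumption.
    rewrite !RtoC_mult; unfold pos_symbol, neg_symbol.
    (* The dependence on [u] cancels because both halves sit at the same point. *)
    assert (Z : (zpow q u (RtoC (- INR (S k))) * zpow q u (RtoC (INR (S k))) = RtoC 1)%C).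
    { rewrite <- zpow_add, <- RtoC_plus, Rplus_opp_l; unfold zpow.
      rewrite Cmult_0_r; apply qpow_0. }
    match goal with |- (?a * ?k * ?b)%C = _ => transitivity (a * k * b * RtoC 1)%C; [ring|] end.
    rewrite <- Z; ring.
Qed.

(** [Cexp cc] depends on neither the zero mode labels nor [u], so it drops out when [K^(-1)] is
    moved past another operator. *)
Lemma vertex_family_K (q r : R) (h0 P0 : C) :
  0 < q < 1 -> 0 < r - 1 ->
  exists cc,
  vertex_family q r (currK_inv q r h0 P0)
    (pos_coef (coefKinv q r) (fun _ => 1)) (neg_coef (coefKinv q r) (fun _ => 1))
    (fun i => Cexp cc * RtoC (parity i))%C
    (P0 * RtoC (/ (r - 1) - / r) - h0 * RtoC (/ (2 * r)))%C
    (- / r) (/ (r - 1) - / r) 0 1.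
Proof.
  intros Hq Hr; destruct (K_self_contraction q r Hq Hr) as [cc Hcc]; exists cc.
  intros u; unfold currK_inv.
  assert (H : vertex_op (kap q r) (zpow_hP q h0 P0 u (fun h P => - expoK r h P)%C ∘ lift (exp_Q 1) ∘
    (op_exp (mode_sum q Zpos (alpha q r) (coefKinv q r) u)
     ∘ op_exp (mode_sum q Zneg (alpha q r) (coefKinv q r) u)))
    (pos_symbol q (pos_coef (coefKinv q r) (fun _ => 1)) u)
    (neg_symbol q (neg_coef (coefKinv q r) (fun _ => 1)) u)
    (fun i j => Cexp cc * RtoC (parity i) * zpow q u
      (P0 * RtoC (/ (r - 1) - / r) - h0 * RtoC (/ (2 * r))
       + RtoC (- / r * IZR i + (/ (r - 1) - / r) * IZR j)))%C 0 1).
  { eapply vertex_op_eq; [apply vertex_op_zero_mode_l;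
      [apply zero_mode_op_comp; [apply zero_mode_hP | apply zero_mode_exp_Q]
      | apply (vertex_op_anti_normal_exp q _ _ _ _ _ cc (scaled_modes_alpha q r)); apply Hcc]
    | | reflexivity | reflexivity].
    intros i j; cbv beta.
    change (if Z.even ?x then 1 else -1) with (parity x).
    rewrite parity_mul_1, ?Z.add_0_l, ?Z.add_0_r, ?Z.sub_0_r.
    match goal with |- (zpow q u ?a * _ * _)%C = (_ * zpow q u ?d)%C =>
      replace (zpow q u d) with (zpow q u a); [ring|] end.
    exponents. }
  intros W w c N d f HW Hc Hf; apply comp_assoc, (H W w c N d f HW Hc Hf).
Qed.

(** * Theta functions and the scalar factors *)

(* The point where [z = q^(2u)] equals [-1], which is not a zero of any of the
   products [(c z; t_1, ..., t_k)_infinity] and [(c / z; t_1, ..., t_k)_infinity]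
   with [c > 0]. *)
Definition base_point (q : R) : C := (0, PI / (2 * ln q)).

(** Asking for a nonzero value at one fixed point, rather than somewhere, makes the class closed
    under products without the identity theorem. *)
Definition regular (q : R) (f : C -> C) : Prop := entire f /\ f (base_point q) <> RtoC 0.

Lemma regular_nonzero_entire (q : R) (f : C -> C) : regular q f -> nonzero_entire f.
Proof. intros [H1 H2]; split; [exact H1 | exists (base_point q); exact H2]. Qed.

Lemma regular_mult (q : R) (f g : C -> C) :
  regular q f -> regular q g -> regular q (fun t => f t * g t)%C.
Proof.
  intros [H1 H2] [H3 H4]; split; [apply entire_mult; assumption | apply Cmult_neq_0; assumption].
Qed.

Ltac split_regular :=
  repeat match goal with
    | |- regular ?q (fun t => @?f t * @?g t)%C => apply (regular_mult q f g)
    end.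

Lemma regular_const (q : R) (c : C) : c <> RtoC 0 -> regular q (fun _ => c).
Proof. intros H; split; [apply entire_const | exact H]. Qed.

Definition spectral (q : R) (t : C) : C := qpow q (RtoC 2 * t)%C.
Definition spectral_inv (q : R) (t : C) : C := qpow q (- (RtoC 2 * t))%C.

Lemma spectral_inv_eq (q : R) (t : C) : spectral_inv q t = (/ spectral q t)%C.
Proof. apply qpow_opp. Qed.

Lemma spectral_neq_0 (q : R) (t : C) : spectral q t <> RtoC 0.
Proof. apply qpow_neq_0. Qed.

Lemma spectral_base_point (q : R) : 0 < q < 1 -> spectral q (base_point q) = RtoC (-1).
Proof.
  intros Hq; assert (ln q < 0) by (rewrite <- ln_1; apply ln_increasing; lra).
  unfold spectral, qpow, Cexp, base_point.
  replace (RtoC 2 * (0, (PI / (2 * ln q))%R) * RtoC (ln q))%C with ((0, PI) : C)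
    by (apply injective_projections; simpl; field; lra).
  unfold Re, Im; simpl; rewrite exp_0, cos_PI, sin_PI.
  apply injective_projections; simpl; ring.
Qed.

(** The zeros of the products lie on [[1, infinity)], so a value [x <= 0] avoids them; both [z] and
    [1 / z] are -1 at the base point, and dilation by [c >= 0] preserves the sign. *)
Definition negative_arg (q : R) (w : C -> C) : Prop :=
  entire w /\ exists x, x <= 0 /\ w (base_point q) = RtoC x.

Lemma negative_arg_scal (q c : R) (w : C -> C) :
  0 <= c -> negative_arg q w -> negative_arg q (fun t => RtoC c * w t)%C.
Proof.
  intros Hc [H1 [x [Hx E]]]; split; [entire_tac|].
  exists (c * x); split; [nra | rewrite E, RtoC_mult; reflexivity].
Qed.

Lemma negative_arg_spectral (q : R) : 0 < q < 1 -> negative_arg q (spectral q).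
Proof.
  intros Hq; split; [unfold spectral; entire_tac|].
  exists (-1); split; [lra | apply spectral_base_point, Hq].
Qed.

Lemma negative_arg_spectral_inv (q : R) : 0 < q < 1 -> negative_arg q (spectral_inv q).
Proof.
  intros Hq; split; [unfold spectral_inv; entire_tac|].
  exists (-1); split; [lra|]; rewrite spectral_inv_eq, spectral_base_point by exact Hq.
  apply injective_projections; simpl; field.
Qed.

Lemma regular_qpoch (q : R) (w : C -> C) (ts : list R) :
  ratios ts -> negative_arg q w -> regular q (fun t => qpoch (w t) ts).
Proof.
  intros Hts [H1 [x [Hx E]]]; split.
  - apply (entire_comp (fun z => qpoch z ts)); [|exact H1].
    apply unit_entire_entire, unit_entire_qpoch, Hts.
  - apply qpoch_neq_0; [exact Hts|]; intros [y [Hy Ey]].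
    rewrite E in Ey; apply RtoC_inj in Ey; lra.
Qed.

Lemma regular_dilated_qpoch (q c : R) (w : C -> C) (ts : list R) :
  ratios ts -> 0 <= c -> negative_arg q w -> regular q (fun t => qpoch (RtoC c * w t) ts)%C.
Proof.
  intros Hts Hc H; apply (regular_qpoch q (fun t => RtoC c * w t)%C);
    [exact Hts | apply negative_arg_scal; assumption].
Qed.

(** Each operator shifts the labels [i], [j] read by the other. The two conditions on [e] make the
    resulting powers of [z1] and [z2] opposite, so that only [(z1 / z2)^e] remains, a function of
    [u1 - u2]; [sgn] is the sign from exchanging [e^Q] and [e^alphahat]. *)
Lemma exchange_family (q r : R) (X Y : C -> op) (aX bX aY bY : nat -> R) (cX cY : Z -> C)
    (AX AY : C) (BX DX BY DY : R) (sX tX sY tY : Z) (dX dY e sgn : R) (al : nat -> R)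
    (F A12 B12 A21 B21 D f g : C -> C) :
  0 < q < 1 ->
  vertex_family q r X aX bX cX AX BX DX sX tX ->
  vertex_family q r Y aY bY cY AY BY DY sY tY ->
  (forall i, cX i * cY (i - sX)%Z = RtoC sgn * (cY i * cX (i - sY)%Z))%C ->
  BX * IZR sY + DX * IZR tY = e -> BY * IZR sX + DY * IZR tX = e ->
  (forall k, aX k * kap q r k * bY k = al (S k) / INR (S k)) ->
  (forall k, aY k * kap q r k * bX k = al (S k) / INR (S k)) ->
  exp_series al F ->
  let x := fun t => qpow q (RtoC 2 * (- t + RtoC (dY - dX)))%C in
  let y := fun t => qpow q (RtoC 2 * (t + RtoC (dX - dY)))%C in
  entire A12 -> regular q B12 -> (forall t, B12 t <> RtoC 0 -> F (x t) = A12 t / B12 t)%C ->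
  entire A21 -> regular q B21 -> (forall t, B21 t <> RtoC 0 -> F (y t) = A21 t / B21 t)%C ->
  regular q D ->
  (forall t, D t <> RtoC 0 ->
    f t * (RtoC sgn * zpow q (t + RtoC (dX - dY)) (RtoC e)) * F (x t) = g t * F (y t))%C ->
  exchange f (fun u => X (u + RtoC dX)%C) (fun u => Y (u + RtoC dY)%C) g.
Proof.
  intros Hq HX HY Hc E1 E2 H12 H21 HF x y EA12 RB12 HF12 EA21 RB21 HF21 RD H.
  apply (exchange_vertex q (kap q r) _ _ aX bX aY bY
    (fun u i j => cX i * zpow q (u + RtoC dX) (AX + RtoC (BX * IZR i + DX * IZR j)))%C
    (fun u i j => cY i * zpow q (u + RtoC dY) (AY + RtoC (BY * IZR i + DY * IZR j)))%C
    sX tX sY tY dX dY al F A12 B12 A21 B21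
    (fun t => RtoC sgn * zpow q (t + RtoC (dX - dY)) (RtoC e))%C D f g); try assumption;
    try (eapply regular_nonzero_entire; eassumption).
  - intros u; apply HX.
  - intros u; apply HY.
  - intros i j; entire_tac.
  - intros u1 u2 i j.
    match goal with |- (?cx * ?z1 * (?cy * ?z2) = ?sg * ?z * (?cy' * ?z3 * (?cx' * ?z4)))%C =>
      transitivity ((cx * cy) * (z1 * z2))%C; [ring|];
      transitivity ((sg * (cy' * cx')) * (z * z3 * z4))%C; [|ring] end.
    rewrite Hc; f_equal.
    unfold zpow; rewrite <- !qpow_add; f_equal.
    rewrite !minus_IZR.
    replace (BX * (IZR i - IZR sY) + DX * (IZR j - IZR tY))
      with (BX * IZR i + DX * IZR j - e) by (rewrite <- E1; ring).
    replace (BY * (IZR i - IZR sX) + DY * (IZR j - IZR tX))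
      with (BY * IZR i + DY * IZR j - e) by (rewrite <- E2; ring).
    rewrite !RtoC_minus; ring.
Qed.

Lemma shift_0 (X : C -> op) : (fun u => X (u + RtoC 0)%C) = X.
Proof. apply functional_extensionality; intros u; f_equal; ring. Qed.

Lemma spectral_unshifted (q : R) (t : C) :
  qpow q (RtoC 2 * (t + RtoC (0 - 0)))%C = spectral q t.
Proof. unfold spectral; f_equal; rewrite Rminus_0_r; ring. Qed.

Lemma spectral_inv_unshifted (q : R) (t : C) :
  qpow q (RtoC 2 * (- t + RtoC (0 - 0)))%C = spectral_inv q t.
Proof. unfold spectral_inv; f_equal; rewrite Rminus_0_r; ring. Qed.

Lemma qpow_RtoC (q a : R) : qpow q (RtoC a) = RtoC (Rpower q a).
Proof.
  unfold qpow, Cexp, Rpower; rewrite <- RtoC_mult; unfold Re, Im; simpl.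
  rewrite cos_0, sin_0; apply injective_projections; simpl; ring.
Qed.

Lemma zpow_RtoC_1 (q : R) (t : C) : zpow q t (RtoC 1) = spectral q t.
Proof. unfold zpow, spectral; f_equal; ring. Qed.

(* With contraction [log (1 - w)] both products continue to the same function
   because [- z (1 - 1 / z) = 1 - z]. *)
Lemma exchange_linear (q r : R) (X Y : C -> op) (aX bX aY bY : nat -> R) (cX cY : Z -> C)
    (AX AY : C) (BX DX BY DY : R) (sX tX sY tY : Z) :
  0 < q < 1 ->
  vertex_family q r X aX bX cX AX BX DX sX tX ->
  vertex_family q r Y aY bY cY AY BY DY sY tY ->
  (forall i, cX i * cY (i - sX)%Z = RtoC (-1) * (cY i * cX (i - sY)%Z))%C ->
  BX * IZR sY + DX * IZR tY = 1 -> BY * IZR sX + DY * IZR tX = 1 ->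
  (forall k, aX k * kap q r k * bY k = - 1 / INR (S k)) ->
  (forall k, aY k * kap q r k * bX k = - 1 / INR (S k)) ->
  exchange (fun _ => RtoC 1) X Y (fun _ => RtoC 1).
Proof.
  intros Hq HX HY Hc E1 E2 H12 H21.
  rewrite <- (shift_0 X), <- (shift_0 Y).
  apply (exchange_family q r X Y aX bX aY bY cX cY AX AY BX DX BY DY sX tX sY tY 0 0 1 (-1)
    (fun _ => -1) (fun w => RtoC 1 - w)%C
    (fun t => RtoC 1 - spectral_inv q t)%C (fun _ => RtoC 1)
    (fun t => RtoC 1 - spectral q t)%C (fun _ => RtoC 1) (fun _ => RtoC 1)); try assumption;
    try (apply regular_const, C1_nz).
  - apply exp_series_log.
  - unfold spectral_inv; entire_tac.
  - intros t _; rewrite spectral_inv_unshifted; field.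
  - unfold spectral; entire_tac.
  - intros t _; rewrite spectral_unshifted; field.
  - intros t _; rewrite spectral_inv_unshifted, spectral_unshifted, Rminus_0_r, Cplus_0_r, zpow_RtoC_1, spectral_inv_eq.
    field; apply spectral_neq_0.
Qed.

(** * Exchange relations with theta functions *)

Definition theta_quotient (p c : R) (w : C) : C :=
  (qpoch (RtoC (p / c) * w) [p] / qpoch (RtoC c * w) [p])%C.

Lemma ratios_1 (p : R) : 0 < p < 1 -> ratios [p].
Proof. intros H; repeat constructor; lra. Qed.

Lemma exp_series_theta_quotient (p c : R) :
  0 < p < 1 -> 0 < c ->
  exp_series (fun k => (c ^ k - (p / c) ^ k) / (1 - p ^ k)) (theta_quotient p c).
Proof.
  intros Hp Hc.
  pose proof (exp_series_qpoch [p] (ratios_1 p Hp)) as H; simpl in H.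
  pose proof (exp_series_dilate _ _ (p / c) ltac:(apply Rdiv_lt_0_compat; lra) H) as H1.
  pose proof (exp_series_opp _ _ (exp_series_dilate _ _ c Hc H)) as H2.
  eapply exp_series_ext; [| |exact (exp_series_plus _ _ _ _ H1 H2)].
  - intros k Hk; cbv beta.
    destruct k as [|k]; [lia|]; pose proof (pow_S_le p k Hp); field; lra.
  - intros w; reflexivity.
Qed.

(** The witnesses are [g = q^(1/2)], [h = z^(1/(2r))] and the part [Q] of the Gaussian prefactor
    common to both shifts, the squares [(t + 1/2)^2] and [(t - 1/2)^2] differing only in the sign of
    [t]. In these letters the theta identities become rational. *)
Lemma theta_half (q r : R) (t : C) :
  0 < q < 1 -> 0 < r ->
  let p := nome q r in
  exists Q h g : C, Q <> RtoC 0 /\ h <> RtoC 0 /\ g <> RtoC 0 /\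
    (g * g = RtoC q)%C /\ (h * h = zpow q t (RtoC (/ r)))%C /\
    theta q r (t + RtoC (1 / 2))%C = (Q * h / g * (qpoch (RtoC q * spectral q t) [p]
       * qpoch (RtoC (p / q) * spectral_inv q t) [p] * qpoch (RtoC p) [p]))%C /\
    theta q r (t - RtoC (1 / 2))%C = (Q * g / h * (qpoch (RtoC (/ q) * spectral q t) [p]
       * qpoch (RtoC (p * q) * spectral_inv q t) [p] * qpoch (RtoC p) [p]))%C.
Proof.
  intros Hq Hr p.
  assert (Hr0 : RtoC r <> RtoC 0) by (intros E; apply RtoC_inj in E; lra).
  assert (Hqq : RtoC q <> RtoC 0) by (intros E; apply RtoC_inj in E; lra).
  exists (qpow q (t * t / RtoC r - t + RtoC (/ (4 * r))))%C, (qpow q (t / RtoC r)%C),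
    (qpow q (RtoC (1 / 2))).
  repeat split; try apply qpow_neq_0.
  - rewrite <- qpow_add, <- RtoC_plus, qpow_RtoC; replace (1 / 2 + 1 / 2) with 1 by field.
    rewrite Rpower_1 by lra; reflexivity.
  - rewrite <- qpow_add; unfold zpow; f_equal; rewrite RtoC_inv by lra; field; exact Hr0.
  - unfold theta, Theta; fold p; f_equal.
    + match goal with |- _ = (?a * ?b / qpow q ?d)%C =>
        transitivity (a * b * qpow q (- d))%C; [|rewrite qpow_opp; reflexivity] end.
      rewrite <- !qpow_add; f_equal.
      rewrite RtoC_inv, RtoC_mult, RtoC_div by lra; field; exact Hr0.
    + replace (qpow q (RtoC 2 * (t + RtoC (1 / 2))))%C with (RtoC q * spectral q t)%C.
      * do 3 f_equal; rewrite spectral_inv_eq, RtoC_div by lra; field; split; [apply spectral_neq_0 | exact Hqq].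
      * unfold spectral; rewrite <- (Rpower_1 q) at 1 by lra; rewrite <- qpow_RtoC, <- qpow_add.
        f_equal; apply injective_projections; simpl; field.
  - unfold theta, Theta; fold p; f_equal.
    + match goal with |- _ = (?a * ?b / qpow q ?d)%C =>
        transitivity (a * b * qpow q (- d))%C; [|rewrite qpow_opp; reflexivity] end.
      rewrite <- !qpow_add; f_equal.
      rewrite RtoC_inv, RtoC_mult, RtoC_div by lra; field; exact Hr0.
    + replace (qpow q (RtoC 2 * (t - RtoC (1 / 2))))%C with (RtoC (/ q) * spectral q t)%C.
      * do 3 f_equal; rewrite spectral_inv_eq, RtoC_inv, RtoC_mult by lra; field;
          split; [apply spectral_neq_0 | exact Hqq].
      * unfold spectral; rewrite <- (Rpower_1 q) at 1 by lra; rewrite <- Rpower_Ropp.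
        rewrite <- qpow_RtoC, <- qpow_add.
        f_equal; apply injective_projections; simpl; field.
Qed.

Lemma qpoch_factor (p c : R) (w : C) :
  0 < p < 1 ->
  qpoch (RtoC c * w)%C [p] = ((RtoC 1 - RtoC c * w) * qpoch (RtoC (p * c) * w) [p])%C.
Proof.
  intros Hp; rewrite qpoch_cons by (apply ratios_1, Hp).
  replace (RtoC c * w * RtoC p)%C with (RtoC (p * c) * w)%C by (rewrite RtoC_mult; ring).
  reflexivity.
Qed.

(** [Tq], [Tm], [Um], [Up] stand for the products at [q z], [p z / q], [p / (q z)], [p q / z], and
    [P0] for the one at [p]. The minus sign and the power of [Z] come from
    [1 - z / q = - (z / q) (1 - q / z)]. *)
Lemma theta_identity_lower (Z h g Q Tq Tm Um Up P0 : C) :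
  Z <> RtoC 0 -> h <> RtoC 0 -> g <> RtoC 0 -> Q <> RtoC 0 -> Tq <> RtoC 0 -> Tm <> RtoC 0 ->
  Up <> RtoC 0 -> P0 <> RtoC 0 ->
  (RtoC 1 - g * g * / Z)%C <> RtoC 0 -> (RtoC 1 - / (g * g) * Z)%C <> RtoC 0 ->
  (h * h * / Z * (Um / ((RtoC 1 - g * g * / Z) * Up))
   = - (Q * h / g * (Tq * Um * P0) / (Q * g / h * ((RtoC 1 - / (g * g) * Z) * Tm * Up * P0)))
     * (Tm / Tq))%C.
Proof.
  intros HZ Hh Hg HQ H1 H2 H3 H4 H5 H6.
  assert (N : (Z - g * g)%C <> RtoC 0).
  { intros E; apply H5; transitivity ((Z - g * g) * / Z)%C; [field; exact HZ | rewrite E; ring]. }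
  assert (N' : (g * g - Z)%C <> RtoC 0).
  { intros E; apply N; transitivity (- (g * g - Z))%C; [ring | rewrite E; ring]. }
  field; repeat split; assumption.
Qed.

(** Mirror image of the preceding identity, from [1 - q z = - q z (1 - 1 / (q z))]; here [Tm] and
    [Tp] are the products at [z / q] and [p q z]. *)
Lemma theta_identity_upper (Z h g Q Tm Tp Um Up P0 : C) :
  Z <> RtoC 0 -> h <> RtoC 0 -> g <> RtoC 0 -> Q <> RtoC 0 -> Tm <> RtoC 0 -> Tp <> RtoC 0 ->
  Um <> RtoC 0 -> P0 <> RtoC 0 ->
  (RtoC 1 - / (g * g) * / Z)%C <> RtoC 0 -> (RtoC 1 - g * g * Z)%C <> RtoC 0 ->
  (/ (h * h) * / Z * (Up / ((RtoC 1 - / (g * g) * / Z) * Um))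
   = - (Q * g / h * (Tm * Up * P0) / (Q * h / g * ((RtoC 1 - g * g * Z) * Tp * Um * P0)))
     * (Tp / Tm))%C.
Proof.
  intros HZ Hh Hg HQ H1 H2 H3 H4 H5 H6.
  assert (N' : (g * g * Z - RtoC 1)%C <> RtoC 0).
  { intros E; apply H6; transitivity (- (g * g * Z - RtoC 1))%C; [ring | rewrite E; ring]. }
  field; repeat split; assumption.
Qed.

Lemma zpow_split_m1 (q : R) (t : C) (a : R) :
  zpow q t (RtoC (-1 + a)) = (zpow q t (RtoC a) * / spectral q t)%C.
Proof.
  rewrite RtoC_plus, Cplus_comm, zpow_add; f_equal.
  rewrite <- spectral_inv_eq; unfold zpow, spectral_inv; f_equal; ring.
Qed.

Lemma zpow_opp (q : R) (t : C) (a : R) : zpow q t (RtoC (- a)) = (/ zpow q t (RtoC a))%C.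
Proof. unfold zpow; rewrite <- qpow_opp; f_equal; rewrite RtoC_opp; ring. Qed.

Lemma qpoch_self_neq_0 (p : R) : 0 < p < 1 -> qpoch (RtoC p) [p] <> RtoC 0.
Proof.
  intros Hp; apply qpoch_neq_0; [apply ratios_1, Hp|].
  intros [y [Hy E]]; apply RtoC_inj in E; lra.
Qed.

(** The three nonvanishing conditions serve both [c = q] and [c = / q]: up to the nonzero constant
    [(p; p)_infinity] and powers of [q], they cover the denominators of the two quotients and of the
    ratio of theta functions. *)
Lemma exchange_theta_quotient (q r p c e : R) (X Y : C -> op) (aX bX aY bY : nat -> R)
    (cX cY : Z -> C) (AX AY : C) (BX DX BY DY : R) (sX tX sY tY : Z) (g : C -> C) :
  0 < q < 1 -> 0 < p < 1 -> 0 < c ->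
  vertex_family q r X aX bX cX AX BX DX sX tX ->
  vertex_family q r Y aY bY cY AY BY DY sY tY ->
  (forall i, cX i * cY (i - sX)%Z = RtoC 1 * (cY i * cX (i - sY)%Z))%C ->
  BX * IZR sY + DX * IZR tY = e -> BY * IZR sX + DY * IZR tX = e ->
  let al := fun k => (c ^ k - (p / c) ^ k) / (1 - p ^ k) in
  (forall k, aX k * kap q r k * bY k = al (S k) / INR (S k)) ->
  (forall k, aY k * kap q r k * bX k = al (S k) / INR (S k)) ->
  (forall t,
    qpoch (RtoC q * spectral q t)%C [p] <> RtoC 0 ->
    qpoch (RtoC (/ q) * spectral q t)%C [p] <> RtoC 0 ->
    qpoch (RtoC c * spectral_inv q t)%C [p] <> RtoC 0 ->
    (zpow q t (RtoC e) * theta_quotient p c (spectral_inv q t)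
     = g t * theta_quotient p c (spectral q t))%C) ->
  exchange (fun _ => RtoC 1) X Y g.
Proof.
  intros Hq Hp Hcp HX HY Hc E1 E2 al H12 H21 Hg.
  rewrite <- (shift_0 X), <- (shift_0 Y).
  assert (Hpc : 0 < p / c) by (apply Rdiv_lt_0_compat; lra).
  assert (Hqi : 0 < / q) by (apply Rinv_0_lt_compat; lra).
  pose proof (negative_arg_spectral q Hq) as Nv; pose proof (negative_arg_spectral_inv q Hq) as Ni.
  set (T := fun c t => qpoch (RtoC c * spectral q t)%C [p]).
  set (U := fun c t => qpoch (RtoC c * spectral_inv q t)%C [p]).
  assert (RT : forall c, 0 < c -> regular q (T c))
    by (intros; apply regular_dilated_qpoch; try apply ratios_1; try apply Rlt_le; assumption).
  assert (RU : forall c, 0 < c -> regular q (U c))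
    by (intros; apply regular_dilated_qpoch; try apply ratios_1; try apply Rlt_le; assumption).
  apply (exchange_family q r X Y aX bX aY bY cX cY AX AY BX DX BY DY sX tX sY tY 0 0 e 1
    al (theta_quotient p c) (U (p / c)) (U c) (T (p / c)) (T c)
    (fun t => T q t * T (/ q)%R t * U c t)%C); try assumption.
  - apply exp_series_theta_quotient; lra.
  - apply RU; lra.
  - apply RU; lra.
  - intros t _; rewrite spectral_inv_unshifted; reflexivity.
  - apply RT; lra.
  - apply RT; lra.
  - intros t _; rewrite spectral_unshifted; reflexivity.
  - split_regular; match goal with
      | |- regular _ (fun t => T ?c t) => apply (RT c)
      | |- regular _ (fun t => U ?c t) => apply (RU c)
      end; lra.
  - intros t Ht; rewrite spectral_inv_unshifted, spectral_unshifted, Rminus_0_r, Cplus_0_r.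
    apply Cmult_neq_0_inv in Ht; destruct Ht as [Ht H3].
    apply Cmult_neq_0_inv in Ht; destruct Ht as [H1 H2].
    rewrite !Cmult_1_l; apply Hg; assumption.
Qed.

Lemma theta_exchange_scalar_lower (q r : R) (t : C) :
  0 < q < 1 -> 0 < r ->
  let p := nome q r in
  qpoch (RtoC q * spectral q t)%C [p] <> RtoC 0 ->
  qpoch (RtoC (/ q) * spectral q t)%C [p] <> RtoC 0 ->
  qpoch (RtoC q * spectral_inv q t)%C [p] <> RtoC 0 ->
  (zpow q t (RtoC (-1 + / r)) * theta_quotient p q (spectral_inv q t)
   = - (theta q r (t + RtoC (1 / 2)) / theta q r (t - RtoC (1 / 2)))
     * theta_quotient p q (spectral q t))%C.
Proof.
  intros Hq Hr p N1 N2 N3.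
  assert (Hp : 0 < p < 1) by (apply nome_bounds; lra).
  destruct (theta_half q r t Hq Hr) as [Q [h [g [HQ [Hh [Hg [Eg [Eh [Ep Em]]]]]]]]].
  rewrite zpow_split_m1, Ep, Em, <- Eh; fold p; unfold theta_quotient.
  rewrite (qpoch_factor p q (spectral_inv q t)), (qpoch_factor p (/ q)) in * by exact Hp.
  rewrite RtoC_inv, <- Eg, spectral_inv_eq in * by lra.
  apply Cmult_neq_0_inv in N2; destruct N2; apply Cmult_neq_0_inv in N3; destruct N3.
  apply theta_identity_lower; try assumption; [apply spectral_neq_0 | apply qpoch_self_neq_0, Hp].
Qed.

Lemma theta_exchange_scalar_upper (q r : R) (t : C) :
  0 < q < 1 -> 0 < r ->
  let p := nome q r in
  qpoch (RtoC q * spectral q t)%C [p] <> RtoC 0 ->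
  qpoch (RtoC (/ q) * spectral q t)%C [p] <> RtoC 0 ->
  qpoch (RtoC (/ q) * spectral_inv q t)%C [p] <> RtoC 0 ->
  (zpow q t (RtoC (-1 + - / r)) * theta_quotient p (/ q) (spectral_inv q t)
   = - (theta q r (t - RtoC (1 / 2)) / theta q r (t + RtoC (1 / 2)))
     * theta_quotient p (/ q) (spectral q t))%C.
Proof.
  intros Hq Hr p N1 N2 N3.
  assert (Hp : 0 < p < 1) by (apply nome_bounds; lra).
  destruct (theta_half q r t Hq Hr) as [Q [h [g [HQ [Hh [Hg [Eg [Eh [Ep Em]]]]]]]]].
  rewrite zpow_split_m1, zpow_opp, Ep, Em, <- Eh; fold p; unfold theta_quotient.
  replace (p / / q) with (p * q) by (field; lra).
  rewrite (qpoch_factor p (/ q) (spectral_inv q t)), (qpoch_factor p q (spectral q t)) in * by exact Hp.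
  rewrite RtoC_inv, <- Eg, spectral_inv_eq in * by lra.
  apply Cmult_neq_0_inv in N1; destruct N1; apply Cmult_neq_0_inv in N3; destruct N3.
  apply theta_identity_upper; try assumption; [apply spectral_neq_0 | apply qpoch_self_neq_0, Hp].
Qed.

(** * The scalar factor [rho] *)

Definition rho_num (q p : R) (w : C) : C :=
  let br := fun x => qpoch x [p; q ^ 6] in
  (br (RtoC (q ^ 2) * w) * (br (RtoC (q ^ 3) * w) * br (RtoC (q ^ 3) * w))
    * br (RtoC (q ^ 4) * w))%C.

Definition rho_den (q p : R) (w : C) : C :=
  let br := fun x => qpoch x [p; q ^ 6] in
  (br (RtoC (q ^ 0) * w) * br (RtoC (q ^ 1) * w) * br (RtoC (q ^ 5) * w) * br (RtoC (q ^ 6) * w))%C.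

Lemma ratios_2 (q p : R) : 0 < q < 1 -> 0 < p < 1 -> ratios [p; q ^ 6].
Proof.
  intros Hq Hp; assert (0 < q ^ 6) by (apply pow_lt; lra); pose proof (pow_S_le q 5 Hq).
  repeat constructor; lra.
Qed.

Definition rho_alpha (q p : R) (k : nat) : R :=
  let s := q ^ k in
  (1 + s - s ^ 2 - 2 * s ^ 3 - s ^ 4 + s ^ 5 + s ^ 6) / (1 - (q ^ 6) ^ k) / (1 - p ^ k).

(** A factor [(q^n w; p, q^6)_infinity] contributes [- s^n / ((1 - p^k) (1 - s^6))], so the
    polynomial in [rho_alpha] dictates which [n] occur above (2, 3, 3, 4) and below (0, 1, 5, 6). *)
Lemma exp_series_rho (q p : R) :
  0 < q < 1 -> 0 < p < 1 ->
  exp_series (rho_alpha q p) (fun w => rho_num q p w / rho_den q p w)%C.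
Proof.
  intros Hq Hp.
  pose proof (exp_series_qpoch _ (ratios_2 q p Hq Hp)) as H; cbn [fold_right] in H.
  assert (E : forall n, exp_series (fun k => -1 / (1 - (q ^ 6) ^ k) / (1 - p ^ k) * (q ^ n) ^ k)
    (fun w => qpoch (RtoC (q ^ n) * w)%C [p; q ^ 6])).
  { intros n; apply (exp_series_dilate _ (fun w => qpoch w [p; q ^ 6])); [apply pow_lt; lra | exact H]. }
  pose proof (exp_series_plus _ _ _ _ (exp_series_plus _ _ _ _ (E 2%nat)
    (exp_series_plus _ _ _ _ (E 3%nat) (E 3%nat))) (E 4%nat)) as HN.
  pose proof (exp_series_plus _ _ _ _ (exp_series_plus _ _ _ _
    (exp_series_plus _ _ _ _ (E 0%nat) (E 1%nat)) (E 5%nat)) (E 6%nat)) as HD.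
  eapply exp_series_ext; [| |exact (exp_series_plus _ _ _ _ HN (exp_series_opp _ _ HD))].
  - intros [|k] Hk; [lia|]; cbv beta; unfold rho_alpha.
    assert (P : forall n, (q ^ n) ^ S k = (q ^ S k) ^ n)
      by (intros n; rewrite <- !pow_mult; f_equal; lia).
    pose proof (pow_S_le p k Hp).
    assert (H6 : 0 < q ^ 6 < 1).
    { pose proof (pow_S_le q 5 Hq); split; [apply pow_lt; lra | lra]. }
    pose proof (pow_S_le (q ^ 6) k H6) as N6; rewrite P in N6.
    rewrite !P; set (s := q ^ S k) in *.
    assert (D6 : 1 - s ^ 6 <> 0) by lra; assert (Dp : 1 - p ^ S k <> 0) by lra.
    set (d6 := 1 - s ^ 6) in *; set (dp := 1 - p ^ S k) in *.
    clearbody d6 dp s; field; split; assumption.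
  - intros w; reflexivity.
Qed.

(** With [R = rho_num / rho_den] the infinite products are [R(p z) / R(1 / z)]; the two values of
    [R] are the contractions of [K^(-1)] with a vertex operator in the two orderings. *)
Lemma rho_eq (q r : R) (t : C) :
  q <> 0 ->
  rho q r t
  = (- RtoC q * zpow q t (RtoC (/ r))
     * ((rho_num q (nome q r) (RtoC (nome q r) * spectral q t) * rho_den q (nome q r) (spectral_inv q t))
        / (rho_den q (nome q r) (RtoC (nome q r) * spectral q t) * rho_num q (nome q r) (spectral_inv q t))))%C.
Proof.
  intros Hq; unfold rho, rho_num, rho_den; cbv zeta; fold (spectral q t).
  set (br := fun x => qpoch x [nome q r; q ^ 6]); set (p := RtoC (nome q r)); set (z := spectral q t).
  rewrite (spectral_inv_eq q t); fold z.
  assert (P0 : forall w, (RtoC (q ^ 0) * w)%C = w) by (intros; simpl; ring).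
  assert (P1 : forall w, (RtoC (q ^ 1) * w)%C = (RtoC q * w)%C) by (intros; rewrite pow_1; reflexivity).
  assert (P : forall n w, (RtoC (q ^ n) * w = RtoC q ^ n * w)%C) by (intros; rewrite RtoC_pow; reflexivity).
  rewrite !P0, !P1, !P.
  assert (A : forall n, (p * RtoC q ^ n * z = RtoC q ^ n * (p * z))%C) by (intros; ring).
  assert (A1 : (p * RtoC q * z = RtoC q * (p * z))%C) by ring.
  rewrite !A, A1; unfold Cdiv; f_equal; f_equal; [|f_equal]; simpl; ring.
Qed.

Lemma regular_rho_num (q p : R) (w : C -> C) :
  0 < q < 1 -> 0 < p < 1 -> negative_arg q w -> regular q (fun t => rho_num q p (w t)).
Proof.
  intros Hq Hp Hw.
  assert (R : forall n, regular q (fun t => qpoch (RtoC (q ^ n) * w t)%C [p; q ^ 6])).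
  { intros n; apply regular_dilated_qpoch; [apply ratios_2; assumption | apply pow_le; lra | exact Hw]. }
  unfold rho_num; split_regular; apply R.
Qed.

Lemma regular_rho_den (q p : R) (w : C -> C) :
  0 < q < 1 -> 0 < p < 1 -> negative_arg q w -> regular q (fun t => rho_den q p (w t)).
Proof.
  intros Hq Hp Hw.
  assert (R : forall n, regular q (fun t => qpoch (RtoC (q ^ n) * w t)%C [p; q ^ 6])).
  { intros n; apply regular_dilated_qpoch; [apply ratios_2; assumption | apply pow_le; lra | exact Hw]. }
  unfold rho_den; split_regular; apply R.
Qed.

Ltac regular_rho :=
  split_regular; match goal with
    | |- regular ?q (fun t => rho_num _ ?p (@?w t)) => apply (regular_rho_num q p w)
    | |- regular ?q (fun t => rho_den _ ?p (@?w t)) => apply (regular_rho_den q p w)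
    end; assumption.

Lemma exp_series_qK (q r : R) :
  0 < q < 1 -> 0 < r ->
  exp_series (fun k => rho_alpha q (nome q r) k * Rpower q r ^ k)
    (fun w => rho_num q (nome q r) (RtoC (Rpower q r) * w)
       / rho_den q (nome q r) (RtoC (Rpower q r) * w))%C.
Proof.
  intros Hq Hr.
  apply (exp_series_dilate _
    (fun w => rho_num q (nome q r) w / rho_den q (nome q r) w)%C); [apply exp_pos|].
  apply exp_series_rho; [exact Hq | apply nome_bounds; assumption].
Qed.

Lemma qK_rho_alpha (q r : R) (k : nat) :
  0 < q < 1 -> 0 < r ->
  qK q r (INR (S k)) = rho_alpha q (nome q r) (S k) * Rpower q r ^ S k.
Proof. intros Hq Hr; rewrite qK_eq by assumption; unfold rho_alpha; ring. Qed.

(** Accounts for the shifts in the relations: [(r + 1) / 2 - 1 / 2 = r / 2] for type I and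
    [(r + 1) / 2 - 1 = (r - 1) / 2] for type II, so the factor [q^r], respectively [q^(r-1)], of the
    contraction turns the arguments into [1 / z] and, in the next lemma, [p z]. *)
Lemma spectral_shift_neg (q r d : R) (t : C) :
  r + 2 * d = 0 ->
  (RtoC (Rpower q r) * qpow q (RtoC 2 * (- t + RtoC d)))%C = spectral_inv q t.
Proof.
  intros E; rewrite <- qpow_RtoC, <- qpow_add; unfold spectral_inv; f_equal.
  replace r with (- (2 * d)) by lra; rewrite RtoC_opp, RtoC_mult; ring.
Qed.

Lemma spectral_shift_pos (q r d : R) (t : C) :
  2 * d = r ->
  (RtoC (Rpower q r) * qpow q (RtoC 2 * (t + RtoC d)))%C = (RtoC (nome q r) * spectral q t)%C.
Proof.
  intros E; unfold nome; rewrite <- !qpow_RtoC; unfold spectral; rewrite <- !qpow_add; f_equal.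
  rewrite <- E, !RtoC_mult; ring.
Qed.

Lemma zpow_shift (q : R) (t : C) (d a : R) :
  zpow q (t + RtoC d)%C (RtoC a) = (zpow q t (RtoC a) * RtoC (Rpower q (2 * d * a)))%C.
Proof.
  rewrite <- qpow_RtoC; unfold zpow; rewrite <- qpow_add; f_equal; rewrite !RtoC_mult; ring.
Qed.

Lemma exchange_K_Phi (q r : R) (h0 P0 : C) :
  0 < q < 1 -> 0 < r - 1 ->
  exchange (rho q r) (Kmp q r h0 P0) (fun u => Phi_minus q r h0 P0 (u + RtoC (1 / 2))%C)
    (fun _ => RtoC 1).
Proof.
  intros Hq Hr; destruct (vertex_family_K q r h0 P0 Hq Hr) as [cc HK].
  set (p := nome q r).
  assert (Hp : 0 < p < 1) by (apply nome_bounds; lra).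
  set (wi := spectral_inv q); set (wp := fun t => (RtoC p * spectral q t)%C).
  assert (Ni : negative_arg q wi) by (apply negative_arg_spectral_inv, Hq).
  assert (Np : negative_arg q wp)
    by (apply negative_arg_scal; [lra | apply negative_arg_spectral, Hq]).
  assert (Ex : forall t, (RtoC (Rpower q r)
    * qpow q (RtoC 2 * (- t + RtoC (1 / 2 - (r + 1) / 2))))%C = wi t)
    by (intros t; apply spectral_shift_neg; field).
  assert (Ey : forall t, (RtoC (Rpower q r)
    * qpow q (RtoC 2 * (t + RtoC ((r + 1) / 2 - 1 / 2))))%C = wp t)
    by (intros t; apply spectral_shift_pos; field).
  apply (exchange_family q r (currK_inv q r h0 P0) (Phi_minus q r h0 P0) _ _ _ _ _ _ _ _ _ _ _ _
    _ _ _ _ ((r + 1) / 2) (1 / 2) (- / r) (-1)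
    (fun k => rho_alpha q p k * Rpower q r ^ k)
    (fun w => rho_num q p (RtoC (Rpower q r) * w) / rho_den q p (RtoC (Rpower q r) * w))%C
    (fun t => rho_num q p (wi t)) (fun t => rho_den q p (wi t))
    (fun t => rho_num q p (wp t)) (fun t => rho_den q p (wp t))
    (fun t => rho_num q p (wi t) * rho_den q p (wi t) * rho_den q p (wp t))%C
    (rho q r) (fun _ => RtoC 1) Hq HK (vertex_family_Phi q r h0 P0 Hr)).
  - intros i; rewrite parity_pred, RtoC_opp; ring.
  - simpl; field; lra.
  - simpl; field; lra.
  - intros k; rewrite contraction_K_Phi, qK_rho_alpha by lra; reflexivity.
  - intros k; rewrite contraction_Phi_K, qK_rho_alpha by lra; reflexivity.
  - apply exp_series_qK; lra.
  - apply regular_rho_num; assumption.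
  - apply regular_rho_den; assumption.
  - intros t _; rewrite Ex; reflexivity.
  - apply regular_rho_num; assumption.
  - apply regular_rho_den; assumption.
  - intros t _; rewrite Ey; reflexivity.
  - regular_rho.
  - intros t Ht; rewrite Ex, Ey, rho_eq, zpow_shift, zpow_opp by lra.
    fold p; fold (wp t); fold wi.
    (* The zero modes give [- (q^r z)^(-1/r) = - q^(-1) z^(-1/r)], the inverse of the prefactor of
       [rho]. *)
    replace (2 * ((r + 1) / 2 - 1 / 2) * - / r) with (- (1)) by (field; lra).
    rewrite Rpower_Ropp, Rpower_1, (RtoC_inv q) by lra.
    apply Cmult_neq_0_inv in Ht; destruct Ht as [Ht H3].
    apply Cmult_neq_0_inv in Ht; destruct Ht as [H1 H2].
    assert (Hz : zpow q t (RtoC (/ r)) <> RtoC 0) by apply qpow_neq_0.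
    assert (RtoC q <> RtoC 0) by (intros E; apply RtoC_inj in E; lra).
    field; repeat split; assumption.
Qed.

Lemma exchange_K_Psi (q r : R) (h0 P0 : C) :
  0 < q < 1 -> 0 < r - 1 ->
  exchange (fun _ => RtoC 1) (Kmp q r h0 P0) (fun u => Psi_minus_star q r h0 P0 (u + RtoC 1)%C)
    (rho q (r - 1)).
Proof.
  intros Hq Hr; destruct (vertex_family_K q r h0 P0 Hq Hr) as [cc HK].
  set (p := nome q (r - 1)).
  assert (Hp : 0 < p < 1) by (apply nome_bounds; lra).
  set (wi := spectral_inv q); set (wp := fun t => (RtoC p * spectral q t)%C).
  assert (Ni : negative_arg q wi) by (apply negative_arg_spectral_inv, Hq).
  assert (Np : negative_arg q wp)
    by (apply negative_arg_scal; [lra | apply negative_arg_spectral, Hq]).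
  assert (Ex : forall t, (RtoC (Rpower q (r - 1))
    * qpow q (RtoC 2 * (- t + RtoC (1 - (r + 1) / 2))))%C = wi t)
    by (intros t; apply spectral_shift_neg; field).
  assert (Ey : forall t, (RtoC (Rpower q (r - 1))
    * qpow q (RtoC 2 * (t + RtoC ((r + 1) / 2 - 1))))%C = wp t)
    by (intros t; apply spectral_shift_pos; field).
  apply (exchange_family q r (currK_inv q r h0 P0) (Psi_minus_star q r h0 P0) _ _ _ _ _ _ _ _ _ _ _ _
    _ _ _ _ ((r + 1) / 2) 1 (/ (r - 1)) (-1)
    (fun k => - (rho_alpha q p k * Rpower q (r - 1) ^ k))
    (fun w => / (rho_num q p (RtoC (Rpower q (r - 1)) * w)
       / rho_den q p (RtoC (Rpower q (r - 1)) * w)))%C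
    (* With [N] and [D] the values of [rho_num] and [rho_den], the inverse of [N / D] is written as
       [D D / (N D)], so that the zeros of [D] are among the excluded points. *)
    (fun t => rho_den q p (wi t) * rho_den q p (wi t))%C
    (fun t => rho_num q p (wi t) * rho_den q p (wi t))%C
    (fun t => rho_den q p (wp t) * rho_den q p (wp t))%C
    (fun t => rho_num q p (wp t) * rho_den q p (wp t))%C
    (fun t => rho_num q p (wi t) * rho_den q p (wi t)
       * (rho_num q p (wp t) * rho_den q p (wp t)))%C
    (fun _ => RtoC 1) (rho q (r - 1)) Hq HK (vertex_family_Psi q r h0 P0 Hr)).
  - intros i; replace (i - -1)%Z with (i + 1)%Z by lia.
    rewrite Z.sub_0_r, !parity_succ, !RtoC_opp; ring.
  - simpl; field; lra.
  - simpl; field; lra.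
  - intros k; rewrite contraction_K_Psi, qK_rho_alpha by lra; reflexivity.
  - intros k; rewrite contraction_Psi_K, qK_rho_alpha by lra; reflexivity.
  - apply exp_series_opp, exp_series_qK; lra.
  - apply entire_mult; apply regular_rho_den; assumption.
  - regular_rho.
  - intros t Ht; rewrite Ex; apply Cmult_neq_0_inv in Ht; field; split; apply Ht.
  - apply entire_mult; apply regular_rho_den; assumption.
  - regular_rho.
  - intros t Ht; rewrite Ey; apply Cmult_neq_0_inv in Ht; field; split; apply Ht.
  - regular_rho.
  - intros t Ht; rewrite Ex, Ey, rho_eq, zpow_shift by lra.
    fold p; fold (wp t); fold wi.
    (* Here the zero modes give [- q z^(1/(r-1))], the prefactor of [rho] itself; the contraction
       has the opposite sign too, so [rho] stands on the other side. *)
    replace (2 * ((r + 1) / 2 - 1) * / (r - 1)) with 1 by (field; lra).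
    rewrite Rpower_1 by lra.
    apply Cmult_neq_0_inv in Ht; destruct Ht as [Ht Ht'].
    apply Cmult_neq_0_inv in Ht; destruct Ht as [H1 H2].
    apply Cmult_neq_0_inv in Ht'; destruct Ht' as [H3 H4].
    field; repeat split; assumption.
Qed.

Theorem theorem6p2 (q r : R) (h0 P0 : C)
    (hq0 : 0 < q) (hq1 : q < 1) (hr : 0 < r) (hrs : 0 < r - 1) :
  let one := fun _ : C => RtoC 1 in
  let half := RtoC (1 / 2) in
  let E := currE q r h0 P0 in
  let F := currF q r h0 P0 in
  let K := Kmp q r h0 P0 in
  let Phi := Phi_minus q r h0 P0 in
  let Psi := Psi_minus_star q r h0 P0 in
  let br := theta q r in
  let brs := theta q (r - 1) in
  (* type I *)
  (exchange (rho q r) K (fun u => Phi (u + half)%C) one /\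
   exchange one Phi E one /\
   (forall u, commutes (Phi u) (hP_fun h0 P0 (fun _ P => P))) /\
   exchange one Phi F (fun u => - (br (u + half) / br (u - half)))%C) /\
  (* type II *)
  (exchange one K (fun u => Psi (u + RtoC 1)%C) (rho q (r - 1)) /\
   exchange one Psi F one /\
   (forall u, commutes (Psi u) (hP_fun h0 P0 (fun h P => P + h / RtoC 2)%C)) /\
   exchange one Psi E (fun u => - (brs (u - half) / brs (u + half)))%C).
Proof.
  assert (Hq : 0 < q < 1) by (split; assumption).
  intros one half E F K Phi Psi br brs.
  pose proof (vertex_family_E q r h0 P0 hrs) as VE.
  pose proof (vertex_family_F q r h0 P0 hrs) as VF.
  pose proof (vertex_family_Phi q r h0 P0 hrs) as VPhi.
  pose proof (vertex_family_Psi q r h0 P0 hrs) as VPsi.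
  split; (split; [|split; [|split]]).
  - exact (exchange_K_Phi q r h0 P0 Hq hrs).
  (* Moving [e^alphahat] of [Phi_minus] past [e^(-Q)] of [E] gives the sign -1 needed in
     [- z (1 - 1 / z) = 1 - z]. *)
  - apply (exchange_linear q r _ _ _ _ _ _ _ _ _ _ _ _ _ _ _ _ _ _ Hq VPhi VE).
    + intros i; rewrite !parity_pred, !RtoC_opp; ring.
    + simpl; field; lra.
    + simpl; field; lra.
    + intros k; apply contraction_Phi_E; assumption.
    + intros k; apply contraction_E_Phi; assumption.
  - intros u; apply (commutes_vertex _ _ _ _ _ _ _ h0 P0 (fun _ P => P) (VPhi u)).
    intros i j; rewrite Z.sub_0_r; reflexivity.
  - apply (exchange_theta_quotient q r (nome q r) q (-1 + / r) _ _ _ _ _ _ _ _ _ _ _ _ _ _ _ _ _ _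
      _ Hq (nome_bounds q r Hq hr) hq0 VPhi VF).
    + intros i; ring.
    + simpl; field; lra.
    + simpl; field; lra.
    + intros k; rewrite contraction_Phi_F, qnum_ratio_lower by assumption; reflexivity.
    + intros k; rewrite contraction_F_Phi, qnum_ratio_lower by assumption; reflexivity.
    + intros t; apply theta_exchange_scalar_lower; assumption.
  - exact (exchange_K_Psi q r h0 P0 Hq hrs).
  - apply (exchange_linear q r _ _ _ _ _ _ _ _ _ _ _ _ _ _ _ _ _ _ Hq VPsi VF).
    + intros i; replace (i - -1)%Z with (i + 1)%Z by lia.
      rewrite !parity_succ, !RtoC_opp; ring.
    + simpl; field; lra.
    + simpl; field; lra.
    + intros k; apply contraction_Psi_F; assumption.
    + intros k; apply contraction_F_Psi; assumption.
  (* [e^(-alphahat)] lowers [h] by 2 and [e^Q] raises [P] by 1, so [P + h / 2] is unchanged. *)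
  - intros u; apply (commutes_vertex _ _ _ _ _ _ _ h0 P0 _ (VPsi u)).
    intros i j; rewrite !minus_IZR; apply injective_projections; simpl; field.
  (* Both operators carry exponentials of [alphahat] and of [Q], and the two reordering signs
     cancel. *)
  - apply (exchange_theta_quotient q r (nome q (r - 1)) (/ q) (-1 + - / (r - 1)) _ _ _ _ _ _ _ _ _ _
      _ _ _ _ _ _ _ _ _ Hq (nome_bounds q (r - 1) Hq hrs) (Rinv_0_lt_compat q hq0) VPsi VE).
    + intros i; replace (i - -1 - 1)%Z with i by lia; replace (i - 1 + 1)%Z with i by lia.
      rewrite parity_succ, parity_pred; ring.
    + simpl; field; lra.
    + simpl; field; lra.
    + intros k; rewrite contraction_Psi_E, qnum_ratio_upper by assumption; reflexivity.
    + intros k; rewrite contraction_E_Psi, qnum_ratio_upper by assumption; reflexivity.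
    + intros t; apply theta_exchange_scalar_upper; assumption.
Qed.
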